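(* Let $k$ be an algebraically closed field of characteristic zero, let $f\in R=k[x,y,z]$ be a reduced homogeneous polynomial of degree $d\geq 3$, and let $X=V(f)\subset\mathbb{P}_k^2$ be the reduced projective plane curve defined by $f$. If every singular point of $X$ is a simple singularity (that is, of type $\mathrm{A}_k$, $\mathrm{D}_k$, $\mathrm{E}_6$, $\mathrm{E}_7$ or $\mathrm{E}_8$), then $X$ is of gradient linear type, i.e. the gradient ideal $J(f)=(\partial f/\partial x,\partial f/\partial y,\partial f/\partial z)\subset R$ is of linear type.
   Context: An ideal $I=(f_1,\ldots,f_m)$ of a commutative Noetherian ring $A$ is of linear type if the natural surjective $A$-algebra homomorphism $\mathrm{Sym}_A(I)\to\mathcal{R}_A(I)=A[f_1t,\ldots,f_mt]\subset A[t]$ from the symmetric algebra to the Rees algebra of $I$ is injective. Simple singularities: let $p$ be a singular point of $X$; after a projective transformation assume $p=[0:0:1]$, put $F(x,y)=f(x,y,1)$, and let $(X_z,(0,0))$ be the germ at the origin of the affine curve $X_z=V(F)\subset\mathbb{A}_k^2$. Let $\mathrm{m}_p(f)$ be the multiplicity of $X$ at $p$. If $\mathrm{m}_p(f)=2$, then $p$ is an $\mathrm{A}_k$ singularity ($k\geq 1$ an integer) if the germ is analytically equivalent to $(V(y^2-x^{k+1}),(0,0))$. If $\mathrm{m}_p(f)=3$, then $p$ is: a $\mathrm{D}_{k+3}$ singularity ($k\geq 1$ an integer) if the germ is analytically equivalent to $(V(y^2x-x^{k+2}),(0,0))$; an $\mathrm{E}_6$ singularity if it is analytically equivalent to $(V(x^3-y^4),(0,0))$;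 an $\mathrm{E}_7$ singularity if it is analytically equivalent to $(V(y^3-yx^3),(0,0))$; an $\mathrm{E}_8$ singularity if it is analytically equivalent to $(V(x^3-y^5),(0,0))$. Here the germs of $V(F)$ and $V(g)$ at the origin (with $F,g$ reduced) are analytically equivalent if $k[[x,y]]/(F)\cong k[[x,y]]/(g)$ as $k$-algebras. *)

(* Defs.v *)
From HB Require Import structures.
From mathcomp Require Import all_boot all_order all_algebra.
From mathcomp Require Import ring_quotient finmap.
From mathcomp Require Import boolp classical_sets.
From mathcomp Require monalg.
From mathcomp Require Import mpoly.

Set Implicit Arguments.
Unset Strict Implicit.
Unset Printing Implicit Defensive.

Import GRing.Theory.
Local Open Scope ring_scope.
Local Open Scope quotient_scope.

Section Ideals.
Variables (A : comNzRingType) (G : set A).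

Definition ideal_span : {pred A} := fun x =>
  `[< exists2 s : seq (A * A),
        forall c, c \in s -> G c.2 & x = \sum_(c <- s) c.1 * c.2 >].

Lemma ideal_spanP x :
  reflect (exists2 s : seq (A * A),
             forall c, c \in s -> G c.2 & x = \sum_(c <- s) c.1 * c.2)
          (x \in ideal_span).
Proof. exact: asboolP. Qed.

Lemma mem_ideal_span x : G x -> x \in ideal_span.
Proof.
move=> Gx; apply/ideal_spanP; exists [:: (1, x)]; last first.
  by rewrite big_seq1 mul1r.
by move=> c; rewrite inE => /eqP->.
Qed.

Lemma ideal_span0 : 0 \in ideal_span.
Proof. by apply/ideal_spanP; exists [::]; rewrite ?big_nil. Qed.

Lemma ideal_spanD x y :
  x \in ideal_span -> y \in ideal_span -> x + y \in ideal_span.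
Proof.
move=> /ideal_spanP[s sG ->] /ideal_spanP[t tG ->]; apply/ideal_spanP.
exists (s ++ t); last by rewrite big_cat.
by move=> c; rewrite mem_cat => /orP[/sG|/tG].
Qed.

Lemma ideal_spanM a x : x \in ideal_span -> a * x \in ideal_span.
Proof.
move=> /ideal_spanP[s sG ->]; apply/ideal_spanP.
exists [seq (a * c.1, c.2) | c <- s].
  by move=> c /mapP[d /sG Gd ->].
by rewrite big_map mulr_sumr; apply: eq_bigr => c _; rewrite mulrA.
Qed.

Lemma ideal_span_zmod_closed : zmod_closed ideal_span.
Proof.
split=> [|x y xI yI]; first exact: ideal_span0.
by apply: ideal_spanD => //; rewrite -mulN1r; apply: ideal_spanM.
Qed.

HB.instance Definition _ :=
  GRing.isZmodClosed.Build A ideal_span ideal_span_zmod_closed.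

End Ideals.

(* The ideal may be improper, hence the quotient is only a [comPzRingType]
   (the library's quotient ring assumes a proper ideal). *)
Section Quotient.
Variables (K : comNzRingType) (A : comAlgType K) (G : set A).

Definition quotAlg := Quotient.quot (ideal_span G).

HB.instance Definition _ := GRing.Zmodule.on quotAlg.

Definition quotAlg_pi (x : A) : quotAlg := \pi_(Quotient.quot (ideal_span G)) x.
Local Notation pi := quotAlg_pi.

Lemma quotAlg_piP x y : pi x = pi y <-> x - y \in ideal_span G.
Proof. by rewrite Quotient.idealrBE; split=> [/eqP|/eqP]. Qed.

Lemma quotAlg_reprK (x : quotAlg) : pi (repr x) = x.
Proof. exact: reprK. Qed.

Lemma quotAlg_repr_pi x : repr (pi x) - x \in ideal_span G.
Proof. by apply/quotAlg_piP; rewrite quotAlg_reprK. Qed.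

Lemma quotAlg_pi_is_zmod_morphism : zmod_morphism pi.
Proof. by move=> x y; rewrite /quotAlg_pi Quotient.pi_add Quotient.pi_opp. Qed.

HB.instance Definition _ := GRing.isZmodMorphism.Build A quotAlg pi
  quotAlg_pi_is_zmod_morphism.

Definition quotAlg_one : quotAlg := pi 1.
Definition quotAlg_mul (x y : quotAlg) : quotAlg := pi (repr x * repr y).
Definition quotAlg_scale (c : K) (x : quotAlg) : quotAlg := pi (c *: repr x).

Lemma quotAlg_pi_mul x y : quotAlg_mul (pi x) (pi y) = pi (x * y).
Proof.
apply/quotAlg_piP; set x' := repr _; set y' := repr _.
have -> : x' * y' - x * y = x' * (y' - y) + y * (x' - x).
  by rewrite !mulrBr addrA [y * x']mulrC subrK [y * x]mulrC.
by apply: ideal_spanD; apply: ideal_spanM; apply: quotAlg_repr_pi.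
Qed.

Lemma quotAlg_pi_scale c x : quotAlg_scale c (pi x) = pi (c *: x).
Proof.
apply/quotAlg_piP; rewrite -scalerBr -mulr_algl.
exact/ideal_spanM/quotAlg_repr_pi.
Qed.

Let qE := (quotAlg_pi_mul, quotAlg_pi_scale).

Lemma quotAlg_mulA : associative quotAlg_mul.
Proof.
move=> x y z.
by rewrite -[x]quotAlg_reprK -[y]quotAlg_reprK -[z]quotAlg_reprK !qE mulrA.
Qed.

Lemma quotAlg_mulC : commutative quotAlg_mul.
Proof.
by move=> x y; rewrite -[x]quotAlg_reprK -[y]quotAlg_reprK !qE mulrC.
Qed.

Lemma quotAlg_mul1 : left_id quotAlg_one quotAlg_mul.
Proof. by move=> x; rewrite -[x]quotAlg_reprK !qE mul1r. Qed.

Lemma quotAlg_mulDl : left_distributive quotAlg_mul +%R.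
Proof.
move=> x y z.
rewrite -[x]quotAlg_reprK -[y]quotAlg_reprK -[z]quotAlg_reprK.
by rewrite -raddfD !qE mulrDl raddfD.
Qed.

HB.instance Definition _ := GRing.Zmodule_isComPzRing.Build quotAlg
  quotAlg_mulA quotAlg_mulC quotAlg_mul1 quotAlg_mulDl.

Lemma quotAlg_scaleA a b x :
  quotAlg_scale a (quotAlg_scale b x) = quotAlg_scale (a * b) x.
Proof. by rewrite -[x]quotAlg_reprK !qE scalerA. Qed.

Lemma quotAlg_scale1 : left_id 1 quotAlg_scale.
Proof. by move=> x; rewrite -[x]quotAlg_reprK !qE scale1r. Qed.

Lemma quotAlg_scaleDr : right_distributive quotAlg_scale +%R.
Proof.
move=> a x y; rewrite -[x]quotAlg_reprK -[y]quotAlg_reprK.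
by rewrite -raddfD !qE scalerDr raddfD.
Qed.

Lemma quotAlg_scaleDl x : {morph quotAlg_scale^~ x : a b / a + b}.
Proof. by move=> a b; rewrite -[x]quotAlg_reprK !qE scalerDl raddfD. Qed.

HB.instance Definition _ := GRing.Zmodule_isLmodule.Build K quotAlg
  quotAlg_scaleA quotAlg_scale1 quotAlg_scaleDr quotAlg_scaleDl.

Lemma quotAlg_pi_is_monoid_morphism : monoid_morphism pi.
Proof. by split=> // x y; rewrite -quotAlg_pi_mul. Qed.

HB.instance Definition _ := GRing.isMonoidMorphism.Build A quotAlg pi
  quotAlg_pi_is_monoid_morphism.

Lemma quotAlg_pi_is_scalable : scalable pi.
Proof. by move=> c x; rewrite -quotAlg_pi_scale. Qed.

HB.instance Definition _ := GRing.isScalable.Build K A quotAlg *:%R pi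
  quotAlg_pi_is_scalable.

End Quotient.

Arguments quotAlg {K A} G.
Arguments quotAlg_pi {K A} G x.

Definition kalg_iso (K : comNzRingType) (A B : comAlgType K)
    (G : set A) (H : set B) : Prop :=
  exists phi : {rmorphism quotAlg G -> quotAlg H}, scalable phi /\ bijective phi.

(* [Sym_A(M)] is presented as the polynomial ring over [A] with one variable
   for each element of [M], modulo the relations that make [M -> Sym_A(M)]
   [A]-linear. *)
(* [monalg] is imported only locally: its [{mpoly R[n]}] would shadow that of
   [mpoly]. *)
Module SymmetricAlgebra.
Import monalg.

Section Sym.
Variables (A : comNzRingType) (M : lmodType A).

Local Notation freeSym := {malg A[{cmonom M}]}.

(* The variable attached to [u]; locked because unification otherwise unfolds
   the underlying finite maps on mismatch. *)
Definition freeSym_var : M -> freeSym := locked (fun u => mkmalgU (ucm u) 1).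

Lemma freeSym_varE u : freeSym_var u = mkmalgU (ucm u) 1.
Proof. by rewrite /freeSym_var -lock. Qed.

Definition sym_rel : set freeSym := fun p => exists (a : A) (u v : M),
  p = freeSym_var (a *: u + v) - (a *: freeSym_var u + freeSym_var v).

Definition symAlg := quotAlg sym_rel.

Definition sym_gen (u : M) : symAlg := quotAlg_pi sym_rel (freeSym_var u).

End Sym.

Section SymUniversal.
Variables (A : comNzRingType) (M : lmodType A) (B : comAlgType A).
Variable g : {linear M -> B}.
Local Notation freeSym M := {malg A[{cmonom M}]}.

Definition cmonom_ev (m : {cmonom M}) : B :=
  \prod_(u <- finsupp m) g u ^+ m u.

Lemma cmonom_evEw (d : {fset M}) (m : {cmonom M}) :
  (finsupp m `<=` d)%fset -> cmonom_ev m = \prod_(u <- d) g u ^+ m u.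
Proof.
move=> le; rewrite /cmonom_ev (big_fset_incl _ le) // => u _.
by rewrite -cmE_eq0 => /eqP->; rewrite expr0.
Qed.

Lemma cmonom_ev_mmorphism : mmorphism cmonom_ev.
Proof.
split=> [m1 m2|]; last by rewrite /cmonom_ev mdom1 big_seq_fset0.
rewrite {1}/cmonom_ev mdomD.
rewrite (cmonom_evEw (fsubsetUl _ (finsupp m2))).
rewrite (cmonom_evEw (fsubsetUr (finsupp m1) _)) -big_split /=.
by apply: eq_bigr => u _; rewrite cmM exprD.
Qed.

HB.instance Definition _ :=
  isMultiplicative.Build {cmonom M} B cmonom_ev cmonom_ev_mmorphism.

Definition freeSym_ev : freeSym M -> B := monalg.mmap (in_alg B) cmonom_ev.

HB.instance Definition _ := GRing.RMorphism.copy freeSym_ev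
  (monalg.mmap (in_alg B) cmonom_ev).

Lemma freeSym_ev_is_scalable : scalable freeSym_ev.
Proof. by move=> c p; rewrite /freeSym_ev monalg.mmapZ /= mulr_algl. Qed.

HB.instance Definition _ := GRing.isScalable.Build A (freeSym M) B *:%R
  freeSym_ev freeSym_ev_is_scalable.

Lemma freeSym_ev_var u : freeSym_ev (freeSym_var u) = g u.
Proof.
rewrite /freeSym_ev freeSym_varE monalg.mmapU /= scale1r mul1r /cmonom_ev mdomU.
by rewrite big_seq_fset1 cmUU expr1.
Qed.

Lemma freeSym_ev_rel p : p \in ideal_span (@sym_rel A M) -> freeSym_ev p = 0.
Proof.
have rel0 r : sym_rel r -> freeSym_ev r = 0.
  move=> [a [u [v ->]]]; rewrite rmorphB rmorphD /= freeSym_ev_is_scalable.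
  by rewrite !freeSym_ev_var linearP subrr.
move=> /ideal_spanP[s sG ->]; rewrite rmorph_sum big_seq big1 // => c /sG rc.
by rewrite rmorphM [X in _ * X]rel0 ?mulr0.
Qed.

(* The unique [A]-algebra morphism extending [g]; by [sym_lift_pi] the choice
   of representative is irrelevant. *)
Definition sym_lift (x : symAlg M) : B := freeSym_ev (repr x).

Lemma sym_lift_pi p : sym_lift (quotAlg_pi (@sym_rel A M) p) = freeSym_ev p.
Proof.
apply/eqP; rewrite -subr_eq0 -rmorphB; apply/eqP.
exact/freeSym_ev_rel/quotAlg_repr_pi.
Qed.

Lemma sym_lift_gen u : sym_lift (sym_gen u) = g u.
Proof. by rewrite sym_lift_pi freeSym_ev_var. Qed.

Lemma sym_lift_is_zmod_morphism : zmod_morphism sym_lift.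
Proof.
move=> x y; rewrite -[x]quotAlg_reprK -[y]quotAlg_reprK -raddfB.
by rewrite !sym_lift_pi raddfB.
Qed.

HB.instance Definition _ := GRing.isZmodMorphism.Build (symAlg M) B sym_lift
  sym_lift_is_zmod_morphism.

Lemma sym_lift_is_monoid_morphism : monoid_morphism sym_lift.
Proof.
split=> [|x y]; first by rewrite [LHS](sym_lift_pi 1) rmorph1.
rewrite -[x]quotAlg_reprK -[y]quotAlg_reprK -rmorphM.
by rewrite !sym_lift_pi rmorphM.
Qed.

HB.instance Definition _ := GRing.isMonoidMorphism.Build (symAlg M) B sym_lift
  sym_lift_is_monoid_morphism.

Lemma sym_lift_is_scalable : scalable sym_lift.
Proof.
move=> c x; rewrite -[x]quotAlg_reprK -linearZ !sym_lift_pi.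
exact: freeSym_ev_is_scalable.
Qed.

HB.instance Definition _ := GRing.isScalable.Build A (symAlg M) B *:%R
  sym_lift sym_lift_is_scalable.

End SymUniversal.

End SymmetricAlgebra.
Export SymmetricAlgebra.

Section LinearType.
Variables (A : comNzRingType) (m : nat) (f : 'I_m -> A).

Definition gen_ideal : {pred A^o} := ideal_span (range f).

Lemma gen_ideal_submod_closed : submod_closed gen_ideal.
Proof.
split=> [|a x y xI yI]; first exact: ideal_span0.
by apply: ideal_spanD => //; apply: ideal_spanM.
Qed.

HB.instance Definition _ :=
  GRing.isSubmodClosed.Build A A^o gen_ideal gen_ideal_submod_closed.

Record idealMod := IdealMod {
  idealMod_val : A^o;
  idealMod_valP : idealMod_val \in gen_ideal }.

HB.instance Definition _ := [isSub for idealMod_val].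
HB.instance Definition _ := [Choice of idealMod by <:].
HB.instance Definition _ := [SubChoice_isSubLmodule of idealMod by <:].

(* [A[f_1 t, ..., f_m t]], the variable ['X] of [{poly A}] playing the role
   of [t]. *)
Definition rees_ev (q : {mpoly A[m]}) : {poly A} :=
  mmap polyC (fun i => f i *: 'X) q.

HB.instance Definition _ := GRing.RMorphism.copy rees_ev
  (mmap polyC (fun i => f i *: 'X)).

Definition rees_pred : {pred {poly A}} := fun p => `[< range rees_ev p >].

Lemma rees_subalg_closed : subalg_closed rees_pred.
Proof.
split; first by apply/asboolP; exists 1; rewrite ?rmorph1.
  move=> a _ _ /asboolP[p _ <-] /asboolP[q _ <-]; apply/asboolP.
  exists (a *: p + q) => //.
  by rewrite rmorphD /= /rees_ev mmapZ mul_polyC.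
move=> _ _ /asboolP[p _ <-] /asboolP[q _ <-]; apply/asboolP.
by exists (p * q); rewrite ?rmorphM.
Qed.

HB.instance Definition _ :=
  GRing.isSubalgClosed.Build A {poly A} rees_pred rees_subalg_closed.

Record reesAlg := ReesAlg {
  rees_val : {poly A};
  rees_valP : rees_val \in rees_pred }.

HB.instance Definition _ := [isSub for rees_val].
HB.instance Definition _ := [Choice of reesAlg by <:].
HB.instance Definition _ := [SubChoice_isSubAlgebra of reesAlg by <:].
HB.instance Definition _ := [SubNzRing_isSubComNzRing of reesAlg by <:].

Lemma rees_gen_subproof (u : idealMod) : (val u : A) *: 'X \in rees_pred.
Proof.
case: u => _ /= /ideal_spanP[s sG ->]; rewrite scaler_suml big_seq.
apply: rpred_sum => c /sG [i _ <-]; rewrite -scalerA; apply: rpredZ.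
by apply/asboolP; exists 'X_i => //; rewrite /rees_ev mmapX mmap1U.
Qed.

Definition rees_gen (u : idealMod) : reesAlg := ReesAlg (rees_gen_subproof u).

Lemma rees_gen_is_linear : linear rees_gen.
Proof.
by move=> a u v; apply: val_inj; rewrite /= scalerDl scalerA.
Qed.

HB.instance Definition _ :=
  GRing.isLinear.Build A idealMod reesAlg *:%R rees_gen rees_gen_is_linear.

Definition sym_to_rees : symAlg idealMod -> reesAlg := sym_lift rees_gen.

Definition linear_type : Prop := injective sym_to_rees.

End LinearType.

(* Formal power series in [n] variables: arbitrary coefficient functions on
   exponents, with the product formula [mcoeffM] of polynomials. *)
Section PowerSeries.
Variables (n : nat) (R : comNzRingType).

Record mfps := MFPS { fcoef : 'X_{1..n} -> R }.

HB.instance Definition _ := gen_eqMixin mfps.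
HB.instance Definition _ := gen_choiceMixin mfps.

Implicit Types a b c : mfps.

Lemma mfpsP a b : fcoef a =1 fcoef b -> a = b.
Proof. by case: a b => [a] [b] /= /funext->. Qed.

Definition mfps_zero := MFPS (fun _ => 0).
Definition mfps_opp a := MFPS (fun m => - fcoef a m).
Definition mfps_add a b := MFPS (fun m => fcoef a m + fcoef b m).

Lemma mfps_addA : associative mfps_add.
Proof. by move=> a b c; apply: mfpsP => m /=; rewrite addrA. Qed.

Lemma mfps_addC : commutative mfps_add.
Proof. by move=> a b; apply: mfpsP => m /=; rewrite addrC. Qed.

Lemma mfps_add0 : left_id mfps_zero mfps_add.
Proof. by move=> a; apply: mfpsP => m /=; rewrite add0r. Qed.

Lemma mfps_addN : left_inverse mfps_zero mfps_opp mfps_add.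
Proof. by move=> a; apply: mfpsP => m /=; rewrite addNr. Qed.

HB.instance Definition _ := GRing.isZmodule.Build mfps
  mfps_addA mfps_addC mfps_add0 mfps_addN.

Definition mfps_of_mpoly (p : {mpoly R[n]}) : mfps := MFPS (fun m => p@_m).

Definition mfps_one : mfps := mfps_of_mpoly 1.
Definition mfps_mul a b : mfps := MFPS (fun m =>
  \sum_(k : 'X_{1..n < (mdeg m).+1, (mdeg m).+1} | m == (k.1 + k.2)%MM)
    fcoef a k.1 * fcoef b k.2).
Definition mfps_scale (c : R) a : mfps := MFPS (fun m => c * fcoef a m).

Definition mfps_trunc (d : nat) a : {mpoly R[n]} :=
  \sum_(m : 'X_{1..n < d}) fcoef a m *: 'X_[m].

Lemma mcoeff_trunc d a m : (mdeg m < d)%N -> (mfps_trunc d a)@_m = fcoef a m.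
Proof. exact: mcoeff_mpoly. Qed.

Lemma eq_mcoeffM (p q p' q' : {mpoly R[n]}) m :
  (forall k, (mdeg k <= mdeg m)%N -> p@_k = p'@_k) ->
  (forall k, (mdeg k <= mdeg m)%N -> q@_k = q'@_k) ->
  (p * q)@_m = (p' * q')@_m.
Proof.
move=> pp' qq'; rewrite !mcoeffM; apply: eq_bigr => -[k l] _ /=.
by rewrite pp' ?qq' // -ltnS bmdeg.
Qed.

Lemma fcoef_mul a b d m : (mdeg m < d)%N ->
  fcoef (mfps_mul a b) m = (mfps_trunc d a * mfps_trunc d b)@_m.
Proof.
move=> md; rewrite mcoeffM; apply: eq_bigr => -[k l] _ /=.
by rewrite !mcoeff_trunc // (leq_trans _ md) // bmdeg.
Qed.

Lemma mfps_trunc_mul d a b m : (mdeg m < d)%N ->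
  (mfps_trunc d (mfps_mul a b))@_m = (mfps_trunc d a * mfps_trunc d b)@_m.
Proof. by move=> md; rewrite mcoeff_trunc // (@fcoef_mul _ _ d). Qed.

Lemma mfps_mulA : associative mfps_mul.
Proof.
move=> a b c; apply: mfpsP => m; rewrite !(@fcoef_mul _ _ (mdeg m).+1) //.
set t := mfps_trunc _.
transitivity ((t a * (t b * t c))@_m).
  by apply: eq_mcoeffM => // k km; rewrite mfps_trunc_mul.
by rewrite mulrA; apply: eq_mcoeffM => // k km; rewrite mfps_trunc_mul.
Qed.

Lemma mfps_mulC : commutative mfps_mul.
Proof.
move=> a b; apply: mfpsP => m.
by rewrite !(@fcoef_mul _ _ (mdeg m).+1) // mulrC.
Qed.

Lemma mfps_mul1 : left_id mfps_one mfps_mul.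
Proof.
move=> a; apply: mfpsP => m; rewrite (@fcoef_mul _ _ (mdeg m).+1) //.
rewrite -[RHS](@mcoeff_trunc (mdeg m).+1) // -[in RHS](mul1r (mfps_trunc _ _)).
by apply: eq_mcoeffM => // k km; rewrite mcoeff_trunc.
Qed.

Lemma mfps_mulDl : left_distributive mfps_mul +%R.
Proof.
move=> a b c; apply: mfpsP => m /=; rewrite -big_split /=.
by apply: eq_bigr => k _; rewrite mulrDl.
Qed.

Lemma mfps_one_neq0 : mfps_one != 0.
Proof.
apply/eqP => /(congr1 (fcoef^~ 0%MM)) /=.
by rewrite mcoeff1 eqxx => /eqP; rewrite oner_eq0.
Qed.

HB.instance Definition _ := GRing.Zmodule_isComNzRing.Build mfps
  mfps_mulA mfps_mulC mfps_mul1 mfps_mulDl mfps_one_neq0.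

Lemma mfps_scaleA (c d : R) a :
  mfps_scale c (mfps_scale d a) = mfps_scale (c * d) a.
Proof. by apply: mfpsP => m /=; rewrite mulrA. Qed.

Lemma mfps_scale1 : left_id 1 mfps_scale.
Proof. by move=> a; apply: mfpsP => m /=; rewrite mul1r. Qed.

Lemma mfps_scaleDr : right_distributive mfps_scale +%R.
Proof. by move=> r a b; apply: mfpsP => m /=; rewrite mulrDr. Qed.

Lemma mfps_scaleDl a : {morph mfps_scale^~ a : r s / r + s}.
Proof. by move=> r s; apply: mfpsP => m /=; rewrite mulrDl. Qed.

HB.instance Definition _ := GRing.Zmodule_isLmodule.Build R mfps
  mfps_scaleA mfps_scale1 mfps_scaleDr mfps_scaleDl.

Lemma mfps_scaleAl (c : R) a b : c *: (a * b) = c *: a * b.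
Proof.
apply: mfpsP => m /=; rewrite mulr_sumr.
by apply: eq_bigr => k _; rewrite mulrA.
Qed.

HB.instance Definition _ :=
  GRing.Lmodule_isLalgebra.Build R mfps mfps_scaleAl.
HB.instance Definition _ := GRing.Lalgebra_isComAlgebra.Build R mfps.

End PowerSeries.

Definition analytically_equivalent (k : comNzRingType) (n : nat)
    (F G : {mpoly k[n]}) : Prop :=
  kalg_iso [set mfps_of_mpoly F]%classic [set mfps_of_mpoly G]%classic.

(* The multiplicity at the origin of [V(F)], i.e. the order of [F]. *)
Definition has_order (k : comNzRingType) (n : nat) (F : {mpoly k[n]}) (m : nat)
    : Prop :=
  (forall e : 'X_{1..n}, (mdeg e < m)%N -> F@_e = 0) /\
  (exists e : 'X_{1..n}, mdeg e = m /\ F@_e != 0).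

Section SimpleSingularities.
Variable k : fieldType.

Local Notation x := ('X_(0 : 'I_2) : {mpoly k[2]}).
Local Notation y := ('X_(1 : 'I_2) : {mpoly k[2]}).
Local Notation "F ~an G" := (analytically_equivalent F G) (at level 70).

Definition simple_germ (F : {mpoly k[2]}) : Prop :=
     (has_order F 2 /\
      exists n : nat, (1 <= n)%N /\ F ~an (y ^+ 2 - x ^+ n.+1))
  \/ (has_order F 3 /\
      [\/ exists n : nat, (1 <= n)%N /\ F ~an (y ^+ 2 * x - x ^+ n.+2),
          F ~an (x ^+ 3 - y ^+ 4),
          F ~an (y ^+ 3 - y * x ^+ 3) |
          F ~an (x ^+ 3 - y ^+ 5)]).

(* [f] in the coordinates given by [T], i.e. the polynomial [w |-> f (T w)]. *)
Definition coord_change (T : 'M[k]_3) (f : {mpoly k[3]}) : {mpoly k[3]} :=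
  f \mPo [tuple \sum_j T i j *: 'X_j | i < 3].

Definition dehomog_z (f : {mpoly k[3]}) : {mpoly k[2]} :=
  f \mPo [tuple x; y; 1].

(* Points of the projective plane are represented by nonzero vectors; the
   condition on the last column says that [T] maps [0:0:1] to [p]. *)
Definition simple_singularity (f : {mpoly k[3]}) (p : 'cV[k]_3) : Prop :=
  exists T : 'M[k]_3,
    [/\ T \in unitmx,
        exists2 c : k, c != 0 & col ord_max T = c *: p &
        simple_germ (dehomog_z (coord_change T f))].

Definition gradient (f : {mpoly k[3]}) (i : 'I_3) : {mpoly k[3]} := f^`M(i).

Definition singular_point (f : {mpoly k[3]}) (p : 'cV[k]_3) : Prop :=
  [/\ p != 0, f.@[fun i => p i 0] = 0 &
      forall i, (gradient f i).@[fun i => p i 0] = 0].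

(* [R/(f)] has no nonzero nilpotent element. *)
Definition reduced_mpoly (f : {mpoly k[3]}) : Prop :=
  forall (g : {mpoly k[3]}) (n : nat),
    (exists h, g ^+ n = h * f) -> exists h, g = h * f.

Definition gradient_linear_type (f : {mpoly k[3]}) : Prop :=
  linear_type (gradient f).

End SimpleSingularities.

(* Main.v *)
Require Import Defs.
From HB Require Import structures.
From mathcomp Require Import all_boot all_order all_algebra.
From mathcomp Require Import perm ring zify finmap.
From mathcomp Require Import boolp classical_sets.
From mathcomp Require monalg.
From mathcomp Require Import mpoly.

Set Implicit Arguments.
Unset Strict Implicit.
Unset Printing Implicit Defensive.

Import GRing.Theory.
Local Open Scope ring_scope.

(** Put R = k[x,y,z], let f_0, f_1, f_2 be the partial derivatives of f and let
    S = R[T_0,T_1,T_2] be the polynomial ring that maps onto both the symmetric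
    and the Rees algebra of the gradient ideal.  The kernel K of S -> R[t],
    T_i |-> f_i t, contains the ideal L of all sum u_i T_i with
    sum u_i f_i = 0, and the elements of L vanish in the symmetric algebra.  So
    the theorem follows from K = L ([linear_type_of_syz]).

    Locally on the plane the equality K = L is easy.  Suppose that c in R is an
    entry of a syzygy of the gradient, so that c f_l lies in (f_i, f_j), and that
    f_i, f_j form a regular sequence once c is inverted.  Such a c is called
    good.  The syzygy eliminates T_l, and the remaining relations between f_i
    and f_j are Koszul relations; hence a power of c multiplies any given element
    of K into L ([good_torsion]).  The same computation shows that, up to a power
    of c, a vector u over S which is orthogonal to both (f_i) and (T_i) is a
    multiple of their cross product ([good_cross]).

    If the good elements generate an ideal that contains powers of x, y and z,
    these two facts become global.  For P in K one gets x^N P, y^N P and z^N P in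
    L; the three presentations differ by multiples of the cross product, and since
    x^N, y^N, z^N is a regular sequence the differences can be corrected, which
    puts P itself in L ([syz_form_of_rees]).  This is the argument that the
    approximation complex is acyclic and that Sym has no torsion supported at the
    origin, in elementary terms.

    It remains to find, at every point p of the projective plane, a good
    homogeneous c with c(p) <> 0; the Nullstellensatz, applied in the three affine
    charts, then gives the powers of the variables.  At a smooth point, and at a
    point outside the curve, some f_l is not zero and is good itself.  At a
    singular point the germ F is equivalent to one of the normal forms of type A,
    D, E, all of which are weighted homogeneous with isolated singularity.  An
    isomorphism of the completed local rings lifts, modulo a high power of the
    maximal ideal m, to a polynomial change of coordinates ([iso_lift]).  Pulling
    back the Euler identity of the normal form gives that F lies in
    (F_x, F_y) + m^N and that m^N lies in (F_x, F_y) + m^(N+1), and Nakayama's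
    lemma removes the error terms after multiplication by some c which is not
    zero at p ([local_ideal]).  Homogenising the relation c F = a F_x + b F_y and
    combining it with the Euler formula of f yields the syzygy
    ([local_syzygy]). *)

(** * Indices and polynomials in several variables *)

(* The last index of 'I_3 is written 1 + 1, in the ring structure of 'I_3. *)

Lemma ord3_ind (P : 'I_3 -> Prop) : P 0 -> P 1 -> P (1 + 1) -> forall i, P i.
Proof.
move=> P0 P1 P2 [[|[|[|]]] // lti].
- by have -> : Ordinal lti = 0 by apply: val_inj.
- by have -> : Ordinal lti = 1 by apply: val_inj.
- by have -> : Ordinal lti = 1 + 1 by apply: val_inj.
Qed.

Lemma ord2_ind (P : 'I_2 -> Prop) : P 0 -> P 1 -> forall i, P i.
Proof.
move=> P0 P1 [[|[|]] // lti].
  by have -> : Ordinal lti = 0 by apply: val_inj.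
by have -> : Ordinal lti = 1 by apply: val_inj.
Qed.

Lemma mem_uniq3 (i j l m : 'I_3) : uniq [:: i; j; l] -> m \in [:: i; j; l].
Proof.
by case: i j l m => [[|[|[]]] // ?] [[|[|[]]] // ?] [[|[|[]]] // ?] [[|[|[]]] // ?].
Qed.

Lemma big_ord3 (V : nmodType) (F : 'I_3 -> V) i j l : uniq [:: i; j; l] ->
  \sum_m F m = F i + F j + F l.
Proof.
move=> U; rewrite (perm_big [:: i; j; l]) /=.
  by rewrite !big_cons big_nil addr0 addrA.
apply: uniq_perm; rewrite ?index_enum_uniq // => m.
by rewrite mem_index_enum (mem_uniq3 _ U).
Qed.

Lemma uniq3_neq (T : eqType) (i j l : T) : uniq [:: i; j; l] ->
  ((i == j = false) * (j == i = false) * (i == l = false) * (l == i = false)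
   * (j == l = false) * (l == j = false))%type.
Proof.
rewrite /= !inE !negb_or andbT => /andP[/andP[ij il] jl].
by rewrite ![l == _]eq_sym [j == i]eq_sym !(negPf ij) !(negPf il) !(negPf jl).
Qed.

Lemma uniq3_cyclic (i j l : 'I_3) : uniq [:: i; j; l] ->
  (j = i + 1 /\ l = i + 1 + 1) \/ (i = j + 1 /\ l = j + 1 + 1).
Proof.
case: i j l => [[|[|[]]] // ?] [[|[|[]]] // ?] [[|[|[]]] // ?] // _;
by [left; split; apply: val_inj|right; split; apply: val_inj].
Qed.

Lemma ord3_addK (i : 'I_3) : i + 1 + 1 + 1 = i.
Proof. by case: i => [[|[|[]]] // ?]; apply: val_inj. Qed.

Lemma exists_other (l : 'I_3) : exists i j, uniq [:: i; j; l].
Proof.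
by elim/ord3_ind: l; [exists 1, (1 + 1)|exists 0, (1 + 1)|exists 0, 1].
Qed.

Lemma eq_of_sub (V : zmodType) (x y z : V) : x - y = z -> z = 0 -> x = y.
Proof. by move=> <- /subr0_eq. Qed.

Lemma mpoly_gen_ind (n : nat) (R : nzRingType) (E : {mpoly R[n]} -> Prop) :
  (forall c, E c%:MP) -> (forall i, E 'X_i) ->
  (forall p q, E p -> E q -> E (p + q)) ->
  (forall p q, E p -> E q -> E (p * q)) -> forall p, E p.
Proof.
move=> hC hX hD hM.
have EXm m : E 'X_[m].
  rewrite mpolyXE_id; elim/big_rec: _ => [|i q _ Eq]; first exact: (hC 1).
  apply: (hM) => //; elim: (m i) => [|e IH]; first exact: (hC 1).
  by rewrite exprS; apply: (hM); first exact: hX.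
elim/mpolyind => [|c m p _ _ Ep]; first by rewrite -(mpolyC0 n); apply: hC.
by apply: hD => //; rewrite -mul_mpolyC; apply: hM.
Qed.

Lemma mpoly_rmorph_ext (n : nat) (R T : nzRingType)
    (g h : {rmorphism {mpoly R[n]} -> T}) :
  (forall c, g c%:MP = h c%:MP) -> (forall i, g 'X_i = h 'X_i) -> g =1 h.
Proof.
move=> ghC ghX; apply: mpoly_gen_ind => // p q gp gq.
  by rewrite !rmorphD gp gq.
by rewrite !rmorphM gp gq.
Qed.

(** Turns coefficientwise solvability into a polynomial solution; the second
    hypothesis keeps the solution of finite support. *)
Lemma mpoly_choice (n : nat) (R : nzRingType) (Q : 'X_{1..n} -> R -> Prop) k :
  (forall m, exists t, Q m t) -> (forall m, (k <= mdeg m)%N -> Q m 0) ->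
  exists t : {mpoly R[n]}, forall m, Q m t@_m.
Proof.
move=> /choice[t Qt] Q0.
exists (\sum_(m : 'X_{1..n < k}) t m *: 'X_[m]) => m.
case: (ltnP (mdeg m) k) => mk; first by rewrite mcoeff_mpoly.
rewrite raddf_sum /= big1 => [|i _]; first exact: Q0.
rewrite mcoeffZ mcoeffX; case: eqP => [im|]; last by rewrite mulr0.
by have := bmdeg i; rewrite im ltnNge mk.
Qed.

Lemma mderiv_var (n : nat) (R : nzRingType) (i j : 'I_n) :
  ('X_i : {mpoly R[n]})^`M(j) = (i == j)%:R%:MP.
Proof.
rewrite mderivX mnm1E; case: eqP => [->|_]; last by rewrite scale0r mpolyC0.
have -> : (U_(j) - U_(j) = 0 :> 'X_{1..n})%MM.
  by apply/mnmP => l; rewrite mnmBE subnn mnm0E.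
by rewrite mpolyX0 scale1r mpolyC1.
Qed.

Section MonomialIdeals.
Variables (n : nat) (R : comNzRingType).
Local Notation P := {mpoly R[n]}.

Lemma mcoeff_mulX (p : P) m' m :
  (p * 'X_[m'])@_m = if (m' <= m)%MM then p@_(m - m') else 0.
Proof.
case: ifP => [h|/negP h]; first by rewrite -{1}(submK h) addmC mcoeffMX.
rewrite [p]mpolyE mulr_suml raddf_sum big1 //= => j _.
rewrite -scalerAl mcoeffZ -mpolyXD mcoeffX; case: eqP => [e|]; last by rewrite mulr0.
by case: h; rewrite -e lem_addl.
Qed.

Lemma mulX_of_coeff (p : P) m' : (forall m, ~~ (m' <= m)%MM -> p@_m = 0) ->
  exists q, p = q * 'X_[m'].
Proof.
move=> h; exists (\sum_(m <- msupp p) p@_m *: 'X_[m - m']).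
rewrite [LHS]mpolyE mulr_suml big_seq [RHS]big_seq; apply: eq_bigr => m mp.
rewrite -scalerAl -mpolyXD submK //; apply: contraLR mp => /h.
by rewrite mcoeff_msupp negbK => ->.
Qed.

Lemma le_mulUn i N (m : 'X_{1..n}) : (U_(i) *+ N <= m)%MM = (N <= m i)%N.
Proof.
apply/mnm_lepP/idP => [/(_ i)|h j]; rewrite mulmnE mnm1E ?eqxx ?mul1n //.
by case: eqP => [<-|_]; rewrite ?mul1n ?mul0n.
Qed.

Lemma mcoeff_mulXn (p : P) (i : 'I_n) N (m : 'X_{1..n}) : (m i < N)%N -> (p * 'X_i ^+ N)@_m = 0.
Proof. by rewrite mpolyXn mcoeff_mulX le_mulUn ltnNge => /negPf->. Qed.

Lemma mem_monomial_ideal2 (p : P) (i j : 'I_n) N :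
  (forall m : 'X_{1..n}, (m i < N)%N -> (m j < N)%N -> p@_m = 0) ->
  exists u v, p = u * 'X_i ^+ N + v * 'X_j ^+ N.
Proof.
move=> h; pose p1 := \sum_(m <- msupp p | (N <= m i)%N) p@_m *: 'X_[m].
pose p2 := \sum_(m <- msupp p | ~~ (N <= m i)%N) p@_m *: 'X_[m].
have pE : p = p1 + p2 by rewrite [LHS]mpolyE (bigID (fun m : 'X_{1..n} => (N <= m i)%N)).
have [|u hu] := @mulX_of_coeff p1 (U_(i) *+ N)%MM.
  move=> m; rewrite le_mulUn => mN; rewrite raddf_sum big1 //= => m' m'N.
  by rewrite mcoeffZ mcoeffX; case: eqP m'N mN => [-> ->|]; rewrite ?mulr0.
have [|v hv] := @mulX_of_coeff p2 (U_(j) *+ N)%MM.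
  move=> m; rewrite le_mulUn => mN; rewrite raddf_sum big1 //= => m' m'N.
  rewrite mcoeffZ mcoeffX; case: eqP m'N => [->|]; rewrite ?mulr0 // => miN.
  by rewrite h ?mul0r // ltnNge.
by exists u, v; rewrite !mpolyXn -hu -hv.
Qed.

End MonomialIdeals.

(** * Pairs that are regular up to a multiplier *)

(** When c is inverted, every relation between a and b is a multiple of the
    trivial one.  A single multiplier c serves all relations, so that the property
    passes to polynomials coefficient by coefficient. *)
Definition reg_upto (R : nzRingType) (c a b : R) := forall A B,
  A * a = B * b -> exists t, c * A = t * b /\ c * B = t * a.

Lemma reg_uptoC (R : nzRingType) (c a b : R) : reg_upto c a b -> reg_upto c b a.
Proof. by move=> h A B /esym/h[t [h1 h2]]; exists t. Qed.

Lemma reg_uptoM (R : comNzRingType) (c c' a a' b : R) :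
  reg_upto c a b -> reg_upto c' a' b -> reg_upto (c * c') (a * a') b.
Proof.
move=> h h' A B; rewrite mulrA mulrAC => /h[t [h1 h2]].
have /h'[t' [h3 h4]] : (c * A) * a' = t * b by rewrite -h1 mulrA.
exists t'; split; first by rewrite -h3; ring.
transitivity (c' * (c * B)); first by ring.
by rewrite h2 mulrA h4; ring.
Qed.

Lemma reg_uptoX (R : comNzRingType) (c a b : R) n : reg_upto c a b -> reg_upto (c ^+ n) (a ^+ n) b.
Proof.
move=> h; elim: n => [|n IH]; last by rewrite !exprS; apply: reg_uptoM.
by move=> A B; rewrite expr0 mulr1 => ->; exists B; rewrite !mul1r mulr1.
Qed.

Lemma reg_uptoXX (R : comNzRingType) (c a b : R) n :
  reg_upto c a b -> reg_upto (c ^+ n ^+ n) (a ^+ n) (b ^+ n).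
Proof. by move=> h; apply/reg_uptoC/reg_uptoX/reg_uptoC/reg_uptoX. Qed.

Lemma reg_upto_mpolyC n (R : comNzRingType) (c a b : R) : reg_upto c a b ->
  reg_upto (c%:MP_[n]) a%:MP b%:MP.
Proof.
move=> h A B /mpolyP AB.
have [] := @mpoly_choice n R (fun m t => c * A@_m = t * b /\ c * B@_m = t * a)
  (maxn (msize A) (msize B)).
- move=> m; apply: h; have := AB m.
  by rewrite ![_ * (_)%:MP]mulrC !mcoeffCM ![_ * _@__]mulrC.
- move=> m; rewrite geq_max => /andP[/msize_mdeg_ge/memN_msupp_eq0-> /msize_mdeg_ge/memN_msupp_eq0->].
  by rewrite !mulr0 !mul0r.
move=> t tP; exists t; split; apply/mpolyP => m; have [e1 e2] := tP m.
  by rewrite mcoeffCM e1 [t * _]mulrC mcoeffCM mulrC.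
by rewrite mcoeffCM e2 [t * _]mulrC mcoeffCM mulrC.
Qed.

(** If (a, b) contains c u and c v for a regular sequence u, v, then a and b have
    no common factor where c is invertible.  The proof avoids factorisation: from
    A a = B b one reads off c u A = D b and c v A = E b, so v D = u E, and
    regularity of u, v makes D divisible by u. *)
Lemma reg_upto_of_regular (R : idomainType) (c u v a b p q r s : R) :
  c != 0 -> u != 0 -> reg_upto 1 u v ->
  c * u = p * a + q * b -> c * v = r * a + s * b -> reg_upto c a b.
Proof.
move=> c0 u0 uv cu cv A B AB.
have cuA : c * u * A = (q * A + p * B) * b by rewrite cu; ring: AB.
have cuB : c * u * B = (q * A + p * B) * a by rewrite cu; ring: AB.
have cvA : c * v * A = (s * A + r * B) * b by rewrite cv; ring: AB.
have cvB : c * v * B = (s * A + r * B) * a by rewrite cv; ring: AB.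
have ab0 : (a != 0) || (b != 0).
  rewrite -negb_and; apply/negP => /andP[/eqP a0 /eqP b0].
  by move/eqP: cu; rewrite a0 b0 !mulr0 addr0 mulf_eq0 (negPf c0) (negPf u0).
have DE : (s * A + r * B) * u = (q * A + p * B) * v.
  case/orP: ab0 => [a0|b0]; [apply: (mulIf a0)|apply: (mulIf b0)].
    by transitivity (u * (c * v * B)); [rewrite cvB|transitivity (v * (c * u * B)); last rewrite cuB]; ring.
  by transitivity (u * (c * v * A)); [rewrite cvA|transitivity (v * (c * u * A)); last rewrite cuA]; ring.
have [t [_ ht]] := uv _ _ DE; rewrite mul1r in ht.
exists t; split; apply: (mulIf u0).
  by transitivity (c * u * A); [ring|rewrite cuA ht; ring].
by transitivity (c * u * B); [ring|rewrite cuB ht; ring].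
Qed.
(** * Forms with syzygy coefficients and good elements *)

Section GoodElements.
Variables (R : idomainType) (f : 'I_3 -> R).
Local Notation S := {mpoly R[3]}.
Implicit Types (P Q r : S) (u : 'I_3 -> S).

(** The ideal of S generated by the linear forms whose coefficients are syzygies
    of f: a syzygy over S is an S-combination of syzygies over R. *)
Definition syz_form (P : S) : Prop := exists u : 'I_3 -> S,
  \sum_i u i * (f i)%:MP = 0 /\ P = \sum_i u i * 'X_i.

(** Kills the variables outside D; its image is the subring of the polynomials in
    the variables of D. *)
Definition restr (D : pred 'I_3) : S -> S :=
  comp_mpoly [tuple if D i then 'X_i else 0 | i < 3].

HB.instance Definition _ D := GRing.RMorphism.copy (restr D)
  (comp_mpoly [tuple if D i then 'X_i else 0 | i < 3]).

Lemma restrC D c : restr D c%:MP = c%:MP.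
Proof. exact: comp_mpolyC. Qed.

Lemma restrX (D : pred 'I_3) i : restr D 'X_i = if D i then 'X_i else 0.
Proof. by rewrite /restr comp_mpolyXU -tnth_nth tnth_mktuple. Qed.

Lemma restr_restr D E p : restr D (restr E p) = restr (predI D E) p.
Proof.
apply: (@mpoly_rmorph_ext _ _ _ (restr D \o restr E) (restr (predI D E))) => /=.
  by move=> c; rewrite !restrC.
move=> i; rewrite !restrX /=; case: (E i); rewrite ?andbT ?andbF ?rmorph0 //.
by rewrite restrX.
Qed.

(** Multiplying by powers of s_l allows replacing T_l by the other variables modulo
    the linear form sum s_m T_m. *)
Lemma elim_var (s : 'I_3 -> R) (l : 'I_3) P : exists N q r,
  (s l ^+ N)%:MP * P = (\sum_i (s i)%:MP * 'X_i) * q + restr (predC1 l) r.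
Proof.
set La := \sum_i _.
elim/mpoly_gen_ind: P => [c|i|p p' [N [q [r e]]] [N' [q' [r' e']]]|
                             p p' [N [q [r e]]] [N' [q' [r' e']]]].
- by exists 0%N, 0, c%:MP; rewrite restrC expr0 mpolyC1; ring.
- have [->|il] := eqVneq i l; last first.
    by exists 0%N, 0, 'X_i; rewrite restrX /= il expr0 mpolyC1; ring.
  exists 1%N, 1, (- \sum_(i | i != l) (s i)%:MP * 'X_i).
  rewrite rmorphN rmorph_sum /= (eq_bigr (fun i => (s i)%:MP * 'X_i)); last first.
    by move=> j jl; rewrite rmorphM /= restrC restrX /= jl.
  by rewrite /La (bigD1 l) //= expr1; ring.
- exists (N + N')%N, ((s l ^+ N')%:MP * q + (s l ^+ N)%:MP * q').
  exists ((s l ^+ N')%:MP * r + (s l ^+ N)%:MP * r').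
  rewrite rmorphD !rmorphM /= !restrC exprD mpolyCM.
  by ring: e e'.
- exists (N + N')%N, (La * q * q' + q * restr (predC1 l) r' + q' * restr (predC1 l) r).
  exists (r * r'); rewrite rmorphM /= exprD mpolyCM.
  transitivity (((s l ^+ N)%:MP * p) * ((s l ^+ N')%:MP * p')); first by ring.
  by rewrite e e'; ring.
Qed.

Lemma rees_evC c : rees_ev f c%:MP = c%:P.
Proof. by rewrite /rees_ev mmapC. Qed.

Lemma rees_evX i : rees_ev f 'X_i = f i *: 'X.
Proof. by rewrite /rees_ev mmapX mmap1U. Qed.

Lemma rees_ev_syz u : \sum_i u i * (f i)%:MP = 0 -> rees_ev f (\sum_i u i * 'X_i) = 0.
Proof.
move=> /(congr1 (rees_ev f)); rewrite rmorph0 !rmorph_sum /= => e.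
transitivity ((\sum_i rees_ev f (u i * (f i)%:MP)) * 'X); last by rewrite e mul0r.
rewrite mulr_suml; apply: eq_bigr => i _.
by rewrite !rmorphM /= rees_evX rees_evC -mul_polyC mulrA.
Qed.

(** On polynomials in the single variable T_i the evaluation T_i |-> f_i t is a
    rescaling by f_i, hence injective. *)
Lemma rees_ev_one_var i P : f i != 0 -> rees_ev f (restr (pred1 i) P) = 0 ->
  restr (pred1 i) P = 0.
Proof.
move=> fi0.
pose rho : S -> {poly R} := mmap polyC (fun j => if j == i then 'X else 0).
pose back : {poly R} -> S := fun p => (map_poly (@mpolyC 3 R) p).['X_i].
have rhoC c : rho c%:MP = c%:P by rewrite /rho mmapC.
have rhoX j : rho 'X_j = if j == i then 'X else 0 by rewrite /rho mmapX mmap1U.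
have rhoD p q : rho (p + q) = rho p + rho q by rewrite /rho rmorphD.
have rhoM p q : rho (p * q) = rho p * rho q by rewrite /rho rmorphM.
have e1 : rees_ev f (restr (pred1 i) P) = rho P \Po (f i *: 'X).
  elim/mpoly_gen_ind: P => [c|j|p q ep eq|p q ep eq].
  - by rewrite restrC rees_evC rhoC comp_polyC.
  - rewrite restrX rhoX /=; case: eqP => [->|_]; last by rewrite rmorph0 comp_poly0.
    by rewrite rees_evX comp_polyX.
  - by rewrite rmorphD /= rmorphD /= ep eq rhoD comp_polyD.
  - by rewrite rmorphM /= rmorphM /= ep eq rhoM comp_polyM.
have e2 : restr (pred1 i) P = back (rho P).
  elim/mpoly_gen_ind: P {e1} => [c|j|p q ep eq|p q ep eq].
  - by rewrite restrC rhoC /back map_polyC hornerC.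
  - rewrite restrX rhoX /back /=; case: eqP => [->|_]; last by rewrite rmorph0 horner0.
    by rewrite map_polyX hornerX.
  - by rewrite rmorphD /= ep eq rhoD /back rmorphD hornerD.
  - by rewrite rmorphM /= ep eq rhoM /back rmorphM hornerM.
rewrite e1 e2 => /eqP; rewrite comp_poly2_eq0 ?size_scale ?size_polyX //.
by move=> /eqP->; rewrite /back rmorph0 horner0.
Qed.

Lemma syz_formD P Q : syz_form P -> syz_form Q -> syz_form (P + Q).
Proof.
move=> [u [u0 ->]] [v [v0 ->]]; exists (fun i => u i + v i); split.
  by rewrite (eq_bigr _ (fun i _ => mulrDl _ _ _)) big_split /= u0 v0 addr0.
by rewrite (eq_bigr _ (fun i _ => mulrDl _ _ _)) big_split.
Qed.

Lemma syz_formM P Q : syz_form P -> syz_form (P * Q).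
Proof.
move=> [u [u0 ->]]; exists (fun i => Q * u i); split.
  by rewrite (eq_bigr _ (fun i _ => esym (mulrA _ _ _))) -mulr_sumr u0 mulr0.
rewrite mulr_suml; apply: eq_bigr => i _; ring.
Qed.

Lemma syz_form_lin (s : 'I_3 -> R) : \sum_m s m * f m = 0 ->
  syz_form (\sum_m (s m)%:MP * 'X_m).
Proof.
move=> s0; exists (fun m => (s m)%:MP); split=> //.
rewrite -[RHS](mpolyC0 3) -s0 raddf_sum; apply: eq_bigr => m _.
by rewrite /= mpolyCM.
Qed.

Lemma rees_ev_syz_form P : syz_form P -> rees_ev f P = 0.
Proof. by move=> [u [u0 ->]]; apply: rees_ev_syz. Qed.

(** The form of the Koszul syzygy between f_i and f_j, a 2x2 minor of the matrix
    with rows f and T. *)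
Definition koszul i j : S := (f i)%:MP * 'X_j - (f j)%:MP * 'X_i.

Lemma koszul_sum i j l : uniq [:: i; j; l] -> koszul i j =
  \sum_m (if m == j then f i else if m == i then - f j else 0)%:MP * 'X_m.
Proof.
move=> U; rewrite (big_ord3 _ U) !eqxx.
rewrite !(uniq3_neq U).
rewrite /koszul raddfN mpolyC0; ring.
Qed.

Lemma syz_form_koszul i j l : uniq [:: i; j; l] -> syz_form (koszul i j).
Proof.
move=> U; rewrite (koszul_sum U); apply: syz_form_lin.
rewrite (big_ord3 _ U) !eqxx.
rewrite !(uniq3_neq U).
ring.
Qed.

Lemma koszul_neq0 i j : i != j -> (f i != 0) || (f j != 0) -> koszul i j != 0.
Proof.
move=> ij ab; apply/eqP => k0.
have := congr1 (mcoeff U_(i)) k0; have := congr1 (mcoeff U_(j)) k0.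
rewrite /koszul !mcoeffB !mcoeffCM !mcoeffXU !eqxx [j == i]eq_sym !(negPf ij) !mcoeff0.
rewrite !mulr0 !mulr1 subr0 sub0r => fi0 /eqP; rewrite oppr_eq0 => /eqP fj0.
by move: ab; rewrite fi0 fj0 eqxx.
Qed.

(** Modulo the Koszul form, f_i T_j = f_j T_i removes T_j, and what is left is a
    polynomial in T_i alone, which vanishes because it evaluates to 0.  The
    exponent N.+1 makes the case f_i = 0 trivial. *)
Lemma two_var_torsion i j l r : uniq [:: i; j; l] ->
  restr (predC1 l) r = r -> rees_ev f r = 0 ->
  exists N q, (f i ^+ N.+1)%:MP * r = koszul i j * q.
Proof.
move=> U rl r0; have [fi0|fi0] := eqVneq (f i) 0.
  by exists 0%N, 0; rewrite fi0 expr1 mpolyC0 mul0r mulr0.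
pose s m := if m == j then f i else if m == i then - f j else 0.
have [N [q [r1]]] := elim_var s j r; rewrite -(koszul_sum U) {1}/s eqxx => e.
have := congr1 (restr (predC1 l)) e.
rewrite rmorphD !rmorphM /= restrC rl restr_restr.
have -> : restr (predC1 l) (koszul i j) = koszul i j.
  by rewrite /koszul rmorphB !rmorphM /= !restrC !restrX /= !(uniq3_neq U).
have -> : restr (predI (predC1 l) (predC1 j)) r1 = restr (pred1 i) r1.
  congr (restr _ _); apply/funext => m /=; move: U {e}; clear.
  by case: i j l m => [[|[|[]]] // ?] [[|[|[]]] // ?] [[|[|[]]] // ?] [[|[|[]]] // ?].
move=> e'; have := congr1 (rees_ev f) e'.
rewrite rmorphD !rmorphM /= r0 mulr0 (rees_ev_syz_form (syz_form_koszul U)) mul0r add0r.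
move=> /esym/(rees_ev_one_var fi0) z; rewrite z addr0 in e'.
exists N, ((f i)%:MP * restr (predC1 l) q); rewrite exprS mpolyCM -mulrA e'; ring.
Qed.

(** After inverting c, the ideal (f_0, f_1, f_2) is generated by f_i and f_j, which
    form a regular sequence or generate the unit ideal. *)
Definition good (c : R) := exists i j l (s : 'I_3 -> R),
  [/\ uniq [:: i; j; l], c = s l, c != 0,
      \sum_m s m * f m = 0 & reg_upto c (f i) (f j)].

Lemma reg_upto_neq0 (c a b : R) : c != 0 -> reg_upto c a b -> (a != 0) || (b != 0).
Proof.
move=> c0 h; rewrite -negb_and; apply/negP => /andP[/eqP a0 /eqP b0].
have [|t []] := h 1 0; first by rewrite a0 b0 mulr0 mul0r.
by rewrite b0 mulr0 mulr1 => /eqP; rewrite (negPf c0).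
Qed.

(** Eliminate T_l with the syzygy; the remainder r involves T_i and T_j only, and
    both f_i^n r and f_j^n r are multiples of the Koszul form.  As f_i^n and f_j^n
    are regular up to a power of c, that power of c times r is a multiple of it as
    well. *)
Lemma good_torsion c P : good c -> rees_ev f P = 0 ->
  exists N, syz_form ((c ^+ N)%:MP * P).
Proof.
move=> [i [j [l [s [U cs c0 s0 cij]]]]] P0.
have [N [q [r0]]] := elim_var s l P; set r := restr _ _ => e.
have r_l : restr (predC1 l) r = r.
  by rewrite /r restr_restr; congr (restr _ _); apply/funext => m /=; rewrite andbb.
have rK : rees_ev f r = 0.
  have := congr1 (rees_ev f) e; rewrite rmorphM rmorphD rmorphM /= P0 mulr0.
  by rewrite (rees_ev_syz_form (syz_form_lin s0)) mul0r add0r.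
have U' : uniq [:: j; i; l] by rewrite /= !inE !(uniq3_neq U).
have [M [q1 e1]] := two_var_torsion U r_l rK.
have [M' [q2 e2]] := two_var_torsion U' r_l rK.
have ab0 := reg_upto_neq0 c0 cij.
have ij : i != j by rewrite (uniq3_neq U).
have k0 := koszul_neq0 ij ab0.
pose n := (M.+1 + M'.+1)%N; pose Q1 := (f i ^+ M'.+1)%:MP * q1.
pose Q2 := - (f j ^+ M.+1)%:MP * q2.
have E1 : (f i ^+ n)%:MP * r = koszul i j * Q1.
  rewrite /n exprD mpolyCM -mulrA [X in _ * X]mulrC mulrA e1 /Q1; ring.
have E2 : (f j ^+ n)%:MP * r = koszul i j * Q2.
  rewrite /n exprD mpolyCM -mulrA e2 /Q2 /koszul; ring.
have E3 : Q1 * (f j ^+ n)%:MP = Q2 * (f i ^+ n)%:MP.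
  apply: (mulfI k0); rewrite mulrA -E1 [RHS]mulrA -E2; ring.
have [t [t1 t2]] := @reg_upto_mpolyC 3 _ _ _ _ (reg_uptoC (@reg_uptoXX _ _ _ _ n cij)) _ _ E3.
set C := (c ^+ n ^+ n)%:MP in t1 t2.
have Cr : C * r = koszul i j * t.
  case/orP: ab0 => a0.
    have a0' : (f i ^+ n)%:MP_[3] != 0 by rewrite mpolyC_eq0 expf_eq0 (negPf a0) andbF.
    apply: (mulfI a0'); rewrite mulrCA E1 mulrCA t1; ring.
  have a0' : (f j ^+ n)%:MP_[3] != 0 by rewrite mpolyC_eq0 expf_eq0 (negPf a0) andbF.
  apply: (mulfI a0'); rewrite mulrCA E2 mulrCA t2; ring.
exists (n * n + N)%N; rewrite exprD mpolyCM -mulrA {2}cs e exprM.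
rewrite mulrDr -/C Cr mulrCA; apply: syz_formD; last exact/syz_formM/(syz_form_koszul U).
exact/syz_formM/syz_form_lin.
Qed.

(** Rescaling all variables by c acts on coefficients by powers of c; so it is
    injective when c is not 0. *)
Lemma comp_scaleE c (P : S) m :
  (P \mPo [tuple c *: 'X_i | i < 3])@_m = c ^+ mdeg m * P@_m.
Proof.
elim/mpolyind: P => [|a m' p _ _ IH]; first by rewrite comp_mpoly0 !mcoeff0 mulr0.
rewrite comp_mpolyD comp_mpolyZ !mcoeffD IH mulrDr; congr (_ + _).
rewrite !mcoeffZ comp_mpolyX (eq_bigr (fun i => c ^+ m' i *: 'X_i ^+ m' i)); last first.
  by move=> i _; rewrite tnth_mktuple exprZn.
rewrite scaler_prod -mpolyXE_id mcoeffZ mcoeffX.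
rewrite prodrXr -mdegE; case: eqP => [->|_]; rewrite ?mulr0 //; ring.
Qed.

(** The substitution T_l |-> - sum_(j != l) s_j T_j, T_m |-> s_l T_m kills the
    linear form and merely rescales the polynomials free of T_l. *)
Lemma lin_form_restr0 (s : 'I_3 -> R) l q r : s l != 0 ->
  (\sum_m (s m)%:MP * 'X_m) * q = restr (predC1 l) r ->
  restr (predC1 l) r = 0.
Proof.
move=> c0 e; pose c := s l.
pose sg := [tuple if m == l then - \sum_(j | j != l) (s j)%:MP * 'X_j else c *: 'X_m | m < 3].
have sgX m : 'X_m \mPo sg = if m == l then - \sum_(j | j != l) (s j)%:MP * 'X_j else c *: 'X_m.
  by rewrite comp_mpolyXU -tnth_nth tnth_mktuple.
have : restr (predC1 l) r \mPo sg = 0.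
  rewrite -e rmorphM /= rmorph_sum /= (bigD1 l) //= rmorphM /= comp_mpolyC sgX eqxx.
  rewrite [X in _ + X](eq_bigr (fun j => c%:MP * ((s j)%:MP * 'X_j))); last first.
    move=> j jl; rewrite rmorphM /= comp_mpolyC sgX (negPf jl) -mul_mpolyC; ring.
  rewrite -mulr_sumr -/c; ring.
have -> : restr (predC1 l) r \mPo sg = restr (predC1 l) r \mPo [tuple c *: 'X_i | i < 3].
  elim/mpoly_gen_ind: r {e} => [a|i|p p' ep ep'|p p' ep ep'].
  - by rewrite restrC !comp_mpolyC.
  - rewrite restrX /=; case: eqP => [|/eqP il]; first by rewrite !comp_mpoly0.
    by rewrite sgX (negPf il) comp_mpolyXU -tnth_nth tnth_mktuple.
  - by rewrite rmorphD /= !comp_mpolyD ep ep'.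
  - by rewrite rmorphM /= !rmorphM /= ep ep'.
move=> z; apply/mpolyP => m; apply/eqP; rewrite mcoeff0.
have /eqP := congr1 (mcoeff m) z.
by rewrite comp_scaleE mcoeff0 mulf_eq0 expf_eq0 (negPf c0) andbF.
Qed.

(** The coordinates of the cross product of (f_0, f_1, f_2) and (T_0, T_1, T_2). *)
Definition cross (m : 'I_3) : S := koszul (m + 1) (m + 1 + 1).

(** Over the fraction field a vector orthogonal to f and T is a multiple g of their
    cross product; the point is that powers of c clear the denominator of g.
    Orthogonality to f and regularity give c u_i - s_i u_l = t f_j / c and its
    analogue for j; orthogonality to T then gives t w = c u_l La, where w is the
    Koszul form of f_i, f_j and La the form of the syzygy s.  Since w does not
    involve T_l and La does, La divides t up to powers of c. *)
Lemma good_cross c (u : 'I_3 -> S) : good c ->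
  \sum_m u m * (f m)%:MP = 0 -> \sum_m u m * 'X_m = 0 ->
  exists N g, forall m, (c ^+ N)%:MP * u m = g * cross m.
Proof.
move=> [i [j [l [s [U cs c0 s0 cij]]]]] uf uT.
have ab0 := reg_upto_neq0 c0 cij.
have ij : i != j by rewrite (uniq3_neq U).
have k0 := koszul_neq0 ij ab0.
move: (s0) (uf) (uT); rewrite !(big_ord3 _ U) -cs => s0' uf' uT'.
have s0S : (s i)%:MP * (f i)%:MP + (s j)%:MP * (f j)%:MP + c%:MP * (f l)%:MP = 0 :> S.
  by rewrite -!mpolyCM -!mpolyCD s0' mpolyC0.
have E : (c%:MP * u i - (s i)%:MP * u l) * (f i)%:MP =
         ((s j)%:MP * u l - c%:MP * u j) * (f j)%:MP.
  apply: (@eq_of_sub _ _ _ (c%:MP * 0 - u l * 0)); last by rewrite !mulr0 subr0.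
  by rewrite -{1}uf' -s0S; ring.
have [t [t1 t2]] := @reg_upto_mpolyC 3 _ _ _ _ cij _ _ E.
set La : S := \sum_m (s m)%:MP * 'X_m.
have LaE : La = (s i)%:MP * 'X_i + (s j)%:MP * 'X_j + c%:MP * 'X_l.
  by rewrite /La (big_ord3 _ U) -cs.
have tw : t * koszul i j = c%:MP * u l * La.
  rewrite LaE /koszul.
  apply: (@eq_of_sub _ _ _ ('X_i * (c%:MP * (c%:MP * u i - (s i)%:MP * u l) - t * (f j)%:MP)
    - 'X_j * (c%:MP * ((s j)%:MP * u l - c%:MP * u j) - t * (f i)%:MP)
    - c%:MP * c%:MP * (u i * 'X_i + u j * 'X_j + u l * 'X_l))); first by ring.
  by rewrite t1 t2 uT' !subrr !mulr0 !subr0.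
have [N [q [r0]]] := elim_var s l t; rewrite -/La -cs => Ct.
have r'0 : restr (predC1 l) (koszul i j * r0) = 0.
  apply: (@lin_form_restr0 s l ((c ^+ N)%:MP * c%:MP * u l - koszul i j * q)); first by rewrite -cs.
  rewrite rmorphM /= /koszul rmorphB !rmorphM /= !restrC !restrX /= !(uniq3_neq U) -/La -/(koszul i j).
  apply: (@eq_of_sub _ _ _ (koszul i j * ((c ^+ N)%:MP * t - (La * q + restr (predC1 l) r0))
    - (c ^+ N)%:MP * (t * koszul i j - c%:MP * u l * La))); first by rewrite /koszul; ring.
  by rewrite tw Ct !subrr !mulr0 subr0.
have {}r'0 : restr (predC1 l) r0 = 0.
  move: r'0; rewrite rmorphM /= /koszul rmorphB !rmorphM /= !restrC !restrX /= !(uniq3_neq U).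
  by move/eqP; rewrite mulf_eq0 -/(koszul i j) (negPf k0) => /eqP.
rewrite r'0 addr0 in Ct.
have La0 : La != 0.
  apply/eqP => /(congr1 (mcoeff U_(l))).
  rewrite LaE !mcoeffD !mcoeffCM !mcoeffXU !(uniq3_neq U) eqxx !mulr0 !add0r mulr1 mcoeff0.
  by move/eqP; rewrite (negPf c0).
have ul : (c ^+ N)%:MP * c%:MP * u l = koszul i j * q.
  apply: (mulIf La0).
  apply: (@eq_of_sub _ _ _ (koszul i j * ((c ^+ N)%:MP * t - La * q)
    - (c ^+ N)%:MP * (t * koszul i j - c%:MP * u l * La))); first by ring.
  by rewrite tw Ct !subrr !mulr0 subr0.
have key : exists N g, [/\ (c ^+ N)%:MP * u i = g * koszul j l,
    (c ^+ N)%:MP * u j = g * koszul l i & (c ^+ N)%:MP * u l = g * koszul i j].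
  exists N.+2, (c%:MP * q); rewrite !exprSr !mpolyCM; split.
  - apply: (@eq_of_sub _ _ _ ((c ^+ N)%:MP * (c%:MP * (c%:MP * u i - (s i)%:MP * u l) - t * (f j)%:MP)
      + (f j)%:MP * ((c ^+ N)%:MP * t - La * q)
      + (s i)%:MP * ((c ^+ N)%:MP * c%:MP * u l - koszul i j * q)
      + q * 'X_j * ((s i)%:MP * (f i)%:MP + (s j)%:MP * (f j)%:MP + c%:MP * (f l)%:MP))).
      by rewrite LaE /koszul; ring.
    by rewrite t1 Ct ul s0S !subrr !mulr0 !addr0.
  - apply: (@eq_of_sub _ _ _ (- (c ^+ N)%:MP * (c%:MP * ((s j)%:MP * u l - c%:MP * u j) - t * (f i)%:MP)
      - (f i)%:MP * ((c ^+ N)%:MP * t - La * q)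
      + (s j)%:MP * ((c ^+ N)%:MP * c%:MP * u l - koszul i j * q)
      - q * 'X_i * ((s i)%:MP * (f i)%:MP + (s j)%:MP * (f j)%:MP + c%:MP * (f l)%:MP))).
      by rewrite LaE /koszul; ring.
    by rewrite t2 Ct ul s0S !subrr !mulr0 !subr0 addr0.
  - apply: (@eq_of_sub _ _ _ (c%:MP * ((c ^+ N)%:MP * c%:MP * u l - koszul i j * q))); first by ring.
    by rewrite ul subrr mulr0.
have [N' [g [h1 h2 h3]]] := key; exists N'.
(* The cross product picks up the sign of the permutation (i, j, l). *)
case: (uniq3_cyclic U) => [[ej el]|[ei el]]; [exists g|exists (- g)] => m.
  have := mem_uniq3 m U; rewrite !inE => /or3P[/eqP->|/eqP->|/eqP->];
  by rewrite /cross ?h1 ?h2 ?h3 ?el ?ej ?ord3_addK.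
have := mem_uniq3 m U; rewrite !inE => /or3P[/eqP->|/eqP->|/eqP->];
rewrite /cross ?h1 ?h2 ?h3 ?el ?ei ?ord3_addK // /koszul; ring.
Qed.

Lemma cross_perp_f : \sum_m cross m * (f m)%:MP = 0.
Proof.
rewrite (@big_ord3 _ _ ord0 (ord0 + 1) (ord0 + 1 + 1)) // /cross ord3_addK /koszul; ring.
Qed.

Lemma cross_perp_X : \sum_m cross m * 'X_m = 0.
Proof.
rewrite (@big_ord3 _ _ ord0 (ord0 + 1) (ord0 + 1 + 1)) // /cross ord3_addK /koszul; ring.
Qed.

Lemma cross_neq0 m : f m != 0 -> exists n, cross n != 0.
Proof.
move=> fm; exists (m + 1); apply: koszul_neq0; last by rewrite ord3_addK fm orbT.
by case: m {fm} => [[|[|[]]]].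
Qed.

End GoodElements.

Lemma pow_ideal_add (R : comNzRingType) (I : R -> Prop) (g h : R) N M :
  I 0 -> (forall x y, I x -> I y -> I (x + y)) -> (forall x y, I x -> I (x * y)) ->
  I (g ^+ N) -> I (h ^+ M) -> I ((g + h) ^+ (N + M)).
Proof.
move=> I0 ID IM gI hI; rewrite exprDn.
elim/big_ind: _ => // i _; rewrite -mulr_natr; apply: (IM).
case: (leqP M i) => Mi.
  by rewrite mulrC -(subnKC Mi) exprD -mulrA; apply: IM.
have Ni : (N <= N + M - i)%N by rewrite leq_subRL ?(leq_trans (ltnW Mi)) ?leq_addl // addnC leq_add2l ltnW.
by rewrite -{1}(subnKC Ni) exprD -mulrA; apply: IM.
Qed.

Lemma rad_ideal_span (R : comNzRingType) (I : R -> Prop) (G : classical_sets.set R) (g : R) :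
  I 0 -> (forall x y, I x -> I y -> I (x + y)) -> (forall x y, I x -> I (x * y)) ->
  (forall c, G c -> exists N, I (c ^+ N)) ->
  g \in ideal_span G -> exists N, I (g ^+ N).
Proof.
move=> I0 ID IM GI /ideal_spanP[s sG ->].
elim: s sG => [|c s IH] sG; first by exists 1%N; rewrite big_nil expr1.
have [] := IH; first by move=> x xs; apply: sG; rewrite inE xs orbT.
move=> N hN; have [M hM] := GI _ (sG _ (mem_head _ _)).
exists (M + N)%N; rewrite big_cons; apply: pow_ideal_add => //.
by rewrite exprMn mulrC; apply: IM.
Qed.

Lemma mpolyC_ideal2 n (R : comNzRingType) (a b c : R) :
  (forall A u v : R, A * c = u * a + v * b -> exists u' v', A = u' * a + v' * b) ->
  forall A u v : {mpoly R[n]}, A * c%:MP = u * a%:MP + v * b%:MP ->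
  exists u' v', A = u' * a%:MP + v' * b%:MP.
Proof.
move=> h A u v /mpolyP E.
have /choice[t tP] m : exists t : R * R, A@_m = t.1 * a + t.2 * b.
  have [] := h A@_m u@_m v@_m.
    have := E m; rewrite mcoeffD ![_ * _%:MP]mulrC !mcoeffCM => e.
    by rewrite mulrC e; ring.
  by move=> u' [v' e]; exists (u', v').
exists (\sum_(m <- msupp A) (t m).1 *: 'X_[m]), (\sum_(m <- msupp A) (t m).2 *: 'X_[m]).
rewrite [LHS]mpolyE !mulr_suml -big_split /=; apply: eq_bigr => m _.
by rewrite -[_ * a%:MP]mulrC -[_ * b%:MP]mulrC !mul_mpolyC !scalerA -scalerDl {1}tP [a * _]mulrC [b * _]mulrC.
Qed.

(** * The kernel of the map to the Rees algebra *)

(** The sequence a plays the role of x^N, y^N, z^N. *)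
Section Torsion.
Variables (R : idomainType) (f a : 'I_3 -> R).
Hypothesis areg : forall n, reg_upto 1 (a 0 ^+ n) (a 1 ^+ n).
Hypothesis areg2 : forall n (A u v : R),
  A * a (1 + 1) ^+ n = u * a 0 ^+ n + v * a 1 ^+ n ->
  exists u' v', A = u' * a 0 ^+ n + v' * a 1 ^+ n.
Hypothesis a_good : forall m, a m \in ideal_span (good f).
Hypothesis a_neq0 : forall m, a m != 0.
Local Notation S := {mpoly R[3]}.

Lemma aregS n (A B : S) : A * (a 0 ^+ n)%:MP = B * (a 1 ^+ n)%:MP ->
  exists t, A = t * (a 1 ^+ n)%:MP /\ B = t * (a 0 ^+ n)%:MP.
Proof.
move=> /(@reg_upto_mpolyC 3 _ _ _ _ (@areg n)) [t [h1 h2]].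
by exists t; rewrite -h1 -h2 mpolyC1 !mul1r.
Qed.

Lemma exists_cross_neq0 : exists m, cross f m != 0.
Proof.
have /ideal_spanP[[|c s] sG a0] := a_good 0.
  by move: (a_neq0 0); rewrite a0 big_nil eqxx.
have [i [j [l [s' [U _ c0 _ /(reg_upto_neq0 c0)]]]]] := sG c (mem_head _ _).
by case/orP => /cross_neq0.
Qed.

(** Two elements a_0^K, a_1^K of a regular sequence are enough to glue the local
    factors g of [good_cross]. *)
Lemma koszul_exact (u : 'I_3 -> S) :
  \sum_m u m * (f m)%:MP = 0 -> \sum_m u m * 'X_m = 0 ->
  exists g, forall m, u m = g * cross f m.
Proof.
move=> uf uT; pose I (c : R) := exists g, forall m, c%:MP * u m = g * cross f m.
have rI c : c \in ideal_span (good f) -> exists N, I (c ^+ N).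
  apply: rad_ideal_span.
  - by exists 0 => m; rewrite mpolyC0 !mul0r.
  - by move=> x y [g hg] [h hh]; exists (g + h) => m; rewrite mpolyCD !mulrDl hg hh.
  - by move=> x y [g hg]; exists (y%:MP * g) => m; rewrite mpolyCM mulrAC hg; ring.
  - by move=> c' c'G; apply: good_cross.
have [N [g0 h0]] := rI _ (a_good 0); have [M [g1 h1]] := rI _ (a_good 1).
pose K := (N + M)%N.
have [g0' h0'] : I (a 0 ^+ K).
  by exists ((a 0 ^+ M)%:MP * g0) => m; rewrite exprD mpolyCM mulrAC h0; ring.
have [g1' h1'] : I (a 1 ^+ K).
  by exists ((a 1 ^+ N)%:MP * g1) => m; rewrite exprD mpolyCM -mulrA h1; ring.
have [n0 cn0] := exists_cross_neq0.
have [t [ht1 ht2]] : exists t, g1' = t * (a 1 ^+ K)%:MP /\ g0' = t * (a 0 ^+ K)%:MP.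
  apply: aregS; apply: (mulIf cn0); rewrite mulrAC -h1' [RHS]mulrAC -h0'; ring.
exists t => m.
have a0' : (a 0 ^+ K)%:MP_[3] != 0 by rewrite mpolyC_eq0 expf_neq0.
by apply: (mulfI a0'); rewrite h0' ht2; ring.
Qed.

(** Write a_0^K P, a_1^K P, a_2^K P as forms of vectors u, v, w of syzygies.  The
    differences a_1 u - a_0 v, a_2 v - a_1 w, a_0 w - a_2 u (exponents K omitted)
    are multiples g, al, be of the cross product, with
    a_2 g + a_0 al + a_1 be = 0.  Hence g = g1 a_0 + g2 a_1, and subtracting
    g2 times the cross product from u makes it divisible by a_0. *)
Lemma syz_form_of_rees P : rees_ev f P = 0 -> syz_form f P.
Proof.
move=> P0; pose I (c : R) := syz_form f (c%:MP * P).
have IM x y : I x -> I (x * y).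
  by rewrite /I => h; rewrite mpolyCM mulrAC; apply: syz_formM.
have rI m : exists N, I (a m ^+ N).
  apply: rad_ideal_span (a_good m) => //.
  - by exists (fun _ => 0); rewrite mpolyC0 mul0r !big1 // => i _; rewrite mul0r.
  - by move=> x y hx hy; rewrite /I mpolyCD mulrDl; apply: syz_formD.
  - by move=> c' c'G; apply: good_torsion.
have [N0 h0] := rI 0; have [N1 h1] := rI 1; have [N2 h2] := rI (1 + 1).
pose K := (N0 + N1 + N2)%N.
have {h0}[u [uf uT]] : I (a 0 ^+ K) by rewrite /K -addnA exprD; apply: IM.
have {h1}[v [vf vT]] : I (a 1 ^+ K) by rewrite /K addnAC addnC exprD; apply: IM.
have {h2}[w [wf wT]] : I (a (1 + 1) ^+ K) by rewrite /K addnC exprD; apply: IM.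
set b0 := (a 0 ^+ K)%:MP in uT; set b1 := (a 1 ^+ K)%:MP in vT.
set b2 := (a (1 + 1) ^+ K)%:MP in wT.
have ex (p q : 'I_3 -> S) (x y : S) :
    \sum_i p i * (f i)%:MP = 0 -> \sum_i q i * (f i)%:MP = 0 ->
    x * P = \sum_i p i * 'X_i -> y * P = \sum_i q i * 'X_i ->
    exists g, forall m, y * p m - x * q m = g * cross f m.
  move=> pf qf pT qT; apply: koszul_exact.
    rewrite (eq_bigr (fun i => y * (p i * (f i)%:MP) - x * (q i * (f i)%:MP))); last by move=> i _; ring.
    by rewrite sumrB -!mulr_sumr pf qf !mulr0 subr0.
  rewrite (eq_bigr (fun i => y * (p i * 'X_i) - x * (q i * 'X_i))); last by move=> i _; ring.
  by rewrite sumrB -!mulr_sumr -pT -qT; ring.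
have [g hg] := ex _ _ _ _ uf vf uT vT.
have [al hal] := ex _ _ _ _ vf wf vT wT.
have [be hbe] := ex _ _ _ _ wf uf wT uT.
have [n0 cn0] := exists_cross_neq0.
have rel : g * b2 = (- al) * b0 + (- be) * b1.
  apply: (mulIf cn0).
  transitivity (b2 * (g * cross f n0)); first by ring.
  transitivity (- b0 * (al * cross f n0) - b1 * (be * cross f n0)); last by ring.
  by rewrite -hg -hal -hbe; ring.
have [g1 [g2 gE]] := mpolyC_ideal2 (@areg2 K) rel.
have /choice[t ht] m : exists t, u m - g2 * cross f m = t * b0.
  have [] := @aregS K (v m + g1 * cross f m) (u m - g2 * cross f m).
    rewrite -/b0 -/b1; apply: (@eq_of_sub _ _ _ (- (b1 * u m - b0 * v m - g * cross f m))).
      by rewrite gE -/b0 -/b1; ring.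
    by rewrite hg subrr oppr0.
  by move=> t [_ e]; exists t.
have b00 : b0 != 0 by rewrite mpolyC_eq0 expf_neq0.
exists t; split.
  apply: (mulfI b00); rewrite mulr0 mulr_sumr.
  rewrite (eq_bigr (fun i => u i * (f i)%:MP - g2 * (cross f i * (f i)%:MP))).
    by rewrite sumrB -mulr_sumr cross_perp_f uf mulr0 subr0.
  by move=> i _; rewrite mulrA [b0 * _]mulrC -ht; ring.
apply: (mulfI b00); rewrite uT mulr_sumr.
rewrite [RHS](eq_bigr (fun i => u i * 'X_i - g2 * (cross f i * 'X_i))).
  by rewrite sumrB -mulr_sumr cross_perp_X mulr0 subr0.
by move=> i _; rewrite mulrA [b0 * _]mulrC -ht; ring.
Qed.

End Torsion.

(** * From syzygies to the symmetric algebra *)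

Module FreeSymInd.
Import monalg.

Definition freeSymAlg (A : comNzRingType) (M : lmodType A) : comAlgType A :=
  {malg A[{cmonom M}]}.

Lemma malgUZ (K : choiceType) (R : nzRingType) c k :
  << c *g k >> = c *: << 1 *g k >> :> {malg R[K]}.
Proof.
by apply/malgP => k'; rewrite mcoeffZ !mcoeffU mulrnAr mulr1.
Qed.

Section S.
Variables (A : comNzRingType) (M : lmodType A).
Local Notation freeSym := {malg A[{cmonom M}]}.

Lemma freeSym_ind (E : freeSym -> Prop) :
  (forall c, E c%:A) -> (forall u, E (freeSym_var u)) ->
  (forall p q, E p -> E q -> E (p + q)) ->
  (forall p q, E p -> E q -> E (p * q)) -> forall p, E p.
Proof.
move=> hC hV hD hM p; rewrite [p]monalgE.
have hU n : forall k : {cmonom M}, (mdeg k <= n)%N -> E << 1 *g k >>.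
  elim: n => [|n IH] k kn.
    have -> : k = mone by apply: mdeg_eq0I; apply/eqP; rewrite -leqn0.
    by have := hC 1; rewrite scale1r.
  have [->|k1] := eqVneq k mone; first by have := hC 1; rewrite scale1r.
  have [u uk] : exists u, k u != 0%N.
    apply/not_existsP => h; case/eqP: k1; apply/eqP/cmP => u; rewrite cm1.
    by apply/eqP/negP => /negP; apply: h.
  have ek : k = mmul (ucm u) (divcm k (ucm u)).
    apply/eqP/cmP => v; rewrite cmM divcmE cmU.
    by case: eqVneq => [<-|_] /=; rewrite ?subn0 // addnC subnK // lt0n.
  have -> : << 1 *g k >> = freeSym_var u * << 1 *g divcm k (ucm u) >> :> freeSym.
    rewrite {1}ek freeSym_varE; symmetry; have := fgmulUU (1 : A) 1 (ucm u) (divcm k (ucm u)).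
    by rewrite mulr1 => <-.
  apply: hM => //; apply: IH.
  by move: kn; rewrite {1}ek mdegM mdegU.
elim/big_ind: _ => [||k _]; first by have := hC 0; rewrite scale0r.
  exact: hD.
rewrite malgUZ -[_ *: _]mulr_algl.
by apply: hM => //; apply: hU (leqnn _).
Qed.
End S.
End FreeSymInd.

Section LinearTypeCriterion.
Variables (A : comNzRingType) (m : nat) (f : 'I_m -> A).

Lemma sym_gen_is_linear (M : lmodType A) : linear (@sym_gen A M).
Proof.
move=> a u v; rewrite /sym_gen.
rewrite -[a *: quotAlg_pi _ _]linearZ -raddfD; apply/quotAlg_piP.
by apply: mem_ideal_span; exists a, u, v.
Qed.

HB.instance Definition _ (M : lmodType A) :=
  GRing.isLinear.Build A M (symAlg M) *:%R (@sym_gen A M) (@sym_gen_is_linear M).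

Lemma gen_ideal_gen_subproof i : f i \in gen_ideal f.
Proof. by apply: mem_ideal_span; exists i. Qed.

Definition ideal_gen i : idealMod f := IdealMod (gen_ideal_gen_subproof i).

Lemma idealMod_gen (u : idealMod f) : exists a : 'I_m -> A,
  u = \sum_i a i *: ideal_gen i.
Proof.
have [a ha] : exists a : 'I_m -> A, (val u : A) = \sum_i a i * f i.
  case: u => x /= /ideal_spanP[s sG ->].
  elim: s sG => [|c s IH] sG.
    by exists (fun _ => 0); rewrite big_nil big1 // => i _; rewrite mul0r.
  have [] := IH; first by move=> x' xs; apply: sG; rewrite inE xs orbT.
  move=> a ha; have [i _ ci] := sG _ (mem_head _ _).
  exists (fun j => a j + c.1 *+ (j == i)); rewrite big_cons ha -ci.
  under [RHS]eq_bigr => j _ do rewrite mulrDl.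
  rewrite big_split /= addrC; congr (_ + _).
  rewrite (bigD1 i) //= eqxx mulr1n big1 ?addr0 // => j /negPf->.
  by rewrite mulr0n mul0r.
exists a; apply: val_inj; rewrite [LHS]ha raddf_sum /=.
by apply: eq_bigr => i _.
Qed.

(** The surjection from A[T_1..T_m] onto the symmetric algebra given by the chosen
    generators of the ideal. *)
Definition sym_ev (P : {mpoly A[m]}) : symAlg (idealMod f) :=
  quotAlg_pi _ (mmap (in_alg (FreeSymInd.freeSymAlg (idealMod f))) (fun i => freeSym_var (ideal_gen i)) P).

Lemma sym_evD P Q : sym_ev (P + Q) = sym_ev P + sym_ev Q.
Proof. by rewrite /sym_ev !rmorphD. Qed.

Lemma sym_evM P Q : sym_ev (P * Q) = sym_ev P * sym_ev Q.
Proof. by rewrite /sym_ev !rmorphM. Qed.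

Lemma sym_evZ c P : sym_ev (c *: P) = c *: sym_ev P.
Proof. by rewrite /sym_ev mmapZ /= mulr_algl linearZ. Qed.

Lemma sym_evX i : sym_ev 'X_i = sym_gen (ideal_gen i).
Proof. by rewrite /sym_ev mmapX mmap1U. Qed.

Lemma sym_ev_surj x : exists P, x = sym_ev P.
Proof.
rewrite -[x]quotAlg_reprK; move: (repr x) => p {x}.
elim/FreeSymInd.freeSym_ind: p => [c|u|p q [P eP] [Q eQ]|p q [P eP] [Q eQ]].
- by exists (c *: 1); rewrite sym_evZ linearZ /= /sym_ev !rmorph1.
- have [a ->] := idealMod_gen u; exists (\sum_i a i *: 'X_i).
  rewrite -[LHS]/(sym_gen _) linear_sum.
  elim/big_rec2: _ => [|i y1 y2 _ ->]; first by rewrite /sym_ev !rmorph0.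
  by rewrite sym_evD sym_evZ sym_evX linearZ.
- by exists (P + Q); rewrite sym_evD rmorphD /= eP eQ.
- by exists (P * Q); rewrite sym_evM rmorphM /= eP eQ.
Qed.

Lemma sym_to_rees_ev P : val (sym_to_rees (sym_ev P)) = rees_ev f P.
Proof.
rewrite /sym_to_rees /sym_ev sym_lift_pi.
pose g : {rmorphism {mpoly A[m]} -> FreeSymInd.freeSymAlg (idealMod f)} :=
  mmap (in_alg (FreeSymInd.freeSymAlg (idealMod f)))
    (fun i => freeSym_var (ideal_gen i)).

pose h1 : {rmorphism reesAlg f -> {poly A}} := (val : reesAlg f -> {poly A}).
pose h2 : {rmorphism FreeSymInd.freeSymAlg (idealMod f) -> reesAlg f} := freeSym_ev (@rees_gen A m f).
pose h : {rmorphism {mpoly A[m]} -> {poly A}} := h1 \o (h2 \o g).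
apply: (@mpoly_rmorph_ext _ _ _ h (rees_ev f)) => [c|i] /=.
- rewrite mmapC [freeSym_ev _ _]linearZ /= rmorph1 /=.
  by rewrite /rees_ev mmapC alg_polyC.
- by rewrite mmapX mmap1U freeSym_ev_var /rees_ev mmapX mmap1U.
Qed.

(** Each coefficient of the vector u is a syzygy over A, and linearity of the
    generators kills its form in the symmetric algebra. *)
Lemma sym_ev_syz (u : 'I_m -> {mpoly A[m]}) :
  \sum_i u i * (f i)%:MP = 0 -> sym_ev (\sum_i u i * 'X_i) = 0.
Proof.
move=> u0; pose k := (\max_i msize (u i))%N.
have uE i : u i = \sum_(n : 'X_{1..m < k}) (u i)@_n *: 'X_[n].
  by apply: mpolywE; rewrite (bigmax_sup i).
have sym_ev_sum (I : finType) (F : I -> {mpoly A[m]}) :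
    sym_ev (\sum_i F i) = \sum_i sym_ev (F i).
  by apply: big_morph; [exact: sym_evD | rewrite /sym_ev !rmorph0].
rewrite sym_ev_sum.
transitivity (\sum_i \sum_(n : 'X_{1..m < k})
    sym_ev 'X_[n] * sym_gen ((u i)@_n *: ideal_gen i)).
  apply: eq_bigr => i _; rewrite {1}[u i]uE mulr_suml sym_ev_sum.
  apply: eq_bigr => n _; rewrite linearZ /= -sym_evX -sym_evZ -sym_evM.
  by rewrite -scalerAl -scalerAr.
rewrite exchange_big big1 //= => n _; rewrite -mulr_sumr -linear_sum /=.
have -> : \sum_i (u i)@_n *: ideal_gen i = 0.
  apply: val_inj; rewrite raddf_sum /=.
  have := congr1 (mcoeff n) u0; rewrite mcoeff0 raddf_sum /= => e.
  by rewrite -[RHS]e; apply: eq_bigr => i _; rewrite mulrC mcoeffCM mulrC.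
by rewrite linear0 mulr0.
Qed.

(** As sym_ev is onto, an element of the kernel of Sym -> Rees comes from a
    polynomial P that evaluates to 0 in A[t]. *)
Lemma linear_type_of_syz :
  (forall P, rees_ev f P = 0 -> exists u : 'I_m -> {mpoly A[m]},
     \sum_i u i * (f i)%:MP = 0 /\ P = \sum_i u i * 'X_i) -> linear_type f.
Proof.
move=> h x y exy; apply/eqP; rewrite -subr_eq0; apply/eqP.
have : sym_to_rees (x - y) = 0.
  by rewrite /sym_to_rees [sym_lift _ _]raddfB; apply/eqP; rewrite subr_eq0; apply/eqP.
have [P ->] := sym_ev_surj (x - y) => P0.
have [|u [u0 ->]] := h P; last exact: sym_ev_syz.
by rewrite -sym_to_rees_ev P0.
Qed.

End LinearTypeCriterion.

(** * Nullstellensatz in the plane and in a chart of the projective plane *)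

(** An ideal of k[X] is principal, and a nonconstant generator has a root. *)
Lemma poly_ideal_no_root (k : closedFieldType) (J : {poly k} -> Prop) :
  (forall p q, J p -> J q -> J (p + q)) -> (forall p q, J p -> J (p * q)) ->
  (forall b, exists2 p, J p & p.[b] != 0) -> J 1.
Proof.
move=> JD JM Jb.
have [p0 Jp0 p0b] := Jb 0.
have p0n0 : p0 != 0 by apply: contraNneq p0b => ->; rewrite horner0.
have [n] := ubnP (size p0); elim: n => // n IH in p0 Jp0 p0n0 {p0b} *.
have [/size_poly1P[c c0 ec] _|s1] := boolP (size p0 == 1%N).
  by have := JM _ (c^-1)%:P Jp0; rewrite ec -polyCM divff.
have [b rb] := closed_rootP _ s1; have [g Jg gb] := Jb b.
rewrite ltnS => sn; have [[u v] /= e] := Bezoutp g p0.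
have Je : J (u * g + v * p0) by apply: JD; rewrite mulrC; apply: JM.
have en0 : u * g + v * p0 != 0 by rewrite -size_poly_eq0 (eqp_size e) size_poly_eq0 gcdp_eq0 negb_and p0n0 orbT.
apply: (IH _ Je en0); rewrite (eqp_size e) (leq_trans _ sn) // ltn_neqAle.
rewrite dvdp_leq ?dvdp_gcdr // andbT dvdp_size_eqp ?dvdp_gcdr //.
apply/negP => /eqp_dvdl h; have : p0 %| g by rewrite -h dvdp_gcdl.
by move/root_dvdp => /(_ _ rb); rewrite /root (negPf gb).
Qed.

Section Nullstellensatz2.
Variables (k : closedFieldType) (I : {poly {poly k}} -> Prop).
Hypothesis ID : forall p q, I p -> I q -> I (p + q).
Hypothesis IM : forall p q, I p -> I (p * q).
Hypothesis Iab : forall a b, exists2 g, I g & (map_poly (horner_eval a) g).[b] != 0.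

(** The restrictions of I to the line x = a form an ideal of k[Y] without zeros. *)
Lemma slice_unit a : exists2 g, I g & map_poly (horner_eval a) g = 1.
Proof.
pose J p := exists2 g, I g & map_poly (horner_eval a) g = p.
apply: (@poly_ideal_no_root _ J).
- by move=> _ _ [g Ig <-] [h Ih <-]; exists (g + h); [exact: ID | rewrite rmorphD].
- move=> _ q [g Ig <-]; exists (g * map_poly polyC q); first exact: IM.
  rewrite rmorphM /=; congr (_ * _); apply/polyP => i.
  by rewrite !coef_map /= /horner_eval hornerC.
- by move=> b; have [g Ig gb] := Iab a b; exists (map_poly (horner_eval a) g) => //; exists g.
Qed.

Lemma slice_eq0 a (g : {poly {poly k}}) : map_poly (horner_eval a) g = 0 ->
  exists h, g = ('X - a%:P)%:P * h.
Proof.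
move=> g0; exists (map_poly (fun p => p %/ ('X - a%:P)) g).
apply/polyP => i; rewrite mul_polyC coefZ coef_map_id0 ?div0p //.
have /eqP := congr1 (fun p : {poly k} => p`_i) g0.
rewrite coef_map /= coef0 => /factor_theorem[q ->].
by rewrite mulpK ?polyXsubC_eq0 // mulrC.
Qed.

(** A polynomial q(x) in I splits into factors x - a.  By [slice_unit] the ideal
    contains some 1 + (x - a) h, and this removes the factors one by one. *)
Lemma nullstellensatz2_of_const (q : {poly k}) : q != 0 -> I q%:P -> I 1.
Proof.
have [rs ->] := closed_field_poly_normal q; set c := lead_coef q => q0.
have {q0} c0 : c != 0 by apply: contraNneq q0 => ->; rewrite scale0r.
move=> /(@IM _ (c^-1)%:P%:P); rewrite -polyCM -mul_polyC mulrAC -polyCM divff // mul1r.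
elim: rs => [|a rs IH]; first by rewrite big_nil.
rewrite big_cons => Ia; apply: IH.
have [g Ig ga] := slice_unit a.
have [|h hg] := @slice_eq0 a (g - 1); first by rewrite rmorphB /= ga rmorph1 subrr.
set P := \prod_(j <- _) _ in Ia *.
have -> : P%:P = g * P%:P + (('X - a%:P) * P)%:P * (- h).
  have -> : g = ('X - a%:P)%:P * h + 1 by rewrite -hg subrK.
  rewrite polyCM; ring.
by apply: ID; apply: IM.
Qed.

(** It suffices to find a nonzero polynomial in x alone.  Choose F in I that
    involves y, a value a where its leading coefficient does not vanish, and g in I
    with g(a, y) = 1.  The resultant of F and g lies in I; it is nonzero because
    at x = a the two polynomials are coprime. *)
Lemma nullstellensatz2 : I 1.
Proof.
have [F0 IF0 F0n0] := Iab 0 0.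
pose F := F0 * 'X; have IF : I F by apply: IM.
have {F0n0} F0n0 : F0 != 0.
  by apply: contraNneq F0n0 => ->; rewrite rmorph0 horner0.
have sF : (1 < size F)%N by rewrite size_mulX // ltnS lt0n size_poly_eq0.
have Fn0 : F != 0 by rewrite -size_poly_gt0 ltnW.
have [a ra] : exists a, ~~ root (lead_coef F) a.
  by apply/closed_nonrootP; rewrite lead_coef_eq0.
have [g Ig ga] := slice_unit a.
(* At x = a the polynomial g drops to degree 0, and resultants commute with
   specialisation only when leading coefficients survive; adding a multiple of F
   gives h the leading coefficient of F without changing coprimality. *)
pose h := g + F * 'X^(size g).
have Ih : I h by apply: ID => //; apply: IM.
have sgF : (size g < size (F * 'X^(size g))%R)%N.
  by rewrite size_mulXn // -[X in (X < _)%N]addn0 ltn_add2l ltnW.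
have lh : lead_coef h = lead_coef F.
  by rewrite /h lead_coefDr // lead_coef_Mmonic // monicXn.
have sh : (1 < size h)%N.
  by rewrite /h addrC size_polyDl // size_mulXn // (leq_trans sF) // leq_addl.
have [[u v] /= _ e] := resultant_in_ideal sF sh.
apply: (@nullstellensatz2_of_const (resultant F h)); last first.
  by rewrite e; apply: ID; rewrite mulrC; apply: IM.
apply/eqP => r0.
have := map_resultant (f := horner_eval a) (p := F) (q := h).
rewrite lh r0 rmorph0 => /(_ ra ra)/esym/eqP.
have -> : map_poly (horner_eval a) h =
    map_poly (horner_eval a) 'X^(size g) * map_poly (horner_eval a) F + 1.
  by rewrite /h raddfD /= ga [F * _]mulrC rmorphM /= addrC.
rewrite resultant_eq0; set Fa := map_poly _ F; set Xa := map_poly _ _.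
by have := coprimep_addl_mul Xa 1 Fa; rewrite coprimep1 /coprimep => /eqP->.
Qed.

End Nullstellensatz2.

Section PlaneNullstellensatz.
Variable k : closedFieldType.

Definition mpoly2_poly : {mpoly k[2]} -> {poly {poly k}} :=
  mmap (polyC \o polyC) (fun i => if i == 0 then 'X%:P else 'X).

Definition poly_mpoly2 : {poly {poly k}} -> {mpoly k[2]} :=
  horner_eval 'X_1 \o map_poly (horner_eval 'X_0 \o map_poly (@mpolyC 2 k)).

HB.instance Definition _ := GRing.RMorphism.copy poly_mpoly2
  (horner_eval 'X_1 \o map_poly (horner_eval 'X_0 \o map_poly (@mpolyC 2 k))).

Lemma mpoly2_polyK : cancel mpoly2_poly poly_mpoly2.
Proof.
elim/mpoly_gen_ind => [c|i|p q ep eq|p q ep eq].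
- rewrite /mpoly2_poly mmapC /poly_mpoly2 /= map_polyC /horner_eval hornerC /=.
  by rewrite map_polyC /horner_eval hornerC.
- rewrite /mpoly2_poly mmapX mmap1U /poly_mpoly2 /=.
  case: i => [[|[|]]] //= ?.
    rewrite map_polyC /horner_eval hornerC /= map_polyX ?/horner_eval hornerX.
    by congr mpolyX; congr mnm1; apply: val_inj.
  rewrite map_polyX /horner_eval hornerX.
  by congr mpolyX; congr mnm1; apply: val_inj.
- by rewrite /mpoly2_poly rmorphD rmorphD /= -/(mpoly2_poly _) ep -/(mpoly2_poly _) eq.
- by rewrite /mpoly2_poly rmorphM rmorphM /= -/(mpoly2_poly _) ep -/(mpoly2_poly _) eq.
Qed.

Lemma mpoly2_poly_eval (v : 'I_2 -> k) g :
  (map_poly (horner_eval (v 0)) (mpoly2_poly g)).[v 1] = g.@[v].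
Proof.
pose ev : {rmorphism {poly {poly k}} -> k} :=
  horner_eval (v 1) \o map_poly (horner_eval (v 0)).
pose h : {rmorphism {mpoly k[2]} -> k} := ev \o (mmap (polyC \o polyC) (fun i => if i == 0 then 'X%:P else 'X)).
apply: (@mpoly_rmorph_ext _ _ _ h (meval v)) => [c|i] /=.
  by rewrite mmapC mevalC /= map_polyC /= !horner_evalE !hornerC.
rewrite mmapX mmap1U mevalXU.
case: i => [[|[|]]] //= ?.
  rewrite map_polyC /= !horner_evalE hornerC hornerX.
  by congr v; apply: val_inj.
rewrite map_polyX !horner_evalE hornerX.
by congr v; apply: val_inj.
Qed.

Lemma nullstellensatz_mpoly2 (G : set {mpoly k[2]}) :
  (forall v, exists2 g, G g & g.@[v] != 0) -> 1 \in ideal_span G.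
Proof.
move=> Gv; rewrite -(rmorph1 poly_mpoly2).
apply: (@nullstellensatz2 _ (fun p => poly_mpoly2 p \in ideal_span G)).
- by move=> p q; rewrite rmorphD; apply: ideal_spanD.
- by move=> p q Gp; rewrite rmorphM mulrC; apply: ideal_spanM.
- move=> a b; have [g Gg gv] := Gv (fun i => if i == 0 then a else b).
  exists (mpoly2_poly g); first by rewrite mpoly2_polyK; apply: mem_ideal_span.
  by have := mpoly2_poly_eval (fun i => if i == 0 then a else b) g => /= ->.
Qed.

End PlaneNullstellensatz.

Section Homogenisation.
Variable k : fieldType.
Local Notation R2 := {mpoly k[2]}.
Local Notation R3 := {mpoly k[3]}.

(** Homogenisation and dehomogenisation of exponents with respect to the last
    variable; [hmnm e m] is meaningful for mdeg m <= e. *)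
Definition hmnm (e : nat) (m : 'X_{1..2}) : 'X_{1..3} :=
  [multinom [tuple m 0; m 1; (e - mdeg m)%N]].

Definition dmnm (m : 'X_{1..3}) : 'X_{1..2} :=
  [multinom [tuple m 0; m 1]].

Lemma mdeg2E (m : 'X_{1..2}) : mdeg m = (m 0%R + m 1%R)%N.
Proof. by rewrite mdegE !big_ord_recl big_ord0 addn0; congr (m _ + m _)%N; apply: val_inj. Qed.

Lemma mdeg3E (m : 'X_{1..3}) : mdeg m = (m 0%R + m 1%R + m (1 + 1)%R)%N.
Proof.
by rewrite mdegE !big_ord_recl big_ord0 addn0 addnA; congr (m _ + m _ + m _)%N; apply: val_inj.
Qed.

Lemma hmnmE e m : (hmnm e m 0 = m 0) * (hmnm e m 1 = m 1) *
  (hmnm e m (1 + 1) = (e - mdeg m)%N).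
Proof. by rewrite /hmnm !multinomE !(tnth_nth 0%N). Qed.

Lemma dmnmE m : (dmnm m 0 = m 0) * (dmnm m 1 = m 1).
Proof. by rewrite /dmnm !multinomE !(tnth_nth 0%N). Qed.

Lemma hmnm_add M m n : (mdeg m <= M)%N ->
  hmnm (M + mdeg n) (m + dmnm n)%MM = (hmnm M m + n)%MM.
Proof.
move=> mM; apply/mnmP; apply: ord3_ind; rewrite mnmDE !hmnmE ?mnmDE ?dmnmE //.
rewrite mdegD (mdeg2E (dmnm n)) !dmnmE mdeg3E; lia.
Qed.

Lemma mdeg_hmnm M m : (mdeg m <= M)%N -> mdeg (hmnm M m) = M.
Proof. by move=> mM; rewrite mdeg3E !hmnmE mdeg2E in mM *; lia. Qed.

Lemma dmnm_hmnm M m : dmnm (hmnm M m) = m.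
Proof. by apply/mnmP; apply: ord2_ind; rewrite !dmnmE !hmnmE. Qed.

Lemma dehomog_zE (p : R3) : dehomog_z p = \sum_(m <- msupp p) p@_m *: 'X_[dmnm m].
Proof.
rewrite /dehomog_z comp_mpolyEX; apply: eq_bigr => m _; congr (_ *: _).
rewrite comp_mpolyX !big_ord_recl big_ord0 mulr1 !(tnth_nth 0) /= expr1n mulr1.
rewrite [RHS]mpolyXE_id !big_ord_recl big_ord0 mulr1.
have -> : lift ord0 ord0 = 1 :> 'I_2 by apply: val_inj.
by rewrite !dmnmE; congr (_ * _ ^+ m _); apply: val_inj.
Qed.

(** The sum is cut off at degree M, so that the map is linear on all polynomials
    while its values are homogeneous of degree M. *)
Definition homog_z (M : nat) (g : R2) : R3 :=
  \sum_(m : 'X_{1..2 < M.+1}) g@_m *: 'X_[hmnm M m].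

Lemma homog_z_is_linear M : linear (homog_z M).
Proof.
move=> a p q; rewrite /homog_z scaler_sumr -big_split /=; apply: eq_bigr => m _.
by rewrite mcoeffD mcoeffZ scalerDl scalerA.
Qed.

HB.instance Definition _ M :=
  GRing.isLinear.Build k R2 R3 *:%R (homog_z M) (homog_z_is_linear M).

Lemma homog_zX M m : (mdeg m <= M)%N -> homog_z M 'X_[m] = 'X_[hmnm M m].
Proof.
rewrite -ltnS => mM; rewrite /homog_z (bigD1 (BMultinom mM)) //= mcoeffX eqxx scale1r.
rewrite big1 ?addr0 // => n nm; rewrite mcoeffX; case: eqP => [mn|]; last by rewrite scale0r.
by case/eqP: nm; apply: val_inj; rewrite /= mn.
Qed.

(** For polynomials of degree at most M, homogenisation commutes with multiplication
    by a homogeneous polynomial; membership in an ideal with homogeneous generators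
    can therefore be homogenised. *)
Lemma homog_zM M e (h : R2) (C : R3) : (msize h <= M.+1)%N -> C \is e.-homog ->
  homog_z (M + e) (h * dehomog_z C) = homog_z M h * C.
Proof.
move=> hM Ce; rewrite dehomog_zE [X in homog_z _ (X * _) = _]mpolyE.
rewrite [X in _ = homog_z _ X * _]mpolyE [X in _ = _ * X]mpolyE.
rewrite mulr_suml !raddf_sum mulr_suml big_seq [RHS]big_seq /=.
apply: eq_bigr => m /msize_mdeg_lt mh.
have mM : (mdeg m <= M)%N by rewrite -ltnS (leq_trans mh).
rewrite !mulr_sumr raddf_sum big_seq [RHS]big_seq; apply: eq_bigr => n nC.
have <- : mdeg n = e by move/dhomogP: Ce => /(_ n nC).
rewrite linearZ /= homog_zX // -!scalerAl -!scalerAr -!mpolyXD !linearZ /=.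
rewrite homog_zX ?hmnm_add //; first by rewrite !scalerA mulrC.
by rewrite mdegD leq_add // mdeg2E mdeg3E !dmnmE leq_addr.
Qed.

Lemma homog_z_homog M h : homog_z M h \is M.-homog.
Proof.
apply: rpred_sum => m _; apply: rpredZ; rewrite dhomogX /=.
by rewrite mdeg_hmnm // -ltnS bmdeg.
Qed.

Lemma homog_zK M h : (msize h <= M.+1)%N -> dehomog_z (homog_z M h) = h.
Proof.
move=> hM; rewrite {2}[h](mpolywE hM) /homog_z /dehomog_z raddf_sum.
apply: eq_bigr => m _; rewrite /= comp_mpolyZ; congr (_ *: _).
by rewrite -[LHS]/(dehomog_z _) dehomog_zE msuppX big_seq1 mcoeffX eqxx scale1r dmnm_hmnm.
Qed.

Lemma homog_z1 M : homog_z M 1 = 'X_(1 + 1) ^+ M.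
Proof.
rewrite -mpolyX0 homog_zX ?mdeg0 // [RHS]mpolyXn; congr mpolyX.
by apply/mnmP; apply: ord3_ind; rewrite mulmnE !hmnmE mnm1E ?mdeg0 ?mnm0E ?subn0 ?mul1n.
Qed.

End Homogenisation.

Lemma nullstellensatz_chart (k : closedFieldType) (G : set {mpoly k[3]}) :
  (forall g, G g -> exists e, g \is e.-homog) ->
  (forall v, exists2 g, G g & (dehomog_z g).@[v] != 0) ->
  exists M, 'X_(1 + 1) ^+ M \in ideal_span G.
Proof.
move=> Gh Gv.
have : 1 \in ideal_span [set dehomog_z g | g in G].
  apply: nullstellensatz_mpoly2 => v; have [g Gg gv] := Gv v.
  by exists (dehomog_z g) => //; exists g.
move=> /ideal_spanP[s sG E].
suff [M0 hM0] : exists M0, forall M, (M0 <= M)%N ->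
    homog_z M (\sum_(c <- s) c.1 * c.2) \in ideal_span G.
  by exists M0; rewrite -homog_z1 E; apply: hM0.
elim: s sG {E} => [|c s IH] sG.
  by exists 0%N => M _; rewrite big_nil raddf0 ideal_span0.
have [] := IH; first by move=> x xs; apply: sG; rewrite inE xs orbT.
move=> M1 h1; have [g Gg gc] := sG _ (mem_head _ _); have [e ge] := Gh _ Gg.
exists (maxn M1 (msize c.1 + e)) => M; rewrite geq_max => /andP[M1M cM].
rewrite big_cons raddfD /=; apply: ideal_spanD; last exact: h1.
rewrite -gc -(@subnK e M) ?(leq_trans (leq_addl _ _) cM) // homog_zM //.
  exact/ideal_spanM/mem_ideal_span.
by rewrite leqW // leq_subRL ?(leq_trans (leq_addl _ _) cM) // addnC.
Qed.

(** * Power series and order of vanishing *)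

Section PowerSeriesOrder.
Variables (n : nat) (R : comNzRingType).
Local Notation A := (mfps n R).
Implicit Types (a b : A) (p q : {mpoly R[n]}).

Lemma mfps_of_mpoly_is_zmod_morphism : zmod_morphism (@mfps_of_mpoly n R).
Proof. by move=> p q; apply: mfpsP => m /=; rewrite mcoeffB. Qed.

HB.instance Definition _ := GRing.isZmodMorphism.Build {mpoly R[n]} A
  (@mfps_of_mpoly n R) mfps_of_mpoly_is_zmod_morphism.

Lemma mfps_of_mpoly_is_monoid_morphism : monoid_morphism (@mfps_of_mpoly n R).
Proof. by split=> // p q; apply: mfpsP => m /=; rewrite mcoeffM. Qed.

HB.instance Definition _ := GRing.isMonoidMorphism.Build {mpoly R[n]} A
  (@mfps_of_mpoly n R) mfps_of_mpoly_is_monoid_morphism.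

Lemma mfps_of_mpoly_is_scalable : scalable (@mfps_of_mpoly n R).
Proof. by move=> c p; apply: mfpsP => m /=; rewrite mcoeffZ. Qed.

HB.instance Definition _ := GRing.isScalable.Build R {mpoly R[n]} A *:%R
  (@mfps_of_mpoly n R) mfps_of_mpoly_is_scalable.

Lemma fcoefB a b m : fcoef (a - b) m = fcoef a m - fcoef b m.
Proof. by []. Qed.

Lemma fcoefD a b m : fcoef (a + b) m = fcoef a m + fcoef b m.
Proof. by []. Qed.

Lemma fcoefZ c a m : fcoef (c *: a) m = c * fcoef a m.
Proof. by []. Qed.

Lemma fcoef_sum (I : Type) (r : seq I) (P : pred I) (F : I -> A) m :
  fcoef (\sum_(i <- r | P i) F i) m = \sum_(i <- r | P i) fcoef (F i) m.
Proof. by apply: (big_morph (fun a => fcoef a m)). Qed.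

(** Membership in the N-th power of the maximal ideal. *)
Definition vanish (N : nat) (a : A) := forall m, (mdeg m < N)%N -> fcoef a m = 0.

Lemma vanishD N a b : vanish N a -> vanish N b -> vanish N (a + b).
Proof. by move=> ha hb m mN; rewrite fcoefD ha // hb // addr0. Qed.

Lemma vanishN N a : vanish N a -> vanish N (- a).
Proof. by move=> ha m mN; rewrite -sub0r fcoefB ha // subr0. Qed.

Lemma vanishB N a b : vanish N a -> vanish N b -> vanish N (a - b).
Proof. by move=> ha hb; apply/vanishD/vanishN. Qed.

Lemma vanishM i j a b : vanish i a -> vanish j b -> vanish (i + j) (a * b).
Proof.
move=> ha hb m mij; rewrite /= big1 // => -[k l] /= /eqP mkl.
case: (ltnP (mdeg k) i) => ki; first by rewrite ha // mul0r.
have := congr1 mdeg mkl; rewrite mdegD => e; rewrite hb ?mulr0 //; lia.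
Qed.

Lemma vanish_le i j a : (i <= j)%N -> vanish j a -> vanish i a.
Proof. by move=> ij h m mi; apply: h; apply: leq_trans ij. Qed.

Lemma vanish00 a : vanish 0 a. Proof. by []. Qed.

Lemma vanishMl N a b : vanish N a -> vanish N (a * b).
Proof. by move=> ha; rewrite -[N]addn0; apply: vanishM. Qed.

Lemma vanishMr N a b : vanish N b -> vanish N (a * b).
Proof. by rewrite mulrC; apply: vanishMl. Qed.

Lemma vanishZ N c a : vanish N a -> vanish N (c *: a).
Proof. by move=> h m mN; rewrite fcoefZ h ?mulr0. Qed.

Lemma vanishX i a : vanish 1 a -> vanish i (a ^+ i).
Proof.
move=> h; elim: i => [|i IH]; first exact: vanish00.
by rewrite exprS -add1n; apply: vanishM.
Qed.

Lemma fcoef0M a b : fcoef (a * b) 0%MM = fcoef a 0%MM * fcoef b 0%MM.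
Proof.
rewrite /= (bigD1 (bm0, bm0)) /=; last first.
  by rewrite add0m.
rewrite big1 ?addr0 // => -[k l] /= /andP[/eqP e /eqP ne].
have /esym/eqP : mdeg (0%MM : 'X_{1..n}) = (mdeg k + mdeg l)%N by rewrite -mdegD -e.
rewrite [X in _ == X]mdeg0 addn_eq0 !mdeg_eq0 => /andP[/eqP k0 /eqP l0]; case: ne.
by congr (_, _); apply: val_inj.
Qed.

Lemma vanish1P a : vanish 1 a <-> fcoef a 0%MM = 0.
Proof.
split; first by apply; rewrite mdeg0.
by move=> h m; rewrite ltnS leqn0 mdeg_eq0 => /eqP->.
Qed.

Lemma fcoef1 m : fcoef (1 : A) m = (m == 0%MM)%:R.
Proof. exact: mcoeff1. Qed.

Lemma vanish_trunc N a : vanish N (mfps_of_mpoly (mfps_trunc N a) - a).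
Proof. by move=> m mN; rewrite fcoefB /= mcoeff_trunc // subrr. Qed.

(** The geometric series of b = 1 - a; the coefficient at m only needs the powers
    b^i with i <= mdeg m. *)
Lemma mfps_unit1 a : fcoef a 0%MM = 1 -> exists v, a * v = 1.
Proof.
move=> a1; pose b := 1 - a.
have b0 : vanish 1 b by apply/vanish1P; rewrite fcoefB a1 fcoef1 eqxx subrr.
pose v := MFPS (fun m : 'X_{1..n} => \sum_(i < (mdeg m).+1) fcoef (b ^+ i) m).
exists v; apply: mfpsP => m.
pose V := \sum_(i < (mdeg m).+1) b ^+ i.
have vV : vanish (mdeg m).+1 (v - V).
  move=> m' m'm; rewrite fcoefB fcoef_sum /= (big_ord_widen _ (fun i => fcoef (b ^+ i) m') m'm).
  rewrite [X in _ - X](bigID (fun i : 'I__ => (i < (mdeg m').+1)%N)) /= opprD addrA subrr sub0r.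
  rewrite big1 ?oppr0 // => i; rewrite -leqNgt => mi.
  exact: (vanishX b0).
have e : a * V = 1 - b ^+ (mdeg m).+1.
  by rewrite -[RHS]opprB subrX1 -/V -mulNr /b opprB opprB addrC subrK.
have -> : a * v = 1 - b ^+ (mdeg m).+1 + a * (v - V) by rewrite -e; ring.
rewrite fcoefD fcoefB (vanishX b0) // (vanishMr a vV) // subr0 addr0 //.
Qed.

End PowerSeriesOrder.

Lemma mfps_unit (n : nat) (k : fieldType) (a : mfps n k) :
  fcoef a 0%MM != 0 -> exists v, a * v = 1.
Proof.
move=> a0; have [|v hv] := @mfps_unit1 n k ((fcoef a 0%MM)^-1 *: a).
  by rewrite fcoefZ mulVf.
by exists ((fcoef a 0%MM)^-1 *: v); rewrite -scalerAr scalerAl.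
Qed.

Lemma ideal_span1P (A : comNzRingType) (g x : A) :
  x \in ideal_span [set g]%classic -> exists u, x = u * g.
Proof.
move=> /ideal_spanP[s sG ->]; exists (\sum_(c <- s) c.1).
rewrite mulr_suml big_seq [RHS]big_seq; apply: eq_bigr => c /sG /= -> //.
Qed.

Lemma fcoef_mulX (n : nat) (R : comNzRingType) i (b : mfps n R) m :
  fcoef (mfps_of_mpoly 'X_i * b) m = if m i == 0%N then 0 else fcoef b (m - U_(i))%MM.
Proof.
rewrite (@fcoef_mul _ _ _ _ (mdeg m).+1) //.
transitivity (('X_i * mfps_trunc (mdeg m).+1 b)@_m).
  by apply: eq_mcoeffM => // j jm; rewrite mcoeff_trunc.
rewrite mulrC mcoeff_mulX lep1mP; case: eqP => //= _.
by rewrite mcoeff_trunc // ltnS mdegB.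
Qed.

(** * Lifting an isomorphism of germs to a change of coordinates *)

Section LiftIso.
Variables (k : fieldType) (F G : {mpoly k[2]}).
Local Notation A := (mfps 2 k).
Local Notation iota := (@mfps_of_mpoly 2 k).
Local Notation piF := (@quotAlg_pi k A [set iota F]%classic).
Local Notation piG := (@quotAlg_pi k A [set iota G]%classic).
Variable phi : {rmorphism quotAlg [set iota F]%classic -> quotAlg [set iota G]%classic}.
Hypothesis phiZ : scalable phi.
Hypothesis phi_bij : bijective phi.
Hypothesis G2 : vanish 2 (iota G).
Implicit Types a b : A.

Lemma piG_eq a b : piG a = piG b -> exists u, a = b + u * iota G.
Proof.
by move=> /quotAlg_piP/ideal_span1P[u e]; exists u; rewrite -e addrC subrK.
Qed.

Lemma piF0 : piF (iota F) = 0.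
Proof.
rewrite -(rmorph0 piF); apply/quotAlg_piP; rewrite subr0.
exact: mem_ideal_span.
Qed.

Definition lifts a b := piG b = phi (piF a).

Lemma lifts_exists a : exists b, lifts a b.
Proof. by exists (repr (phi (piF a))); rewrite /lifts quotAlg_reprK. Qed.

Lemma lifts_onto b : exists a, lifts a b.
Proof.
have [psi _ phiK] := phi_bij; exists (repr (psi (piG b))).
by rewrite /lifts quotAlg_reprK phiK.
Qed.

Lemma liftsD a a' b b' : lifts a b -> lifts a' b' -> lifts (a + a') (b + b').
Proof. by rewrite /lifts !rmorphD /= => -> ->. Qed.

Lemma liftsM a a' b b' : lifts a b -> lifts a' b' -> lifts (a * a') (b * b').
Proof. by rewrite /lifts !rmorphM /= => -> ->. Qed.

Lemma liftsZ c a b : lifts a b -> lifts (c *: a) (c *: b).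
Proof. by rewrite /lifts !linearZ /= phiZ => ->. Qed.

Lemma lifts1 : lifts 1 1.
Proof. by rewrite /lifts !rmorph1. Qed.

Lemma liftsC c : lifts (c%:A) (c%:A).
Proof. exact/liftsZ/lifts1. Qed.

Lemma lifts_eq a b b' : lifts a b -> lifts a b' -> exists u, b = b' + u * iota G.
Proof. by move=> e e'; apply: piG_eq; rewrite e. Qed.

(** A ring isomorphism preserves units, and a power series is a unit exactly when its
    constant term is not 0; compare a and b after subtracting the constant term
    of b. *)
Lemma lifts_const a b : lifts a b -> fcoef b 0%MM = fcoef a 0%MM.
Proof.
move=> ab; set c := fcoef b _; apply/eqP; rewrite eq_sym -subr_eq0; apply/negP => /negP ac.
have cE : fcoef (- c)%:A (0%MM : 'X_{1..2}) = - c.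
  by rewrite fcoefZ fcoef1 eqxx mulr1.
have [|v hv] := @mfps_unit 2 k (a + (- c)%:A).
  by rewrite fcoefD cE.
have [w vw] := lifts_exists v.
have := liftsM (liftsD ab (liftsC (- c))) vw.
rewrite hv => /lifts_eq-/(_ _ lifts1)[u /(congr1 (fun a => fcoef a 0%MM))].
rewrite fcoefD !fcoef0M fcoefD cE subrr mul0r fcoef1 eqxx (G2 (m := 0%MM)) ?mdeg0 //.
by rewrite mulr0 addr0 => /esym/eqP; rewrite oner_eq0.
Qed.

Lemma lifts_vanish1 a b : lifts a b -> vanish 1 a <-> vanish 1 b.
Proof. by move=> /lifts_const e; rewrite !vanish1P e. Qed.

Lemma vanish1_decomp a : vanish 1 a -> exists b c,
  [/\ a = iota 'X_0 * b + iota 'X_1 * c,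
      vanish 2 a -> vanish 1 b & vanish 2 a -> vanish 1 c].
Proof.
move=> a1.
exists (MFPS (fun m => fcoef a (m + U_(0%R))%MM)).
exists (MFPS (fun m : 'X_{1..2} => if m 0 == 0%N then fcoef a (m + U_(1%R))%MM else 0)); split.
- apply: mfpsP => m; rewrite fcoefD !fcoef_mulX /=.
  have [m0|m0] := eqVneq (m 0) 0%N; have [m1|m1] := eqVneq (m 1) 0%N.
  + by rewrite a1 ?addr0 // mdeg2E m0 m1.
  + by rewrite add0r submK ?lep1mP // mnmBE mnm1E m0.
  + by rewrite addr0 submK ?lep1mP.
  + rewrite submK ?lep1mP // mnmBE mnm1E /= subn0 (negPf m0) addr0 //.
- by move=> a2 m m1; rewrite /= a2 // mdegD mdeg1 addn1 ltnS.
- by move=> a2 m m1; rewrite /=; case: ifP => // _; rewrite a2 // mdegD mdeg1 addn1 ltnS.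
Qed.

(** Lifts respect the maximal ideal, hence its square; the ambiguity of a lift is a
    multiple of G, which lies in the square as well. *)
Lemma lifts_vanish2 a b : lifts a b -> vanish 2 a -> vanish 2 b.
Proof.
move=> ab a2; have [a1 [a' [e /(_ a2) h1 /(_ a2) h2]]] := vanish1_decomp (vanish_le (leqnSn 1) a2).
have [X xX] := lifts_exists (iota 'X_0); have [Y yY] := lifts_exists (iota 'X_1).
have [b1 ab1] := lifts_exists a1; have [b' ab'] := lifts_exists a'.
have X1 i : vanish 1 (iota 'X_i).
  by apply/vanish1P; rewrite /= mcoeffX mnm1_eq0.
have := liftsD (liftsM xX ab1) (liftsM yY ab'); rewrite -e => /(lifts_eq ab)[u ->].
apply: vanishD; last exact: vanishMr.
apply: vanishD; rewrite -[2%N]/(1 + 1)%N; apply: vanishM.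
- exact/(lifts_vanish1 xX)/X1.
- exact/(lifts_vanish1 ab1).
- exact/(lifts_vanish1 yY)/X1.
- exact/(lifts_vanish1 ab').
Qed.

Lemma vanish2_linear a : vanish 1 a ->
  vanish 2 (a - (fcoef a U_(0%R)%MM *: iota 'X_0 + fcoef a U_(1%R)%MM *: iota 'X_1)).
Proof.
move=> a1 m; rewrite fcoefB fcoefD !fcoefZ /= !mcoeffX => m2.
have [d0|d1] : mdeg m = 0%N \/ mdeg m = 1%N by lia.
  have -> : m = 0%MM by apply/eqP; rewrite -mdeg_eq0 d0.
  by rewrite (a1 0%MM) ?mdeg0 // !mnm1_eq0 !mulr0 !addr0 subrr.
have /mdeg1P[i /eqP->] : mdeg m == 1%N by rewrite d1.
by elim/ord2_ind: i; rewrite !eq_mnm1 eqxx /= ?mulr1 ?mulr0 ?addr0 ?add0r subrr.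
Qed.

(** The lifts of the two variables, truncated at order N, give the change of
    coordinates X.  The matrix M, the linear part of lifts of the variables under
    the inverse isomorphism, inverts the linear part of X.  As F maps to 0 modulo
    G, substituting X in F gives a multiple of G. *)
Lemma iso_lift N : exists (X : 'I_2 -> {mpoly k[2]}) (M : 'M[k]_2) (U : {mpoly k[2]}),
  [/\ forall i, vanish 1 (iota (X i)),
      forall i, vanish 2 (iota (\sum_j M i j *: X j - 'X_i)) &
      vanish N (iota (F \mPo [tuple X i | i < 2] - U * G))].
Proof.
have /choice[XX hXX] i := lifts_exists (iota 'X_i).
have /choice[X' hX'] i := lifts_onto (iota 'X_i).
have X1 i : vanish 1 (iota 'X_i).
  by apply/vanish1P; rewrite /= mcoeffX mnm1_eq0.
have XX1 i : vanish 1 (XX i) by apply/(lifts_vanish1 (hXX i)).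
have X'1 i : vanish 1 (X' i) by apply/(lifts_vanish1 (hX' i)).
pose ev (p : {mpoly k[2]}) : A := mmap (in_alg A) XX p.
have ev_lifts p : lifts (iota p) (ev p).
  elim/mpoly_gen_ind: p => [c|i|p q hp hq|p q hp hq].
  - have -> : iota c%:MP = c%:A.
      by rewrite -alg_mpolyC linearZ /= rmorph1.
    by rewrite /ev mmapC; apply: liftsC.
  - by rewrite /ev mmapX mmap1U.
  - by rewrite /ev !rmorphD; apply: liftsD.
  - by rewrite /ev !rmorphM; apply: liftsM.
have [U hU] : exists U, ev F = U * iota G.
  have [|U ->] := @piG_eq (ev F) 0; last by exists U; rewrite add0r.
  by rewrite rmorph0 ev_lifts piF0 rmorph0.
(* Order 2 is needed for the linear parts to survive the truncation. *)
pose N' := maxn N 2; pose X i := mfps_trunc N' (XX i).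
have hX i : vanish N' (iota (X i) - XX i) by apply: vanish_trunc.
exists X, (\matrix_(i, j) fcoef (X' i) U_(j)%MM), (mfps_trunc N' U); split.
- move=> i; rewrite -[iota _](subrK (XX i)); apply: vanishD => //.
  by apply: vanish_le (hX i); rewrite leq_max orbT.
- move=> i; rewrite big_ord_recl big_ord1 !mxE.
  have -> : lift ord0 ord0 = 1 :> 'I_2 by apply: val_inj.
  have := lifts_vanish2 (liftsD (hX' i) (liftsD (liftsZ (- fcoef (X' i) U_(0%R)%MM) (hXX 0))
    (liftsZ (- fcoef (X' i) U_(1%R)%MM) (hXX 1)))).
  have -> : X' i + (- fcoef (X' i) U_(0%R)%MM *: iota 'X_0 + - fcoef (X' i) U_(1%R)%MM *: iota 'X_1)
    = X' i - (fcoef (X' i) U_(0%R)%MM *: iota 'X_0 + fcoef (X' i) U_(1%R)%MM *: iota 'X_1).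
    by rewrite opprD !scaleNr.
  move=> /(_ (vanish2_linear (X'1 i))); set a := fcoef _ _; set b := fcoef _ _ => h.
  rewrite rmorphB rmorphD /= !linearZ /=.
  have -> : a *: iota (X 0) + b *: iota (X 1) - iota 'X_i =
     a *: (iota (X 0) - XX 0) + b *: (iota (X 1) - XX 1) - (iota 'X_i + (- a *: XX 0 + - b *: XX 1)).
    by rewrite !scalerBr !scaleNr; ring.
  by apply: vanishB => //; apply: vanishD; apply: vanishZ; apply: vanish_le (hX _);
     rewrite leq_max orbT.
- apply: (@vanish_le _ _ N N'); first by rewrite leq_max leqnn.
  have hev p : vanish N' (iota (p \mPo [tuple X i | i < 2]) - ev p).
    elim/mpoly_gen_ind: p => [c|i|p q hp hq|p q hp hq].
    + have -> : iota (c%:MP \mPo [tuple X i | i < 2]) = c%:A.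
        by rewrite comp_mpolyC -alg_mpolyC linearZ /= rmorph1.
      by rewrite /ev mmapC subrr.
    + by rewrite comp_mpolyXU -tnth_nth tnth_mktuple /ev mmapX mmap1U.
    + have -> : ev (p + q) = ev p + ev q by rewrite /ev rmorphD.
      rewrite rmorphD [iota _]rmorphD opprD addrACA.
      exact: (vanishD hp hq).
    + have -> : ev (p * q) = ev p * ev q by rewrite /ev rmorphM.
      have -> : iota ((p * q) \mPo [tuple X i | i < 2]) =
          iota (p \mPo [tuple X i | i < 2]) * iota (q \mPo [tuple X i | i < 2]).
        by rewrite rmorphM rmorphM.
      move: hp hq; move: (iota _) (iota _) (ev p) (ev q) => y x p' q' hp hq.
      have -> : x * y - p' * q' = (x - p') * y + p' * (y - q') by ring.
      by apply: vanishD; [apply: vanishMl | apply: vanishMr].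
  have -> : iota (F \mPo [tuple X i | i < 2] - mfps_trunc N' U * G) =
    (iota (F \mPo [tuple X i | i < 2]) - ev F) - (iota (mfps_trunc N' U) - U) * iota G.
    by rewrite rmorphB rmorphM /= hU; ring.
  by apply: vanishB => //; apply/vanishMl/vanish_trunc.
Qed.

End LiftIso.

(** * Substitutions and their inverses modulo a power of the maximal ideal *)

Section PolynomialOrder.
Variables (n : nat) (R : comNzRingType).
Local Notation P := {mpoly R[n]}.
Implicit Types p q : P.

Definition ord_ge N p := vanish N (mfps_of_mpoly p).

Lemma ord_geP N p : ord_ge N p <-> forall m, (mdeg m < N)%N -> p@_m = 0.
Proof. by []. Qed.

Lemma ord_ge0 N : ord_ge N 0. Proof. by move=> m _; rewrite /= mcoeff0. Qed.

Lemma ord_geD N p q : ord_ge N p -> ord_ge N q -> ord_ge N (p + q).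
Proof. by rewrite /ord_ge rmorphD; apply: vanishD. Qed.

Lemma ord_geB N p q : ord_ge N p -> ord_ge N q -> ord_ge N (p - q).
Proof. by rewrite /ord_ge rmorphB; apply: vanishB. Qed.

Lemma ord_geN N p : ord_ge N p -> ord_ge N (- p).
Proof. by rewrite /ord_ge rmorphN; apply: vanishN. Qed.

Lemma ord_geM i j p q : ord_ge i p -> ord_ge j q -> ord_ge (i + j) (p * q).
Proof. by rewrite /ord_ge rmorphM; apply: vanishM. Qed.

Lemma ord_geMl N p q : ord_ge N p -> ord_ge N (p * q).
Proof. by rewrite /ord_ge rmorphM; apply: vanishMl. Qed.

Lemma ord_geMr N p q : ord_ge N q -> ord_ge N (p * q).
Proof. by rewrite /ord_ge rmorphM; apply: vanishMr. Qed.

Lemma ord_geX i p : ord_ge 1 p -> ord_ge i (p ^+ i).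
Proof. by rewrite /ord_ge rmorphXn; apply: vanishX. Qed.

Lemma ord_ge_le i j p : (i <= j)%N -> ord_ge j p -> ord_ge i p.
Proof. exact: vanish_le. Qed.

Lemma ord_ge_sum N (I : Type) (r : seq I) (Q : pred I) (F : I -> P) :
  (forall i, Q i -> ord_ge N (F i)) -> ord_ge N (\sum_(i <- r | Q i) F i).
Proof. by move=> h; elim/big_ind: _ => //; [exact: ord_ge0 | exact: ord_geD]. Qed.

Lemma ord_geZ N c p : ord_ge N p -> ord_ge N (c *: p).
Proof. by rewrite -mul_mpolyC; apply: ord_geMr. Qed.

Lemma ord_ge1P p : ord_ge 1 p <-> p@_0%MM = 0.
Proof. exact: vanish1P. Qed.

Lemma ord_ge1B p : ord_ge 1 (p - (p@_0%MM)%:MP).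
Proof. by apply/ord_ge1P; rewrite mcoeffB mcoeffC eqxx mulr1 subrr. Qed.

Lemma ord_ge1X i : ord_ge 1 ('X_i : P).
Proof. by apply/ord_ge1P; rewrite mcoeffX mnm1_eq0. Qed.

Lemma ord_ge_mnm m : ord_ge (mdeg m) ('X_[m] : P).
Proof. by move=> m' h; rewrite /= mcoeffX; case: eqP h => [->|//]; rewrite ltnn. Qed.

Lemma ord_ge_deriv N p i : ord_ge N.+1 p -> ord_ge N p^`M(i).
Proof.
by move=> h m mN; rewrite /= mcoeff_deriv [p@__]h ?mul0rn // mdegD mdeg1 addn1 ltnS.
Qed.

End PolynomialOrder.

Section Substitution.
Variables (n : nat) (R : comNzRingType).
Local Notation P := {mpoly R[n]}.
Implicit Types (p q : P) (X Y Z : 'I_n -> P).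

Definition subst X p : P := p \mPo [tuple X i | i < n].

HB.instance Definition _ X := GRing.RMorphism.copy (subst X)
  (comp_mpoly [tuple X i | i < n]).

Lemma substC X c : subst X c%:MP = c%:MP.
Proof. exact: comp_mpolyC. Qed.

Lemma substX X i : subst X 'X_i = X i.
Proof. by rewrite /subst comp_mpolyXU -tnth_nth tnth_mktuple. Qed.

Lemma subst_deriv X p l :
  (subst X p)^`M(l) = \sum_j subst X p^`M(j) * (X j)^`M(l).
Proof.
elim/mpoly_gen_ind: p => [c|i|p q hp hq|p q hp hq].
- by rewrite substC mderivC big1 // => j _; rewrite mderivC rmorph0 mul0r.
- rewrite substX (bigD1 i) //= mderiv_var eqxx mpolyC1 rmorph1 mul1r big1 ?addr0 // => j ji.
  by rewrite mderiv_var eq_sym (negPf ji) mpolyC0 rmorph0 mul0r.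
- rewrite rmorphD /= mderivD hp hq -big_split /=; apply: eq_bigr => j _.
  by rewrite mderivD rmorphD mulrDl.
- rewrite rmorphM /= mderivM hp hq mulr_suml mulr_sumr -big_split /=.
  by apply: eq_bigr => j _; rewrite mderivM rmorphD !rmorphM /=; ring.
Qed.

Lemma subst_coef0 Z p : (forall i, ord_ge 1 (Z i)) -> (subst Z p)@_0%MM = p@_0%MM.
Proof.
move=> Z1; elim/mpoly_gen_ind: p => [c|i|p q hp hq|p q hp hq].
- by rewrite substC.
- by rewrite substX; move/ord_ge1P: (Z1 i) => ->; rewrite mcoeffX mnm1_eq0.
- by rewrite rmorphD /= !mcoeffD hp hq.
- by rewrite !rmorphM /= hp hq.
Qed.

Lemma subst_ord_ge Z N p : (forall i, ord_ge 1 (Z i)) -> ord_ge N p -> ord_ge N (subst Z p).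
Proof.
move=> Z1 hp; rewrite /subst comp_mpolyEX big_seq; apply: ord_ge_sum => m mp.
apply: ord_geZ; rewrite comp_mpolyX.
have Nm : (N <= mdeg m)%N.
  by rewrite leqNgt; apply: contraL mp => mN; rewrite mcoeff_msupp negbK; apply/eqP/hp.
apply: (ord_ge_le Nm); rewrite mdegE.
elim/big_rec2: _ => [|i y1 y2 _ h]; first exact: vanish00.
by apply: ord_geM => //; apply: ord_geX; rewrite tnth_mktuple.
Qed.

Lemma subst_cong N X Z : (forall i, ord_ge N (subst Z (X i) - 'X_i)) ->
  forall p, ord_ge N (subst Z (subst X p) - p).
Proof.
move=> h; elim/mpoly_gen_ind => [c|i|p q hp hq|p q hp hq].
- by rewrite !substC subrr; apply: ord_ge0.
- by rewrite substX.
- by rewrite !rmorphD /= opprD addrACA; apply: ord_geD.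
- rewrite !rmorphM /=; set p' := subst Z _ in hp *; set q' := subst Z _ in hq *.
  have -> : p' * q' - p * q = (p' - p) * q' + p * (q' - q).
    by rewrite mulrBl mulrBr addrA subrK.
  by apply: ord_geD; [apply: ord_geMl | apply: ord_geMr].
Qed.

(** First order Taylor expansion: the increment d has order N, and the quadratic terms
    as well as the variation of the derivatives away from the origin contribute to
    order N + 1 only. *)
Lemma subst_taylor N Z d p : (0 < N)%N ->
  (forall i, ord_ge 1 (Z i)) -> (forall i, ord_ge N (d i)) ->
  ord_ge N.+1 (subst (fun i => Z i + d i) p - subst Z p
               - \sum_i ((p^`M(i))@_0%MM)%:MP * d i).
Proof.
move=> N0 Z1 dN.
have Zd1 i : ord_ge 1 (Z i + d i) by apply: ord_geD => //; apply: ord_ge_le (dN i).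
elim/mpoly_gen_ind: p => [c|i|p q hp hq|p q hp hq].
- rewrite !substC subrr sub0r; apply/ord_geN/ord_ge_sum => i _.
  by rewrite mderivC mcoeff0 mpolyC0 mul0r; apply: ord_ge0.
- rewrite !substX (bigD1 i) //= mderiv_var eqxx mpolyC1 mcoeff1 eqxx mpolyC1 mul1r big1.
    have -> : Z i + d i - Z i - (d i + 0) = 0 by ring.
    exact: ord_ge0.
  by move=> j ji; rewrite mderiv_var eq_sym (negPf ji) mpolyC0 mcoeff0 mpolyC0 mul0r.
- have := ord_geD hp hq; congr (ord_ge _ _); rewrite !rmorphD /=.
  rewrite [X in _ = _ - X](eq_bigr (fun i => ((p^`M(i))@_0%MM)%:MP * d i + ((q^`M(i))@_0%MM)%:MP * d i)).
    by rewrite big_split /= !opprD [LHS]addrACA [X in X + _ = _]addrACA.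
  by move=> i _; rewrite mderivD mcoeffD mpolyCD mulrDl.
set Dp := \sum_i _ in hp; set Dq := \sum_i _ in hq.
have DpN : ord_ge N Dp by apply: ord_ge_sum => i _; apply: ord_geMr.
have DqN : ord_ge N Dq by apply: ord_ge_sum => i _; apply: ord_geMr.
have -> : \sum_i (((p * q)^`M(i))@_0%MM)%:MP * d i =
   (q@_0%MM)%:MP * Dp + (p@_0%MM)%:MP * Dq.
  rewrite !mulr_sumr -big_split; apply: eq_bigr => i _ /=.
  by rewrite mderivM !rmorphD !rmorphM /=; ring.
rewrite !rmorphM /=.
set a' := subst _ p in hp *; set b' := subst _ q in hq *.
set a := subst Z p in hp *; set b := subst Z q in hq *.
have -> : a' * b' - a * b - ((q@_0%MM)%:MP * Dp + (p@_0%MM)%:MP * Dq) =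
  (a - (p@_0%MM)%:MP) * Dq + Dp * (b' - (q@_0%MM)%:MP) + a * (b' - b - Dq) + (a' - a - Dp) * b'.
  by move: a a' b b' Dp Dq {hp hq DpN DqN} (p@_0%MM)%:MP (q@_0%MM)%:MP => *; ring.
have ha : ord_ge 1 (a - (p@_0%MM)%:MP).
  by rewrite -(subst_coef0 p Z1); apply: ord_ge1B.
have hb : ord_ge 1 (b' - (q@_0%MM)%:MP).
  by rewrite -(subst_coef0 q Zd1); apply: ord_ge1B.
apply: ord_geD; last exact: ord_geMl.
apply: ord_geD; last exact: ord_geMr.
by apply: ord_geD; [rewrite -add1n | rewrite -addn1]; apply: ord_geM.
Qed.

End Substitution.

Section RightInverse.
Variables (n : nat) (R : comUnitRingType) (X : 'I_n -> {mpoly R[n]}) (M : 'M[R]_n).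
Hypothesis X1 : forall i, ord_ge 1 (X i).
Hypothesis MX : forall i, ord_ge 2 (\sum_j M i j *: X j - 'X_i).

(** Newton iteration: if Z inverts X up to an error r of order N, correcting Z by the
    inverse linear part applied to r leaves an error of order N + 1. *)
Lemma subst_right_inverse N : exists Z,
  (forall i, ord_ge 1 (Z i)) /\ (forall i, ord_ge N (subst Z (X i) - 'X_i)).
Proof.
have derE p l : (p^`M(l))@_0%MM = p@_U_(l) :> R.
  by rewrite mcoeff_deriv add0m mnm0E.
pose L := \matrix_(j, l) ((X j)^`M(l))@_0%MM.
have LM : L *m M = 1%:M.
  apply: mulmx1C; apply/matrixP => i l; rewrite !mxE.
  have := MX i; move/ord_geP => /(_ U_(l)%MM); rewrite mdeg1 => /(_ isT).
  rewrite mcoeffB raddf_sum /= mcoeffXU => /eqP; rewrite subr_eq0 => /eqP <-.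
  by apply: eq_bigr => j _; rewrite mcoeffZ !mxE derE.
elim: N => [|N [Z [Z1 ZN]]].
  by exists (fun i => 'X_i); split=> i; [apply: ord_ge1X | apply: vanish00].
have [N0|N0] := posnP N.
  exists (fun i => 'X_i); split=> i; first exact: ord_ge1X.
  rewrite N0; apply: ord_geB; last exact: ord_ge1X.
  by apply: subst_ord_ge => // j; apply: ord_ge1X.
pose r i := subst Z (X i) - 'X_i.
pose d i := - \sum_j (M i j)%:MP * r j.
have dN i : ord_ge N (d i).
  by apply/ord_geN/ord_ge_sum => j _; apply: ord_geMr; apply: ZN.
exists (fun i => Z i + d i); split=> i.
  by apply: ord_geD => //; apply: ord_ge_le (dN i).
have := subst_taylor (X i) N0 Z1 dN; congr (ord_ge _ _).
have -> : \sum_l (((X i)^`M(l))@_0%MM)%:MP * d l = - r i.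
  transitivity (- \sum_j ((L *m M) i j)%:MP * r j).
    rewrite -sumrN.
    transitivity (\sum_l \sum_j - ((L i l * M l j)%:MP * r j)).
      apply: eq_bigr => l _; rewrite /d mulrN mulr_sumr -sumrN; apply: eq_bigr => j _.
      by rewrite mxE mpolyCM mulrA.
    rewrite exchange_big; apply: eq_bigr => j _ /=.
    have -> : ((L *m M) i j)%:MP = \sum_l (L i l * M l j)%:MP :> {mpoly R[n]}.
      by rewrite mxE raddf_sum.
    by rewrite sumrN mulr_suml.
  rewrite LM (bigD1 i) //= mxE eqxx mpolyC1 mul1r big1 ?addr0 // => j ji.
  by rewrite mxE eq_sym (negPf ji) mpolyC0 mul0r.
by rewrite opprK /r addrA addrNK.
Qed.

End RightInverse.

(** * The ideal of the partial derivatives near the singular point *)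

Definition in_ideal2 (A : comNzRingType) (p q h : A) := exists u v, h = u * p + v * q.

Lemma in_ideal2D (A : comNzRingType) (p q h h' : A) :
  in_ideal2 p q h -> in_ideal2 p q h' -> in_ideal2 p q (h + h').
Proof.
move=> [u [v ->]] [u' [v' ->]]; exists (u + u'), (v + v').
by rewrite !mulrDl addrACA.
Qed.

Lemma in_ideal2Ml (A : comNzRingType) (p q h a : A) :
  in_ideal2 p q h -> in_ideal2 p q (a * h).
Proof. by move=> [u [v ->]]; exists (a * u), (a * v); rewrite mulrDr !mulrA. Qed.

Lemma in_ideal2_0 (A : comNzRingType) (p q : A) : in_ideal2 p q 0.
Proof. by exists 0, 0; rewrite !mul0r addr0. Qed.

Lemma in_ideal2_sum (A : comNzRingType) (p q : A) (I : finType) (h : I -> A) :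
  (forall i, in_ideal2 p q (h i)) -> in_ideal2 p q (\sum_i h i).
Proof.
by move=> H; elim/big_ind: _ => [|x y|i _] //; [exact: in_ideal2_0|exact: in_ideal2D].
Qed.

Section PlaneMonomials.
Variable R : comNzRingType.
Local Notation P := {mpoly R[2]}.

Definition mnm2 (a b : nat) : 'X_{1..2} := (U_(0%R) *+ a + U_(1%R) *+ b)%MM.

Lemma mnm2E a b : (mnm2 a b 0 = a) * (mnm2 a b 1 = b).
Proof. by rewrite !mnmDE !mulmnE !mnm1E /= !mul1n !mul0n addn0. Qed.

Lemma mnm2_eta (m : 'X_{1..2}) : m = mnm2 (m 0) (m 1).
Proof. by apply/mnmP; apply: ord2_ind; rewrite !mnm2E. Qed.

Lemma mdeg_mnm2 a b : mdeg (mnm2 a b) = (a + b)%N.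
Proof. by rewrite mdeg2E !mnm2E. Qed.

Lemma mnm2D a b c d : (mnm2 a b + mnm2 c d)%MM = mnm2 (a + c) (b + d).
Proof. by apply/mnmP; apply: ord2_ind; rewrite mnmDE !mnm2E. Qed.

Lemma mpolyX_mnm2 a b : 'X_[mnm2 a b] = 'X_0 ^+ a * 'X_1 ^+ b :> P.
Proof. by rewrite mpolyXD -!mpolyXn. Qed.

(** The N-th power of the maximal ideal is generated by the monomials of degree N. *)
Lemma ord_ge_gens N d (p : P) : ord_ge (N + d) p -> exists t : 'I_N.+1 -> P,
  (forall i, ord_ge d (t i)) /\ p = \sum_i t i * 'X_[mnm2 i (N - i)].
Proof.
move=> hp; rewrite [p]mpolyE big_seq.
elim/big_rec: _ => [|m x mp [t [t1 ->]]].
  by exists (fun=> 0); split=> [i|]; [exact: ord_ge0 | rewrite big1 // => i _; rewrite mul0r].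
have Nm : (N + d <= mdeg m)%N.
  by rewrite leqNgt; apply: contraL mp => mN; rewrite mcoeff_msupp negbK; apply/eqP/hp.
pose i : 'I_N.+1 := inord (minn (m 0%R) N).
have iE : i = minn (m 0%R) N :> nat by rewrite inordK // ltnS geq_minr.
pose s : P := p@_m *: 'X_[mnm2 (m 0%R - i) (m 1%R - (N - i))].
exists (fun j => t j + s *+ (j == i)); split=> [j|].
  apply: ord_geD => //; case: eqP => _; last exact: ord_ge0.
  rewrite mulr1n; apply: ord_geZ; apply: ord_ge_le (@ord_ge_mnm _ _ _).
  by rewrite mdeg_mnm2 iE; move: Nm; rewrite mdeg2E; lia.
under [RHS]eq_bigr => j _ do rewrite mulrDl.
rewrite big_split /= addrC; congr (_ + _).
rewrite (bigD1 i) //= eqxx mulr1n big1 ?addr0; last first.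
  by move=> j /negPf->; rewrite mulr0n mul0r.
rewrite -scalerAl -mpolyXD mnm2D; congr (_ *: 'X_[_]).
rewrite {1}[m]mnm2_eta; move: Nm; rewrite mdeg2E iE => Nm.
by congr mnm2; lia.
Qed.

Lemma ord_ge_ideal2 a b (p : P) : ord_ge (a + b) p -> in_ideal2 ('X_0 ^+ a) ('X_1 ^+ b) p.
Proof.
move=> hp; rewrite [p]mpolyE big_seq.
elim/big_rec: _ => [|m x mp IH]; first exact: in_ideal2_0.
apply: in_ideal2D IH; rewrite -mul_mpolyC; apply: in_ideal2Ml.
have Nm : (a + b <= mdeg m)%N.
  by rewrite leqNgt; apply: contraL mp => mN; rewrite mcoeff_msupp negbK; apply/eqP/hp.
move: Nm; rewrite mdeg2E => Nm; rewrite [m]mnm2_eta mpolyX_mnm2.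
case: (leqP a (m 0)) => am.
  exists ('X_0 ^+ (m 0%R - a) * 'X_1 ^+ m 1%R), 0.
  by rewrite mul0r addr0 mulrAC -exprD subnK.
have bm : (b <= m 1%R)%N by lia.
exists 0, ('X_0 ^+ m 0%R * 'X_1 ^+ (m 1%R - b)).
by rewrite mul0r add0r -mulrA -exprD subnK.
Qed.

(** Nakayama's lemma for the N-th power of the maximal ideal, generated by the
    vector e of the monomials of degree N: the hypothesis says that w e = T e modulo
    (f0, f1), where T has entries in the maximal ideal, and the determinant of
    w - T is the required multiplier.  Allowing a factor w avoids inverting power
    series. *)
Lemma nakayama_det N (f0 f1 w : P) :
  (forall p, ord_ge N p -> exists2 e, ord_ge N.+1 e & in_ideal2 f0 f1 (w * p - e)) ->
  exists c, c@_0%MM = w@_0%MM ^+ N.+1 /\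
    forall p, ord_ge N p -> in_ideal2 f0 f1 (c * p).
Proof.
move=> h; pose e (j : 'I_N.+1) : P := 'X_[mnm2 j (N - j)].
have eN j : ord_ge N (e j).
  have {1}-> : N = mdeg (mnm2 j (N - j)) by rewrite mdeg_mnm2 subnKC // -ltnS.
  exact: ord_ge_mnm.
have /choice[T hT] j : exists t : 'I_N.+1 -> P,
    (forall i, ord_ge 1 (t i)) /\ in_ideal2 f0 f1 (w * e j - \sum_i t i * e i).
  have [x xN hx] := h _ (eN j).
  have {}xN : ord_ge (N + 1) x by rewrite addn1.
  by have [t [t1 xE]] := ord_ge_gens xN; exists t; rewrite -xE.
pose B : 'M[P]_N.+1 := w%:M - \matrix_(i, j) T i j.
have B0 : (\det B)@_0%MM = w@_0%MM ^+ N.+1.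
  rewrite -[LHS]/(mcoeff 0%MM (\det B)) -det_map_mx -det_scalar; congr (\det _).
  apply/matrixP => i j; rewrite /B !mxE rmorphB rmorphMn /=.
  by have /ord_ge1P-> := (hT i).1 j; rewrite subr0.
exists (\det B); split=> // p hp.
have det_e j : in_ideal2 f0 f1 (\det B * e j).
  have -> : \det B * e j = \sum_i (\adj B) j i * (w * e i - \sum_l T i l * e l).
    have -> : \det B * e j = ((\adj B *m B) *m (\col_l e l)) j 0.
      by rewrite mul_adj_mx mul_scalar_mx !mxE.
    rewrite -mulmxA mxE; apply: eq_bigr => i _; congr (_ * _).
    rewrite mulmxBl mul_scalar_mx !mxE; congr (_ - _).
    by apply: eq_bigr => l _; rewrite !mxE.
  by apply: in_ideal2_sum => i; apply: in_ideal2Ml; apply: (hT i).2.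
have {}hp : ord_ge (N + 0) p by rewrite addn0.
have [t [_ ->]] := ord_ge_gens hp.
rewrite mulr_sumr; apply: in_ideal2_sum => i.
rewrite mulrCA; apply: in_ideal2Ml; exact: det_e.
Qed.

End PlaneMonomials.

(** Applies g to a membership relation and replaces g x, g a, g b by p, f0, f1; the
    error terms are collected on the left. *)
Lemma in_ideal2_pull (A B : comNzRingType) (g : {rmorphism A -> B}) D x e u v a b p f0 f1 :
  D * x - e = u * a + v * b ->
  g D * p - (g e + g u * (g a - f0) + g v * (g b - f1) - g D * (g x - p))
  = g u * f0 + g v * f1.
Proof.
move=> E; have -> : g e = g D * g x - (g u * g a + g v * g b).
  by rewrite -!rmorphM -rmorphD -E rmorphB opprB addrC subrK.
ring.
Qed.

(** In the local ring at the origin, where c is a unit: F belongs to the ideal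
    of its partial derivatives, and that ideal contains a power of the maximal
    ideal.  By Saito, for an isolated singularity the first property
    characterises quasi-homogeneity up to a change of coordinates. *)
Definition isolated_quasi_homogeneous (k : comNzRingType) (F : {mpoly k[2]}) : Prop :=
  exists N c, [/\ c@_0%MM != 0,
    in_ideal2 F^`M(0) F^`M(1) (c * 'X_0 ^+ N),
    in_ideal2 F^`M(0) F^`M(1) (c * 'X_1 ^+ N) &
    in_ideal2 F^`M(0) F^`M(1) (c * F)].

Section LocalIdeal.
Variables (k : fieldType) (F G : {mpoly k[2]}) (w : 'I_2 -> k) (a b mo : nat).
Hypothesis euler : G = \sum_i w i *: ('X_i * G^`M(i)).
Hypothesis Ga : in_ideal2 G^`M(0) G^`M(1) ('X_0 ^+ a).
Hypothesis Gb : in_ideal2 G^`M(0) G^`M(1) ('X_1 ^+ b).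
Hypothesis mo2 : (2 <= mo)%N.
Hypothesis Fmo : has_order F mo.
Hypothesis Gmo : ord_ge mo G.
Hypothesis FG : analytically_equivalent F G.
Local Notation P := {mpoly k[2]}.

(** Let Phi be the substitution X with F(X) = U G, and Psi its right inverse, both
    modulo a high power of the maximal ideal.  The chain rule expresses the
    derivatives of U G through those of F at X, and the Euler identity turns
    U G_l + U_l G into a combination of the G_m with matrix W; as W reduces to the
    unit U times the identity at the origin, its determinant D multiplies the G_m
    into the ideal of the F_j(X).  Applying Psi transports this to F. *)
Lemma local_ideal : isolated_quasi_homogeneous F.
Proof.
have [phi [phiZ phi_bij]] := FG; have [Flt [e0 [e0mo Fe0]]] := Fmo.
have G2 : ord_ge 2 G by apply: ord_ge_le Gmo.
pose N0 := (a + b)%N; pose N1 := (N0 + mo).+1.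
have [X [M [U [X1 MX XU]]]] := iso_lift phiZ phi_bij G2 N1.+1.
have [Z [Z1 ZX]] := subst_right_inverse X1 MX N1.+1.
pose Phi : {rmorphism P -> P} := subst X.
pose Psi : {rmorphism P -> P} := subst Z.
have PsiPhi p : ord_ge N1.+1 (Psi (Phi p) - p) by apply: subst_cong.
have Psi_ord N p : ord_ge N p -> ord_ge N (Psi p) by apply: subst_ord_ge.
have Phi_ord N p : ord_ge N p -> ord_ge N (Phi p) by apply: subst_ord_ge.
have {}XU : ord_ge N1.+1 (Phi F - U * G) := XU.
(* F and G have the same order, so the factor U is a unit. *)
have U0 : U@_0%MM != 0.
  apply: contraNneq Fe0 => /ord_ge1P U1; apply/eqP.
  have : ord_ge mo.+1 F; last by apply; rewrite e0mo.
  have UG : ord_ge mo.+1 (U * G) by rewrite -[mo.+1]/(1 + mo)%N; apply: ord_geM.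
  have PF : ord_ge mo.+1 (Phi F).
    rewrite -[Phi F](subrK (U * G)); apply: ord_geD => //.
    by apply: ord_ge_le XU; rewrite /N1; lia.
  rewrite -[F](subKr (Psi (Phi F))); apply: ord_geB; first exact: Psi_ord.
  by apply: ord_ge_le (PsiPhi F); rewrite /N1; lia.
pose W l m : P := U *+ (l == m) + w m *: (U^`M(l) * 'X_m).
pose D := W 0 0 * W 1 1 - W 1 0 * W 0 1.
have W0 l m : (W l m)@_0%MM = U@_0%MM *+ (l == m).
  rewrite /W mcoeffD mcoeffMn mcoeffZ rmorphM /= mcoeffX mnm1_eq0.
  by rewrite !mulr0 addr0.
have D0 : D@_0%MM = U@_0%MM ^+ 2.
  by rewrite /D rmorphB !rmorphM /= !W0 /= mulr0 subr0.
pose J l := \sum_j Phi F^`M(j) * (X j)^`M(l).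
have WJ l : ord_ge N1 (J l - (W l 0 * G^`M(0) + W l 1 * G^`M(1))).
  have -> : W l 0 * G^`M(0) + W l 1 * G^`M(1) = (U * G)^`M(l).
    rewrite mderivM {3}euler big_ord_recl big_ord1.
    have -> : lift ord0 ord0 = 1 :> 'I_2 by apply: val_inj.
    rewrite /W -!mul_mpolyC; elim/ord2_ind: l; rewrite /= ?mulr1n ?mulr0n; ring.
  by rewrite /J -subst_deriv -mderivB; apply: ord_ge_deriv.
have DJ m : exists2 e, ord_ge N1 e &
    in_ideal2 (Phi F^`M(0)) (Phi F^`M(1)) (D * G^`M(m) - e).
  have JI l : in_ideal2 (Phi F^`M(0)) (Phi F^`M(1)) (J l).
    exists (X 0)^`M(l), (X 1)^`M(l); rewrite /J big_ord_recl big_ord1.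
    have -> : lift ord0 ord0 = 1 :> 'I_2 by apply: val_inj.
    by rewrite ![_ * Phi _]mulrC.
  pose E l := J l - (W l 0 * G^`M(0) + W l 1 * G^`M(1)).
  elim/ord2_ind: m.
    exists (W 0 1 * E 1 - W 1 1 * E 0).
      by apply: ord_geB; apply: ord_geMr; apply: WJ.
    have -> : D * G^`M(0) - (W 0 1 * E 1 - W 1 1 * E 0) =
        W 1 1 * J 0 + (- W 0 1) * J 1 by rewrite /D /E; ring.
    by apply: in_ideal2D; apply: in_ideal2Ml.
  exists (W 1 0 * E 0 - W 0 0 * E 1).
    by apply: ord_geB; apply: ord_geMr; apply: WJ.
  have -> : D * G^`M(1) - (W 1 0 * E 0 - W 0 0 * E 1) =
      W 0 0 * J 1 + (- W 1 0) * J 0 by rewrite /D /E; ring.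
  by apply: in_ideal2D; apply: in_ideal2Ml.
(* D p lies in the ideal of the F_j(X) up to high order. *)
pose near p := exists2 e, ord_ge N1 e &
  in_ideal2 (Phi F^`M(0)) (Phi F^`M(1)) (D * p - e).
have near_ideal p : in_ideal2 G^`M(0) G^`M(1) p -> near p.
  move=> [u [v ->]]; have [e he h0] := DJ 0; have [e' he' h1] := DJ 1.
  exists (u * e + v * e'); first by apply: ord_geD; apply: ord_geMr.
  have -> : D * (u * G^`M(0) + v * G^`M(1)) - (u * e + v * e') =
    u * (D * G^`M(0) - e) + v * (D * G^`M(1) - e') by ring.
  by apply: in_ideal2D; apply: in_ideal2Ml.
have pull p : near (Phi p) -> exists2 e, ord_ge N1 e &
    in_ideal2 F^`M(0) F^`M(1) (Psi D * p - e).
  move=> [e he [u [v E]]].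
  pose r q := Psi (Phi q) - q.
  have rN q : ord_ge N1 (r q) by apply: ord_ge_le (PsiPhi q).
  exists (Psi e + Psi u * r F^`M(0) + Psi v * r F^`M(1) - Psi D * r p).
    apply: ord_geB; last exact: ord_geMr.
    apply: ord_geD; last exact: ord_geMr.
    by apply: ord_geD; [apply: Psi_ord | apply: ord_geMr].
  by exists (Psi u), (Psi v); apply: in_ideal2_pull.
have Psi_D0 : (Psi D)@_0%MM != 0.
  by rewrite subst_coef0 // D0 expf_neq0.
have hN0 p : ord_ge N0 p -> exists2 e, ord_ge N0.+1 e &
    in_ideal2 F^`M(0) F^`M(1) (Psi D * p - e).
  move=> hp; have [|e he h] := pull p; last first.
  - by exists e => //; apply: ord_ge_le he; rewrite /N1 ltnS leq_addr.
  - apply: near_ideal.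
    have [u [v ->]] := ord_ge_ideal2 (Phi_ord _ _ hp).
    by apply: in_ideal2D; apply: in_ideal2Ml.
have [c [c0 hc]] := nakayama_det hN0.
have nearF : near (Phi F).
  have [|e he h] := near_ideal G.
    rewrite {3}euler; apply: in_ideal2_sum => i; rewrite -mul_mpolyC mulrA.
    apply: in_ideal2Ml; elim/ord2_ind: i; first by exists 1, 0; rewrite mul1r mul0r addr0.
    by exists 0, 1; rewrite mul1r mul0r add0r.
  exists (D * (Phi F - U * G) + U * e).
    apply: ord_geD; apply: ord_geMr => //.
    by apply: ord_ge_le XU.
  have -> : D * Phi F - (D * (Phi F - U * G) + U * e) = U * (D * G - e) by ring.
  exact: in_ideal2Ml.
have [e he hF] := pull F nearF.
exists N0, (c * Psi D); split.
- by rewrite rmorphM /= c0 mulf_neq0 ?expf_neq0.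
- by rewrite mulrAC mulrC; apply/in_ideal2Ml/hc/ord_geX/ord_ge1X.
- by rewrite mulrAC mulrC; apply/in_ideal2Ml/hc/ord_geX/ord_ge1X.
have -> : c * Psi D * F = c * (Psi D * F - e) + c * e by ring.
apply: in_ideal2D; first exact: in_ideal2Ml.
by apply: hc; apply: ord_ge_le he; rewrite /N1; lia.
Qed.

End LocalIdeal.

(** * The normal forms of the simple singularities *)

Section NormalForms.
Variable k : fieldType.
Hypothesis chark : [pchar k] =i pred0.
Local Notation P := {mpoly k[2]}.
Local Notation X a b := ('X_[mnm2 a b] : P).

Lemma natr_neq0 n : n.+1%:R != 0 :> k.
Proof. by rewrite ((pcharf0P k).1 chark). Qed.

Lemma mderiv0_mnm2 a b : (X a b)^`M(0) = a%:R%:MP * X a.-1 b.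
Proof.
rewrite mderivX mnm2E mul_mpolyC; congr (_ *: 'X_[_]).
by apply/mnmP; apply: ord2_ind; rewrite mnmBE mnm1E !mnm2E ?subn1 ?subn0.
Qed.

Lemma mderiv1_mnm2 a b : (X a b)^`M(1) = b%:R%:MP * X a b.-1.
Proof.
rewrite mderivX mnm2E mul_mpolyC; congr (_ *: 'X_[_]).
by apply/mnmP; apply: ord2_ind; rewrite mnmBE mnm1E !mnm2E ?subn1 ?subn0.
Qed.

Lemma mulX_deriv a b (v : 'I_2 -> k) :
  \sum_i v i *: ('X_i * (X a b)^`M(i)) = (v 0 * a%:R + v 1 * b%:R)%:MP * X a b.
Proof.
rewrite big_ord_recl big_ord1.
have -> : lift ord0 ord0 = 1 :> 'I_2 by apply: val_inj.
rewrite mderiv0_mnm2 mderiv1_mnm2 -!mul_mpolyC !mpolyX_mnm2 mpolyCD !mpolyCM.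
have e0 : a%:R%:MP * 'X_0 ^+ a = 'X_0 * (a%:R%:MP * 'X_0 ^+ a.-1) :> P.
  by case: a => [|a]; rewrite ?mpolyC0 ?mul0r ?mulr0 //= exprS mulrCA.
have e1 : b%:R%:MP * 'X_1 ^+ b = 'X_1 * (b%:R%:MP * 'X_1 ^+ b.-1) :> P.
  by case: b => [|b]; rewrite ?mpolyC0 ?mul0r ?mulr0 //= exprS mulrCA.
transitivity ((v 0)%:MP * (a%:R%:MP * 'X_0 ^+ a) * 'X_1 ^+ b + (v 1)%:MP * (b%:R%:MP * 'X_1 ^+ b) * 'X_0 ^+ a : P).
  by rewrite e0 e1; ring.
ring.
Qed.

(** All normal forms are differences of two monomials, and weights for which both have
    weight 1 give the Euler identity. *)
Lemma binomial_local_ideal (F : P) (a1 b1 a2 b2 a b mo : nat) (w0 w1 : k) :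
  let G := X a1 b1 - X a2 b2 in
  w0 * a1%:R + w1 * b1%:R = 1 -> w0 * a2%:R + w1 * b2%:R = 1 ->
  (2 <= mo)%N -> (mo <= a1 + b1)%N -> (mo <= a2 + b2)%N ->
  in_ideal2 (a1%:R%:MP * X a1.-1 b1 - a2%:R%:MP * X a2.-1 b2)
     (b1%:R%:MP * X a1 b1.-1 - b2%:R%:MP * X a2 b2.-1) ('X_0 ^+ a) ->
  in_ideal2 (a1%:R%:MP * X a1.-1 b1 - a2%:R%:MP * X a2.-1 b2)
     (b1%:R%:MP * X a1 b1.-1 - b2%:R%:MP * X a2 b2.-1) ('X_1 ^+ b) ->
  has_order F mo -> analytically_equivalent F G ->
  isolated_quasi_homogeneous F.
Proof.
move=> G h1 h2 mo2 m1 m2 Ga Gb Fmo FG.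
have ed0 : G^`M(0) = a1%:R%:MP * X a1.-1 b1 - a2%:R%:MP * X a2.-1 b2.
  by rewrite mderivB !mderiv0_mnm2.
have ed1 : G^`M(1) = b1%:R%:MP * X a1 b1.-1 - b2%:R%:MP * X a2 b2.-1.
  by rewrite mderivB !mderiv1_mnm2.
apply: (@local_ideal k F G (fun i => if i == 0 then w0 else w1) a b mo) => //.
- transitivity (\sum_i (if i == 0 then w0 else w1) *: ('X_i * (X a1 b1)^`M(i)) -
                \sum_i (if i == 0 then w0 else w1) *: ('X_i * (X a2 b2)^`M(i))).
    by rewrite !mulX_deriv /= h1 h2 mpolyC1 !mul1r.
  rewrite -sumrB; apply: eq_bigr => i _.
  by rewrite /G mderivB mulrBr scalerBr.
- by rewrite ed0 ed1.
- by rewrite ed0 ed1.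
- apply: ord_geB; apply: ord_ge_le (@ord_ge_mnm _ _ _); rewrite mdeg_mnm2 //.
Qed.

Lemma simple_germ_local_ideal (F : P) : simple_germ F ->
  isolated_quasi_homogeneous F.
Proof.
have inv n (p : P) : (n.+1%:R^-1)%:MP * (n.+1%:R%:MP * p) = p.
  by rewrite mulrA -mpolyCM mulVf ?natr_neq0 // mpolyC1 mul1r.
have n2 := natr_neq0 1; have n3 := natr_neq0 2; have n4 := natr_neq0 3.
have n5 := natr_neq0 4.
case=> [[F2 [n [n1 FG]]]|[F3 [[n [n1 FG]]|FG|FG|FG]]].
- have nn := natr_neq0 n.
  apply: (@binomial_local_ideal F 0 2 n.+1 0 n 1 2 (n.+1%:R^-1) (2%:R^-1)) => //.
  + by rewrite mulr0 add0r mulVf.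
  + by rewrite mulr0 addr0 mulVf.
  + by rewrite addn0.
  + exists (- (n.+1%:R^-1)%:MP), 0; rewrite !(mpolyC0, mul0r, addr0, sub0r) mulrNN inv.
    by rewrite mpolyX_mnm2 expr0 mulr1.
  + exists 0, (2%:R^-1)%:MP; rewrite !(mpolyC0, mul0r, add0r, subr0) inv.
    by rewrite mpolyX_mnm2 expr0 mul1r.
  + by rewrite !mpolyX_mnm2 !expr0 mul1r mulr1.
- have nn := natr_neq0 n.+1.
  have d2 : (2%:R^-1)%:MP * 2%:R%:MP = 1 :> P by rewrite -mpolyCM mulVf ?mpolyC1.
  have dn : (n.+2%:R^-1)%:MP * n.+2%:R%:MP = 1 :> P by rewrite -mpolyCM mulVf ?mpolyC1.
  apply: (@binomial_local_ideal F 1 2 n.+2 0 n.+2 3 3 (n.+2%:R^-1)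
    ((1 - n.+2%:R^-1) / 2%:R)) => //.
  + by rewrite mulr1 divfK // addrC subrK.
  + by rewrite mulr0 addr0 mulVf.
  + by rewrite addn0.
  + move: dn d2; move: (n.+2%:R^-1)%:MP n.+2%:R%:MP (2%:R^-1)%:MP 2%:R%:MP => cn' cn c2' c2 dn d2.
    exists (- cn' * 'X_0), (cn' * c2' * 'X_1).
    rewrite !mpolyX_mnm2 /= mpolyC1 mpolyC0 !mul0r !expr0 !mulr1 !mul1r subr0 !expr1 [in LHS]exprS.
    apply: (@eq_of_sub _ _ _ ((1 - cn' * cn) * ('X_0 * 'X_0 ^+ n.+1) + (1 - c2' * c2) * cn' * 'X_0 * 'X_1 ^+ 2)).
      by ring.
    by rewrite dn d2 subrr !mul0r addr0.
  + move: d2; move: n.+2%:R%:MP (2%:R^-1)%:MP 2%:R%:MP => cn c2' c2 d2.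
    exists 'X_1, (cn * c2' * 'X_0 ^+ n).
    rewrite !mpolyX_mnm2 /= mpolyC1 mpolyC0 !mul0r !expr0 !mulr1 !mul1r subr0 !expr1 ['X_0 ^+ n.+1]exprS.
    apply: (@eq_of_sub _ _ _ ((1 - c2' * c2) * cn * 'X_0 * 'X_0 ^+ n * 'X_1)).
      by ring.
    by rewrite d2 subrr !mul0r.
  + by rewrite !mpolyX_mnm2 !expr0 mulr1 expr1 mulrC.
- apply: (@binomial_local_ideal F 3 0 0 4 2 3 3 (3%:R^-1) (4%:R^-1)) => //.
  + by rewrite mulr0 addr0 mulVf.
  + by rewrite mulr0 add0r mulVf.
  + exists (3%:R^-1)%:MP, 0; rewrite !(mpolyC0, mul0r, addr0, subr0) inv.
    by rewrite mpolyX_mnm2 expr0 mulr1.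
  + exists 0, (- (4%:R^-1)%:MP); rewrite !(mpolyC0, mul0r, add0r, sub0r) mulrNN inv.
    by rewrite mpolyX_mnm2 expr0 mul1r.
  + by rewrite !mpolyX_mnm2 !expr0 mul1r mulr1.
- have d3 : (3%:R^-1)%:MP * 3%:R%:MP = 1 :> P by rewrite -mpolyCM mulVf ?mpolyC1.
  apply: (@binomial_local_ideal F 0 3 3 1 5 3 3 (2%:R / 9%:R) (3%:R^-1)) => //.
  + by rewrite mulr0 add0r mulVf.
  + by rewrite mulr1; field; rewrite n3 (natr_neq0 8).
  + exists (- 'X_1), (- 'X_0 ^+ 2).
    by rewrite !mpolyX_mnm2 /= mpolyC1 mpolyC0 !mul0r !expr0 !mulr1 !mul1r; ring.
  + move: d3; move: (3%:R^-1)%:MP 3%:R%:MP => c3' c3 d3.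
    exists (- c3' * c3' * 'X_0), (c3' * 'X_1).
    rewrite !mpolyX_mnm2 /= mpolyC1 mpolyC0 !mul0r !expr0 !mulr1 !mul1r sub0r.
    apply: (@eq_of_sub _ _ _ ((1 - c3' * c3) * ('X_1 ^+ 3 + c3' * 'X_0 ^+ 3 * 'X_1))).
      by ring.
    by rewrite d3 subrr mul0r.
  + by rewrite !mpolyX_mnm2 !expr0 mul1r expr1 mulrC.
- apply: (@binomial_local_ideal F 3 0 0 5 2 4 3 (3%:R^-1) (5%:R^-1)) => //.
  + by rewrite mulr0 addr0 mulVf.
  + by rewrite mulr0 add0r mulVf.
  + exists (3%:R^-1)%:MP, 0; rewrite !(mpolyC0, mul0r, addr0, subr0) inv.
    by rewrite mpolyX_mnm2 expr0 mulr1.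
  + exists 0, (- (5%:R^-1)%:MP); rewrite !(mpolyC0, mul0r, add0r, sub0r) mulrNN inv.
    by rewrite mpolyX_mnm2 expr0 mul1r.
  + by rewrite !mpolyX_mnm2 !expr0 mul1r mulr1.
Qed.

End NormalForms.

(** * Homogeneous polynomials and linear changes of coordinates *)

Lemma reg_upto1X (n : nat) (R : idomainType) (i j : 'I_n) N : i != j ->
  reg_upto 1 ('X_i ^+ N : {mpoly R[n]}) ('X_j ^+ N).
Proof.
move=> ij; have X0 (l : 'I_n) : 'X_l != 0 :> {mpoly R[n]}.
  by rewrite -msize_poly_eq0 msizeX.
suff h : reg_upto 1 ('X_i : {mpoly R[n]}) 'X_j.
  by have := @reg_uptoXX _ _ _ _ N h; rewrite !expr1n.
move=> A B AB; have [|t tA] := @mulX_of_coeff n R A U_(j)%MM.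
  move=> m; rewrite lep1mP negbK => mj.
  have := congr1 (mcoeff (m + U_(i))%MM) AB.
  rewrite !mcoeff_mulX lem_addl addmK lep1mP mnmDE mnm1E (negPf ij) addn0 (eqP mj) /=.
  by [].
exists t; rewrite !mul1r; split=> //.
by apply: (mulIf (X0 j)); rewrite -AB tA mulrAC.
Qed.

Lemma X2_regular (R : comNzRingType) (N : nat) (A u v : {mpoly R[3]}) :
  A * 'X_(1 + 1) ^+ N = u * 'X_0 ^+ N + v * 'X_1 ^+ N ->
  exists u' v', A = u' * 'X_0 ^+ N + v' * 'X_1 ^+ N.
Proof.
move=> E; apply: mem_monomial_ideal2 => m m0 m1.
have := congr1 (mcoeff (m + U_(1 + 1)%R *+ N)%MM) E.
rewrite mpolyXn mcoeff_mulX lem_addl addmK => ->.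
by rewrite mcoeffD !mcoeff_mulXn ?addr0 // mnmDE mulmnE mnm1E /= mul0n addn0.
Qed.

Section Homogeneous.
Variables (n : nat) (k : fieldType).
Local Notation P := {mpoly k[n]}.

Lemma mderiv_homog (f : P) d i : f \is d.-homog -> f^`M(i) \is d.-1.-homog.
Proof.
move=> fd; apply/dhomogP => m; rewrite mcoeff_msupp mcoeff_deriv => h.
have : (m + U_(i))%MM \in msupp f.
  by rewrite mcoeff_msupp; apply: contraNneq h => ->; rewrite mul0rn.
by move/dhomogP: fd => fd /fd; rewrite /= mdegD mdeg1 addn1 => <-.
Qed.

Lemma euler_homog (f : P) d : f \is d.-homog -> \sum_i 'X_i * f^`M(i) = d%:R *: f.
Proof.
move=> fd; rewrite {2}[f]mpolyE scaler_sumr.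
transitivity (\sum_i \sum_(m <- msupp f) (f@_m * (m i)%:R) *: 'X_[m]).
  apply: eq_bigr => i _; rewrite {1}[f]mpolyE raddf_sum mulr_sumr /=.
  apply: eq_bigr => m _; rewrite mderivZ mderivX -!scalerAr -mpolyXD scalerA.
  have [mi0|mi0] := eqVneq (m i) 0%N; first by rewrite mi0 mulr0 !scale0r.
  by rewrite addmC submK ?lep1mP.
rewrite exchange_big /= big_seq [RHS]big_seq; apply: eq_bigr => m mf.
rewrite -scaler_suml -mulr_sumr -natr_sum -mdegE scalerA mulrC.
by move/dhomogP: fd => /(_ m mf) /= ->.
Qed.

Lemma meval_homog (f : P) d a v : f \is d.-homog ->
  f.@[fun i => a * v i] = a ^+ d * f.@[v].
Proof.
move=> fd; rewrite !mevalE mulr_sumr big_seq [RHS]big_seq; apply: eq_bigr => m mf.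
under eq_bigr => i _ do rewrite exprMn.
rewrite big_split /= prodrXr -mdegE mulrCA.
by move/dhomogP: fd => /(_ m mf) /= ->.
Qed.

End Homogeneous.

Section LinearChange.
Variable k : fieldType.
Local Notation P := {mpoly k[3]}.
Implicit Types (T S : 'M[k]_3) (p : P).

HB.instance Definition _ T := GRing.RMorphism.copy (coord_change T)
  (comp_mpoly [tuple \sum_j T i j *: 'X_j | i < 3]).

Lemma coord_changeC T c : coord_change T c%:MP = c%:MP.
Proof. exact: comp_mpolyC. Qed.

Lemma coord_changeZ T c p : coord_change T (c *: p) = c *: coord_change T p.
Proof. exact: comp_mpolyZ. Qed.

Lemma coord_changeX T i : coord_change T 'X_i = \sum_j T i j *: 'X_j.
Proof. by rewrite /coord_change comp_mpolyXU -tnth_nth tnth_mktuple. Qed.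

Lemma coord_change_comp T S p :
  coord_change T (coord_change S p) = coord_change (S *m T) p.
Proof.
apply: (@mpoly_rmorph_ext _ _ _ (coord_change T \o coord_change S)
  (coord_change (S *m T))) => [c|i] /=; first by rewrite !coord_changeC.
rewrite !coord_changeX rmorph_sum /=.
transitivity (\sum_j \sum_l (S i j * T j l) *: 'X_l : P).
  apply: eq_bigr => j _; rewrite coord_changeZ coord_changeX scaler_sumr.
  by apply: eq_bigr => l _; rewrite scalerA.
rewrite exchange_big; apply: eq_bigr => l _ /=.
by rewrite -scaler_suml mxE.
Qed.

Lemma coord_change1 p : coord_change 1%:M p = p.
Proof.
apply: (@mpoly_rmorph_ext _ _ _ (coord_change 1%:M) idfun) => [c|i] /=.
  exact: coord_changeC.
rewrite coord_changeX (bigD1 i) //= mxE eqxx scale1r big1 ?addr0 // => j ji.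
by rewrite mxE eq_sym (negPf ji) scale0r.
Qed.

Lemma coord_changeK T : T \in unitmx ->
  cancel (coord_change T) (coord_change (invmx T)).
Proof. by move=> TU p; rewrite coord_change_comp mulmxV // coord_change1. Qed.

Lemma coord_changeVK T : T \in unitmx ->
  cancel (coord_change (invmx T)) (coord_change T).
Proof. by move=> TU p; rewrite coord_change_comp mulVmx // coord_change1. Qed.

Lemma coord_change_eval T p (v : 'cV[k]_3) :
  (coord_change T p).@[fun i => v i 0] = p.@[fun i => (T *m v) i 0].
Proof.
rewrite comp_mpoly_meval; apply: meval_eq => i.
rewrite tnth_mktuple raddf_sum mxE; apply: eq_bigr => j _.
by rewrite /= mevalZ mevalXU.
Qed.

Lemma coord_change_deriv T p j :
  (coord_change T p)^`M(j) = \sum_i T i j *: coord_change T p^`M(i).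
Proof.
have := @subst_deriv 3 k (fun i => \sum_j T i j *: 'X_j) p j => ->.
apply: eq_bigr => i _; rewrite -[X in X * _]/(coord_change T _).
have -> : (\sum_j T i j *: 'X_j)^`M(j) = (T i j)%:MP :> P.
  rewrite raddf_sum /= (bigD1 j) //= mderivZ mderiv_var eqxx big1 => [|l lj].
    by rewrite addr0 mpolyC1 -alg_mpolyC.
  by rewrite mderivZ mderiv_var (negPf lj) mpolyC0 scaler0.
by rewrite mulrC mul_mpolyC.
Qed.

Lemma coord_change_homog T p d : p \is d.-homog -> coord_change T p \is d.-homog.
Proof.
move=> pd; rewrite [p]mpolyE rmorph_sum big_seq; apply: rpred_sum => m mp.
rewrite /= coord_changeZ; apply: rpredZ; have <- : mdeg m = d by move/dhomogP: pd => /(_ m mp).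
rewrite mpolyXE_id rmorph_prod mdegE /=.
elim/big_rec2: _ => [|i a b _ h]; first exact: dhomog1.
apply: dhomogM => //; rewrite rmorphXn /= -[X in X.-homog]mul1n; apply: dhomogMn.
by rewrite coord_changeX; apply: rpred_sum => j _; apply: rpredZ; rewrite dhomogX /= mdeg1.
Qed.

End LinearChange.

(** * The syzygy at a simple singularity *)

Section LocalSyzygy.
Variables (k : fieldType) (f : {mpoly k[3]}) (d : nat).
Hypothesis chark : [pchar k] =i pred0.
Hypothesis d1 : (0 < d)%N.
Hypothesis fd : f \is d.-homog.
Local Notation P := {mpoly k[3]}.
Local Notation f0 := (f^`M(0)).
Local Notation f1 := (f^`M(1)).

(** The point [0:0:1]. *)
Definition e3 (i : 'I_3) : k := (i == 1 + 1)%:R.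

Lemma dehomog_z_eval (p : P) v :
  (dehomog_z p).@[v] = p.@[fun i => if i == 0 then v 0 else if i == 1 then v 1 else 1].
Proof.
rewrite /dehomog_z comp_mpoly_meval; apply: meval_eq.
by apply: ord3_ind; rewrite (tnth_nth 0) /= ?mevalXU ?meval1.
Qed.

Lemma meval_at0 (p : {mpoly k[2]}) : p.@[fun=> 0] = p@_0%MM.
Proof.
apply: (@mpoly_rmorph_ext _ _ _ (meval (fun=> 0)) (mcoeff 0%MM)) => [c|i] /=.
  by rewrite mevalC mcoeffC eqxx mulr1.
by rewrite mevalXU mcoeffX mnm1_eq0.
Qed.

Lemma homog_z_eval_e3 M c : (msize c <= M.+1)%N -> (homog_z M c).@[e3] = c@_0%MM :> k.
Proof.
move=> cM; rewrite -meval_at0 -[in RHS](homog_zK cM) dehomog_z_eval.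
by apply: meval_eq; apply: ord3_ind.
Qed.

Lemma dehomog_z_deriv (p : P) (i : 'I_2) (j : 'I_3) : i = j :> nat ->
  (dehomog_z p)^`M(i) = dehomog_z p^`M(j).
Proof.
have dhC c : dehomog_z c%:MP = c%:MP by exact: comp_mpolyC.
have dhD p' q : dehomog_z (p' + q) = dehomog_z p' + dehomog_z q :> {mpoly k[2]}.
  exact: comp_mpolyD.
have dhM p' q : dehomog_z (p' * q) = dehomog_z p' * dehomog_z q :> {mpoly k[2]}.
  by rewrite /dehomog_z rmorphM.
have dh0 : dehomog_z 0 = 0 :> {mpoly k[2]} by exact: comp_mpoly0.
move=> ij; elim/mpoly_gen_ind: p => [c|l|p q hp hq|p q hp hq].
- by rewrite dhC !mderivC dh0.
- rewrite mderiv_var dhC /dehomog_z comp_mpolyXU.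
  have ji : (j < 2)%N by rewrite -ij.
  elim/ord3_ind: l => /=; rewrite ?mderiv_var -?mpolyC1 ?mderivC.
  + by congr ((_%:R)%:MP); rewrite -!val_eqE /= ij.
  + by congr ((_%:R)%:MP); rewrite -!val_eqE /= ij.
  + by rewrite -val_eqE /=; case: eqP ji => [<-|_] //; rewrite mpolyC0.
- by rewrite dhD !mderivD dhD hp hq.
- by rewrite dhM !mderivM dhD !dhM hp hq.
Qed.

(** A common M can be chosen for several memberships, since all large M work. *)
Lemma homogenise_membership (c : {mpoly k[2]}) (Q : P) q : Q \is q.-homog ->
  in_ideal2 (dehomog_z f0) (dehomog_z f1) (c * dehomog_z Q) ->
  exists M0, forall M, (M0 <= M)%N -> exists al be,
    [/\ al \is (M + q - d.-1).-homog, be \is (M + q - d.-1).-homog &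
        homog_z M c * Q = al * f0 + be * f1].
Proof.
move=> Qq [u [v E]].
exists (msize c + msize u + msize v + d)%N => M hM.
pose M' := (M + q - d.-1)%N.
exists (homog_z M' u), (homog_z M' v); split; [exact: homog_z_homog..|].
have eM : (M + q = M' + d.-1)%N by rewrite /M'; lia.
have hu : (msize u <= M'.+1)%N by rewrite /M'; lia.
have hv : (msize v <= M'.+1)%N by rewrite /M'; lia.
rewrite -(homog_zM _ Qq); last by lia.
rewrite E raddfD /= eM !(homog_zM (e := d.-1)) ?mderiv_homog //.
Qed.

(** Homogenising c F in (F_x, F_y) gives C f = al f_0 + be f_1.  Substituting the Euler
    formula for d f turns it into the syzygy
    (C x - d al, C y - d be, C z), whose last entry does not vanish at [0:0:1]. *)
Lemma local_syzygy : simple_germ (dehomog_z f) ->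
  exists (C : P) (s : 'I_3 -> P) (N M : nat),
  [/\ (C \is M.-homog) /\ (forall i, s i \is M.+1.-homog),
      \sum_i s i * f^`M(i) = 0,
      C.@[e3] != 0 /\ (s (1 + 1)).@[e3] != 0,
      in_ideal2 f0 f1 (C * 'X_0 ^+ N) & in_ideal2 f0 f1 (C * 'X_1 ^+ N)].
Proof.
move=> /(simple_germ_local_ideal chark)[N [c [c0 hx hy hf]]].
rewrite (@dehomog_z_deriv f 0 0) // (@dehomog_z_deriv f 1 1) // in hx hy hf.
have X0 : 'X_0 = dehomog_z 'X_0 :> {mpoly k[2]} by rewrite /dehomog_z comp_mpolyXU.
have X1 : 'X_1 = dehomog_z 'X_1 :> {mpoly k[2]} by rewrite /dehomog_z comp_mpolyXU.
have XN (i : 'I_3) : ('X_i ^+ N : P) \is N.-homog.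
  by rewrite -{2}[N]mul1n; apply: dhomogMn; rewrite dhomogX /= mdeg1.
rewrite X0 /dehomog_z -rmorphXn -!/(dehomog_z _) in hx.
rewrite X1 /dehomog_z -rmorphXn -!/(dehomog_z _) in hy.
have [Mx hMx] := homogenise_membership (XN 0) hx.
have [My hMy] := homogenise_membership (XN 1) hy.
have [Mf hMf] := homogenise_membership fd hf.
pose M := (Mx + My + Mf + msize c)%N.
have [a1 [b1 [_ _ ex]]] := hMx M ltac:(rewrite /M; lia).
have [a2 [b2 [_ _ ey]]] := hMy M ltac:(rewrite /M; lia).
have [al [be [ald bed ef]]] := hMf M ltac:(rewrite /M; lia).
have Md : (M + d - d.-1 = M.+1)%N by lia.
rewrite Md in ald bed.
set C := homog_z M c in ex ey ef.
have Ch : C \is M.-homog by apply: homog_z_homog.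
have C0 : C.@[e3] = c@_0%MM by apply: homog_z_eval_e3; rewrite /M leqW // leq_addl.
have CX (i : 'I_3) : C * 'X_i \is M.+1.-homog.
  by rewrite -(addn1 M); apply: dhomogM => //; rewrite dhomogX /= mdeg1.
exists C, (fun i => C * 'X_i - d%:R *: (if i == 0 then al else if i == 1 then be else 0)), N, M.
split.
- split=> // i; apply: rpredB; first exact: CX.
  apply: dhomogZ.
  by case: ifP => // _; case: ifP => // _; apply: dhomog0.
- transitivity (C * (\sum_i 'X_i * f^`M(i)) - d%:R *: (al * f0 + be * f1)).
    rewrite !(@big_ord3 _ _ 0 1 (1 + 1)) //= -!mul_mpolyC; ring.
  by rewrite (euler_homog fd) -ef -scalerAr subrr.
- rewrite C0; split=> //=.
  by rewrite scaler0 subr0 mevalM mevalXU C0 /e3 /= mulr1.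
- by exists a1, b1.
- by exists a2, b2.
Qed.

End LocalSyzygy.

(** * Good elements at every point *)

Lemma reg_upto1_cancel (A : nzRingType) (g h : {rmorphism A -> A}) (a b : A) :
  cancel g h -> cancel h g -> reg_upto 1 a b -> reg_upto 1 (g a) (g b).
Proof.
move=> gK hK ab x y /(congr1 h); rewrite !rmorphM !gK => /ab[t [e1 e2]].
by exists (g t); rewrite -!rmorphM -e1 -e2 !rmorphM !rmorph1 !hK.
Qed.

Section GoodAtPoints.
Variables (k : closedFieldType) (d : nat) (f : {mpoly k[3]}).
Hypothesis chark : [pchar k] =i pred0.
Hypothesis d1 : (0 < d)%N.
Hypothesis fd : f \is d.-homog.
Local Notation P := {mpoly k[3]}.
Local Notation crd v := (fun i => (v : 'cV[k]_3) i 0).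

(** Where s_l is invertible the syzygy expresses f_l through the other two, and where C
    is invertible the ideal contains the regular sequence u, v. *)
Lemma good_of_syzygy (s : 'I_3 -> P) (C u v : P) l :
  s l != 0 -> C != 0 -> u != 0 -> reg_upto 1 u v ->
  \sum_i s i * gradient f i = 0 ->
  (exists a, C * u = \sum_i a i * gradient f i) ->
  (exists a, C * v = \sum_i a i * gradient f i) ->
  good (gradient f) (s l * C).
Proof.
move=> sl0 C0 u0 uv s0 [a ha] [b hb]; have [i [j U]] := exists_other l.
exists i, j, l, (fun m => s m * C); split=> //; first exact: mulf_neq0.
  rewrite (eq_bigr (fun m => C * (s m * gradient f m))); last by move=> m _; ring.
  by rewrite -mulr_sumr s0 mulr0.
move: s0 ha hb; rewrite !(big_ord3 _ U) => s0 ha hb.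
apply: (@reg_upto_of_regular _ _ u v _ _ (s l * a i - a l * s i) (s l * a j - a l * s j)
   (s l * b i - b l * s i) (s l * b j - b l * s j)) => //; first exact: mulf_neq0.
  rewrite -mulrA ha; apply: (@eq_of_sub _ _ _ (a l * (s i * gradient f i + s j * gradient f j + s l * gradient f l))).
    by ring.
  by rewrite s0 mulr0.
rewrite -mulrA hb; apply: (@eq_of_sub _ _ _ (b l * (s i * gradient f i + s j * gradient f j + s l * gradient f l))).
  by ring.
by rewrite s0 mulr0.
Qed.

(** Where f_l is invertible the ideal is the unit ideal, and the Koszul syzygies
    suffice. *)
Lemma good_gradient l : gradient f l != 0 -> good (gradient f) (gradient f l).
Proof.
move=> fl0; have [i [j U]] := exists_other l.
have U' : uniq [:: l; i; j] by rewrite /= !inE !(uniq3_neq U).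
exists l, i, j, (fun m => if m == j then gradient f l else if m == l then - gradient f j else 0).
split=> //; first by rewrite eqxx.
  rewrite (big_ord3 _ U') !(uniq3_neq U) !eqxx /=; ring.
by move=> A B AB; exists B; rewrite [_ * A]mulrC AB mulrC; split; rewrite // mulrC.
Qed.

Lemma good_at_smooth (p : 'cV[k]_3) l : (gradient f l).@[crd p] != 0 ->
  exists c, [/\ good (gradient f) c, exists e, c \is e.-homog & c.@[crd p] != 0].
Proof.
move=> fp; exists (gradient f l); split=> //.
  by apply: good_gradient; apply: contraNneq fp => ->; rewrite meval0.
by exists d.-1; apply: mderiv_homog.
Qed.

(** Transport of [local_syzygy] along T.  By the chain rule the gradient transforms by
    the transpose of T and syzygies by T itself, so a syzygy that does not vanish at
    [0:0:1] becomes one that does not vanish at p; one of its entries, times C, is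
    good. *)
Lemma good_at_singular (p : 'cV[k]_3) : simple_singularity f p ->
  exists c, [/\ good (gradient f) c, exists e, c \is e.-homog & c.@[crd p] != 0].
Proof.
move=> [T [TU [c0 c0n0 Tp] sg]].
have [C [s [N [M [[Ch sh] s0 [C3 s3] hx hy]]]]] :=
  local_syzygy chark d1 (coord_change_homog T fd) sg.
pose tau : {rmorphism P -> P} := coord_change (invmx T).
pose tau' : {rmorphism P -> P} := coord_change T.
have tauK : cancel tau tau' by exact: coord_changeVK.
have tau'K : cancel tau' tau by exact: coord_changeK.
have tauE (q : P) : (tau q).@[crd (c0 *: p)] = q.@[@e3 k].
  rewrite coord_change_eval; apply: meval_eq => i.
  rewrite -Tp colE mulmxA mulVmx // mul1mx mxE andbT /e3.
  by congr ((_ == _)%:R); apply: val_inj.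
have taud j : tau (coord_change T f)^`M(j) = \sum_i T i j *: gradient f i.
  rewrite coord_change_deriv rmorph_sum /=; apply: eq_bigr => i _.
  by rewrite coord_changeZ [coord_change _ (coord_change _ _)]tau'K.
have tau_homog q e : q \is e.-homog -> tau q \is e.-homog by apply: coord_change_homog.
pose S i := \sum_j T i j *: tau (s j).
have S0 : \sum_i S i * gradient f i = 0.
  transitivity (tau (\sum_j s j * (coord_change T f)^`M(j))); last by rewrite s0 rmorph0.
  rewrite rmorph_sum /S; under eq_bigr => i _ do rewrite mulr_suml.
  rewrite exchange_big; apply: eq_bigr => j _ /=.
  rewrite rmorphM taud mulr_sumr; apply: eq_bigr => i _.
  by rewrite -scalerAl -scalerAr.
have Sh i : S i \is M.+1.-homog.
  by apply: rpred_sum => j _; apply: dhomogZ; apply: tau_homog.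
have evZ (q : P) e : q \is e.-homog -> q.@[crd (c0 *: p)] = c0 ^+ e * q.@[crd p].
  by move=> qe; rewrite -(meval_homog _ _ qe); apply: meval_eq => i; rewrite mxE.
have [l Sl] : exists l, (S l).@[crd (c0 *: p)] != 0.
  apply/not_existsP => h; case/eqP: s3.
  pose w : 'cV[k]_3 := \col_j (s j).@[@e3 k].
  have Tw : T *m w = 0.
    apply/matrixP => i j; rewrite !mxE ord1.
    have /negP := h i; rewrite negbK => /eqP e; rewrite -[RHS]e /S raddf_sum.
    by apply: eq_bigr => l _; rewrite mxE /= mevalZ tauE.
  have w0 : w = 0 by rewrite -[w]mul1mx -(mulVmx TU) -mulmxA Tw mulmx0.
  by have := congr1 (fun w : 'cV[k]_3 => w (1 + 1) 0) w0; rewrite !mxE.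
have tC : (tau C).@[crd (c0 *: p)] != 0 by rewrite tauE.
have mem (q : P) : in_ideal2 (coord_change T f)^`M(0) (coord_change T f)^`M(1) q ->
    exists a, tau q = \sum_i a i * gradient f i.
  move=> [a [b ->]]; exists (fun i => tau a * (T i 0)%:MP + tau b * (T i 1)%:MP).
  rewrite rmorphD !rmorphM !taud !mulr_sumr -big_split; apply: eq_bigr => i _ /=.
  by rewrite -!mul_mpolyC; ring.
exists (S l * tau C); split.
- apply: (@good_of_syzygy S (tau C) (tau ('X_0 ^+ N)) (tau ('X_1 ^+ N)) l) => //.
  + by apply: contraNneq Sl => ->; rewrite meval0.
  + by apply: contraNneq tC => ->; rewrite meval0.
  + rewrite -[X in _ != X](rmorph0 tau) (inj_eq (can_inj tauK)) expf_neq0 //.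
    by rewrite -msize_poly_eq0 msizeX.
  + by apply: (reg_upto1_cancel tauK tau'K); apply: reg_upto1X.
  + by rewrite -rmorphM; apply: mem.
  + by rewrite -rmorphM; apply: mem.
- by exists (M.+1 + M)%N; apply: dhomogM => //; apply: tau_homog.
- rewrite mevalM mulf_neq0 //.
    by move: Sl; rewrite (evZ _ _ (Sh l)) mulf_eq0 negb_or => /andP[].
  by move: tC; rewrite (evZ _ _ (tau_homog _ _ Ch)) mulf_eq0 negb_or => /andP[].
Qed.

Hypothesis fsimple : forall p : 'cV[k]_3, singular_point f p -> simple_singularity f p.

(** By the Euler formula a common zero of the partial derivatives lies on the curve. *)
Lemma good_at_point (p : 'cV[k]_3) : p != 0 ->
  exists c, [/\ good (gradient f) c, exists e, c \is e.-homog & c.@[crd p] != 0].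
Proof.
move=> p0; have [[l fl]|h] := pselect (exists l, (gradient f l).@[crd p] != 0).
  exact: good_at_smooth fl.
apply/good_at_singular/fsimple; have h' i : (gradient f i).@[crd p] = 0.
  by apply/eqP/negP => /negP fi; apply: h; exists i.
split=> //; have := congr1 (fun q : P => q.@[crd p]) (euler_homog fd).
rewrite raddf_sum mevalZ big1 => [/esym/eqP|i _].
  case: d d1 => // d' _; rewrite mulf_eq0 (negPf (natr_neq0 chark _)).
  by move/eqP.
by rewrite /= mevalM [X in _ * X]h' mulr0.
Qed.

(** A transposition of the coordinates brings the chart of the m-th variable to that of
    the last one. *)
Lemma var_in_good (m : 'I_3) : exists M, 'X_m ^+ M \in ideal_span (good (gradient f)).
Proof.
pose T : 'M[k]_3 := tperm_mx m (1 + 1).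
have TT : T *m T = 1%:M by rewrite /T /tperm_mx -perm_mxM tperm2 perm_mx1.
have TU : T \in unitmx by case/mulmx1_unit: TT.
pose G : set P := [set coord_change T g | g in
  [set g | good (gradient f) g /\ exists e, g \is e.-homog]]%classic.
have [|v|M] := @nullstellensatz_chart k G.
- by move=> _ [g [_ [e ge]] <-]; exists e; apply: coord_change_homog.
- pose q : 'cV[k]_3 := \col_i (if i == 0 then v 0 else if i == 1 then v 1 else 1).
  have q0 : T *m q != 0.
    apply/eqP => /(congr1 (mulmx T)); rewrite mulmxA TT mul1mx mulmx0.
    move=> /(congr1 (fun w : 'cV[k]_3 => w (1 + 1) 0)); rewrite !mxE /= => /eqP.
    by rewrite oner_eq0.
  have [c [cg ch cq]] := good_at_point q0.
  exists (coord_change T c); first by exists c.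
  rewrite dehomog_z_eval; move: cq; rewrite -coord_change_eval.
  by congr (_ != 0); apply: meval_eq => i; rewrite mxE.
move=> /ideal_spanP[t tG E]; exists M.
have -> : 'X_m ^+ M = coord_change T ('X_(1 + 1) ^+ M) :> P.
  rewrite rmorphXn /= coord_changeX (bigD1 m) //= big1 ?addr0 => [|j jm].
    by rewrite !mxE tpermR eqxx scale1r.
  by rewrite !mxE tpermR eq_sym (negPf jm) scale0r.
rewrite E rmorph_sum big_seq; apply: rpred_sum => c /tG[g [gg _] <-].
rewrite rmorphM /= coord_change_comp TT coord_change1.
exact/ideal_spanM/mem_ideal_span.
Qed.

Lemma rees_kernel_syz (Q : {mpoly P[3]}) :
  rees_ev (gradient f) Q = 0 -> syz_form (gradient f) Q.
Proof.
have /choice[M hM] := var_in_good.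
pose N := (\sum_m M m)%N.
apply: (@syz_form_of_rees _ _ (fun m => 'X_m ^+ N)).
- by move=> n; rewrite -!exprM; apply: reg_upto1X.
- by move=> n A u v; rewrite -!exprM; apply: X2_regular.
- move=> m; rewrite /N (bigD1 m) //= exprD mulrC; exact: ideal_spanM.
- by move=> m; rewrite expf_neq0 // -msize_poly_eq0 msizeX.
Qed.

End GoodAtPoints.

Local Close Scope ring_scope.
Unset Implicit Arguments.

Theorem theorem2p7 (k : closedFieldType) (d : nat) (f : {mpoly k[3]})
    (chark : [pchar k]%R =i pred0)
    (d3 : 3 <= d)
    (f0 : (f != 0)%R)
    (fhomog : f \is d.-homog)
    (fred : reduced_mpoly f)
    (fsimple : forall p : 'cV[k]_3,
        singular_point f p -> simple_singularity f p) :
  gradient_linear_type f.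
Proof.
apply: linear_type_of_syz => Q hQ.
exact: (rees_kernel_syz chark (ltn_trans _ d3) fhomog fsimple hQ).
Qed.
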